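(* Let $(W_n)_{n\in\mathbf{N}}$, $W_n=(w_{ij})_{i,j=1}^n$, be a Hermitian Wigner ensemble with $\mathbf{E}w_{ij}=0$ and $\mathbf{E}|w_{ij}|^2<\infty$ for all $n$ and $i,j=1,\ldots,n$. Assume that $$\frac1n\sum_{i\in J_n}\sum_{j=1}^n \mathbf{E}|w_{ij}|^2\to 0 \quad\text{as } n\to\infty\text{, for any choice of } J_n\subset\{1,\ldots,n\} \text{ with } |J_n|/n\to 0,$$ and that the Lindeberg condition holds: $$\frac1n\sum_{i,j=1}^n \mathbf{E}\bigl[|w_{ij}|^2;|w_{ij}|>\epsilon\bigr]\to 0 \quad\text{for all }\epsilon>0.$$ Then $\mathbf{E}\mu_{W_n}\Rightarrow\mu_{\mathrm{sc}}$ if and only if $$\frac1n\sum_{i=1}^n\Bigl|\sum_{j=1}^n\mathbf{E}|w_{ij}|^2-1\Bigr|\to 0.$$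
   Context: A Hermitian Wigner ensemble is a sequence $(W_n)_{n\in\mathbf{N}}$ where $W_n=(w_{ij})_{i,j=1}^n$ is a random $n\times n$ (complex) Hermitian matrix whose upper triangular entries $w_{ij}$, $1\le i\le j\le n$, are independent. The entries $w_{ij}$ depend on $n$, but this is suppressed in the notation. For an $n\times n$ Hermitian matrix $A$ with eigenvalues $\lambda_1\ge\cdots\ge\lambda_n$ (with multiplicity), $\mu_A:=\frac1n\sum_{i=1}^n\delta_{\lambda_i}$. For a random probability measure $\mu$ on $\mathbf{R}$, $\mathbf{E}\mu$ is the Borel probability measure with distribution function $x\mapsto\mathbf{E}[\mu((-\infty,x])]$. $\mu_{\mathrm{sc}}$ is the semicircle distribution $\mu_{\mathrm{sc}}(dx)=\frac{1}{2\pi}\sqrt{(4-x^2)_+}\,dx$, where $x_+=\max\{x,0\}$. $\Rightarrow$ denotes weak convergence (convergence in distribution) of probability measures. $\mathbf{E}[X;A]:=\mathbf{E}[X\mathbf{1}_A]$. *)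

(* Defs.v *)
From HB Require Import structures.
From mathcomp Require Import all_boot all_order all_algebra.
From mathcomp Require Import sesquilinear spectral.
From mathcomp Require Import all_classical all_reals all_analysis.
From mathcomp Require Import measurable_realfun complex ring lra.

Set Implicit Arguments.
Unset Strict Implicit.
Unset Printing Implicit Defensive.

Import Order.TTheory GRing.Theory Num.Theory.
Import numFieldNormedType.Exports.

Local Open Scope classical_set_scope.
Local Open Scope ring_scope.

Section complex_random_variables.
Context d (T : measurableType d) (R : realType) (P : probability T R).

(* A complex variable is identified with the R * R-valued variable of its real
   and imaginary parts: R[i] carries no measurable structure in the library. *)
Definition re_im (X : T -> R[i]) (t : T) : R * R :=
  (complex.Re (X t), complex.Im (X t)).

Definition cmod (X : T -> R[i]) (t : T) : R := ComplexField.Normc.normc (X t).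

Definition mutually_independent d' (U : measurableType d') (I : finType)
    (D : {set I}) (X : I -> T -> U) : Prop :=
  forall (J : {set I}) (B : I -> set U), J \subset D ->
    (forall k, measurable (B k)) ->
    P (\bigcap_(k in [set k | k \in J]) (X k @^-1` B k)) =
      (\prod_(k in J) P (X k @^-1` B k))%E.

Definition upper_triangle (n : nat) : {set 'I_n * 'I_n} :=
  [set p : 'I_n * 'I_n | (p.1 <= p.2)%N]%SET.

Definition hermitian_wigner (n : nat) (W : T -> 'M[R[i]]_n) : Prop :=
  [/\ forall t, W t \is hermsymmx,
      forall i j, measurable_fun [set: T] (re_im (fun t => W t i j)) &
      mutually_independent (upper_triangle n)
        (fun p => re_im (fun t => W t p.1 p.2))].

Definition ccentered (X : T -> R[i]) : Prop :=
  ('E_P[fun t => complex.Re (X t)] = 0 /\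
   'E_P[fun t => complex.Im (X t)] = 0)%E.

Definition second_moment (X : T -> R[i]) : \bar R :=
  ('E_P[fun t => (cmod X t ^+ 2)%R])%E.

Definition truncated_second_moment (eps : R) (X : T -> R[i]) : \bar R :=
  ('E_P[fun t => (cmod X t ^+ 2 * \1_[set u | eps < cmod X u] t)%R])%E.

End complex_random_variables.

Section empirical_spectral_distribution.
Context (R : realType) (n : nat).

(* [spectral_diag A] lists the eigenvalues of a normal matrix with
   multiplicity; they are real when A is Hermitian. *)
Definition esd (A : 'M[R[i]]_n.+1) (B : set (measurableTypeR R)) : \bar R :=
  ((n.+1%:R^-1)%:E *
    \sum_(i < n.+1) \d_(complex.Re (spectral_diag A 0%R i)) B)%E.

Variable A : 'M[R[i]]_n.+1.

Let esd0 : esd A set0 = 0%E.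
Proof. by rewrite /esd big1 ?mule0// => i _; rewrite measure0. Qed.

Let esd_ge0 B : (0 <= esd A B)%E.
Proof.
by rewrite /esd mule_ge0 ?lee_fin ?invr_ge0//; exact: sume_ge0.
Qed.

Let esd_sigma_additive : semi_sigma_additive (esd A).
Proof.
pose a (k : nat) : measurableTypeR R := complex.Re (spectral_diag A 0 (inord k)).
have -> : esd A = mscale (n.+1%:R^-1)%:nng (msum (fun k => \d_(a k)) n.+1).
  apply/funext => B; rewrite /esd /mscale /msum/=; congr (_ * _)%E.
  by apply: eq_bigr => i _; rewrite /a inord_val.
exact: measure_semi_sigma_additive.
Qed.

HB.instance Definition _ := isMeasure.Build _ _ _ (esd A)
  esd0 esd_ge0 esd_sigma_additive.

Let esd_setT : esd A [set: _] = 1%E.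
Proof.
rewrite /esd (eq_bigr (fun=> 1%E)); last by move=> i _; rewrite diracT.
by rewrite sumEFin sumr_const card_ord -EFinM mulVf// pnatr_eq0.
Qed.

HB.instance Definition _ := Measure_isProbability.Build _ _ _ (esd A) esd_setT.

End empirical_spectral_distribution.

Section expected_measure.
Context d (T : measurableType d) (R : realType) (P : probability T R).
Implicit Type mu : T -> probability (measurableTypeR R) R.

Definition is_expected_measure mu
    (nu : probability (measurableTypeR R) R) : Prop :=
  forall x : R, nu `]-oo, x]%classic = (\int[P]_t mu t `]-oo, x]%classic)%E.

(* The distribution function determines [nu] on Borel sets; such a [nu] exists
   whenever [mu] is measurable (lemma [expected_measureP] below), so the Dirac
   default is only there to make the operation total. *)
Definition expected_measure mu : probability (measurableTypeR R) R :=
  match pselect (exists nu, is_expected_measure mu nu) with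
  | left h => projT1 (cid h)
  | right _ => @dirac _ (measurableTypeR R) 0 R
  end.

Section mixture.
Variable mu : T -> probability (measurableTypeR R) R.
Hypothesis mmu : forall B : set (measurableTypeR R), measurable B ->
  measurable_fun [set: T] (fun t => mu t B).

Definition mixture of (forall B : set (measurableTypeR R), measurable B ->
    measurable_fun [set: T] (fun t => mu t B)) :=
  fun B : set (measurableTypeR R) => (\int[P]_t mu t B)%E.

Let mixture0 : mixture mmu set0 = 0%E.
Proof. by rewrite /mixture integral0_eq// => t _; rewrite measure0. Qed.

Let mixture_ge0 B : (0 <= mixture mmu B)%E.
Proof. exact: integral_ge0. Qed.

Let mixture_sigma_additive : semi_sigma_additive (mixture mmu).
Proof.
move=> F mF tF mUF; rewrite /mixture.
have -> : (\int[P]_t mu t (\bigcup_n F n) =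
    \sum_(0 <= n <oo) \int[P]_t mu t (F n))%E.
  rewrite -integral_nneseries//; last by move=> n; exact: mmu.
  apply: eq_integral => t _; apply/esym/cvg_lim => //.
  exact: measure_semi_sigma_additive.
apply: is_cvg_nneseries => n _ _; exact: integral_ge0.
Qed.

HB.instance Definition _ := isMeasure.Build _ _ _ (mixture mmu)
  mixture0 mixture_ge0 mixture_sigma_additive.

Let mixture_setT : mixture mmu [set: _] = 1%E.
Proof.
rewrite /mixture (eq_integral (cst 1%E)); last first.
  by move=> t _; rewrite probability_setT.
by rewrite integral_cst// mul1e; exact: probability_setT.
Qed.

HB.instance Definition _ := Measure_isProbability.Build _ _ _ (mixture mmu)
  mixture_setT.

Lemma expected_measureP : is_expected_measure mu (expected_measure mu).
Proof.
rewrite /expected_measure; case: pselect => [h|[]]; first by case: cid.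
by exists (mixture mmu) => x.
Qed.

End mixture.
End expected_measure.

Section semicircle.
Context (R : realType).
Notation leb := (@lebesgue_measure R).

Definition semicircle_density (x : R) : R :=
  (2 * pi)^-1 * Num.sqrt (Num.max (4 - x ^+ 2) 0).

Definition semicircle (B : set (measurableTypeR R)) : \bar R :=
  (\int[leb]_(x in B) (semicircle_density x)%:E)%E.

Let density_ge0 x : 0 <= semicircle_density x.
Proof.
by rewrite mulr_ge0 ?sqrtr_ge0// invr_ge0 mulr_ge0// pi_ge0.
Qed.

Let continuous_density : continuous semicircle_density.
Proof.
move=> x; apply: cvgM; first exact: cvg_cst.
apply: (continuous_comp (f := fun y : R => Num.max (4 - y ^+ 2) 0)
  (g := @Num.sqrt R)); last exact: sqrt_continuous.
apply: (@continuous_max _ _ (fun y : R => 4 - y ^+ 2) (cst 0)); last exact: cvg_cst.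
apply: cvgB; first exact: cvg_cst.
exact: exprn_continuous.
Qed.

Let measurable_density : measurable_fun [set: R] semicircle_density.
Proof. exact: continuous_measurable_fun. Qed.

Let semicircle0 : semicircle set0 = 0%E.
Proof. by rewrite /semicircle integral_set0. Qed.

Let semicircle_ge0 B : (0 <= semicircle B)%E.
Proof. by apply: integral_ge0 => x _; rewrite lee_fin. Qed.

Let semicircle_sigma_additive : semi_sigma_additive semicircle.
Proof.
move=> /= F mF tF mUF; rewrite /semicircle; apply: cvg_toP.
  apply: ereal_nondecreasing_is_cvgn => m n mn.
  apply: lee_sum_nneg_natr => // k _ _.
  by apply: integral_ge0 => /= x Fkx; rewrite lee_fin.
rewrite ge0_integral_bigcup//=.
- by apply: measurable_funTS; apply: measurableT_comp.
- by move=> x _; rewrite lee_fin.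
Qed.

HB.instance Definition _ := isMeasure.Build _ _ _ semicircle
  semicircle0 semicircle_ge0 semicircle_sigma_additive.

Let dsin2 (t : R) : is_derive t 1 (fun x : R => 2 * sin x) (2 * cos t).
Proof. exact: is_deriveZ. Qed.

Let dprim (t : R) :
  is_derive t 1 (fun t : R => (2 * pi)^-1 * (2 * t + 2 * sin t * cos t))
    ((2 * pi)^-1 * (2 * cos t) * (2 * cos t)).
Proof.
apply: is_derive_eq.
rewrite /GRing.scale/= mulr1 -[RHS]mulrA; congr (_ * _).
have := cos2Dsin2 t => e.
nra.
Qed.

Let semicircle_setT : semicircle [set: _] = 1%E.
Proof.
have pi0 := pi_gt0 R.
have -> : semicircle [set: _] =
    (\int[leb]_(x in `[(-2)%R, 2%R]) (semicircle_density x)%:E)%E.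
  rewrite /semicircle [RHS]integral_mkcond; apply: eq_integral => x _.
  rewrite patchE; case: ifPn => //; rewrite notin_setE/= in_itv/= => x2.
  rewrite /semicircle_density max_r ?sqrtr0 ?mulr0//.
  rewrite leNgt; apply/negP => x4; apply: x2; apply/andP; split; nra.
have e2 : 2 = 2 * sin (pi / 2) :> R by rewrite sin_pihalf mulr1.
have em2 : -2 = 2 * sin (- (pi / 2)) :> R by rewrite sinN sin_pihalf mulrN1.
have dF : derive1 (fun x : R => 2 * sin x) = (fun t => 2 * cos t).
  by apply/funext => t; rewrite derive1E; exact: (derive_val (is_derive := dsin2 t)).
have cF : continuous (fun t : R => 2 * cos t).
  by move=> t; apply: cvgM; [exact: cvg_cst|exact: continuous_cos].
have cS : continuous (fun t : R => 2 * sin t).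
  by move=> t; apply: cvgM; [exact: cvg_cst|exact: continuous_sin].
have cP : continuous (fun t : R => (2 * pi)^-1 * (2 * t + 2 * sin t * cos t)).
  move=> t; apply: differentiable_continuous; apply/derivable1_diffP.
  exact: (ex_derive (is_derive := dprim t)).
have -> : `[(-2)%R, 2%R]%classic =
    `[2 * sin (- (pi / 2)), 2 * sin (pi / 2)]%classic :> set R.
  by rewrite -em2 -e2.
rewrite (@integration_by_substitution_increasing _ (fun x => 2 * sin x))//; last 6 first.
- move=> x y xI yI xy; rewrite ltr_pM2l//.
  by rewrite ltr_sin.
- by move=> x _; rewrite dF; exact: cF.
- by rewrite dF; apply/cvgP; apply: cvg_at_right_filter; exact: cF.
- by rewrite dF; apply/cvgP; apply: cvg_at_left_filter; exact: cF.
- split.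
  + by move=> x _; apply: ex_derive.
  + by apply: cvg_at_right_filter; exact: cS.
  + by apply: cvg_at_left_filter; exact: cS.
- by apply: continuous_subspaceT.
- transitivity (\int[leb]_(t in `[(- (pi / 2))%R, (pi / 2)%R])
      ((2 * pi)^-1 * (2 * cos t) * (2 * cos t))%:E)%E.
    apply: eq_integral.
    move=> t; rewrite inE/= => tI; congr EFin.
    rewrite dF [LHS]/= /semicircle_density.
    change ((2 * pi)^-1 * Num.sqrt (Num.max (4 - (2 * sin t) ^+ 2) 0) *
      (2 * cos t) = (2 * pi)^-1 * (2 * cos t) * (2 * cos t)).
    congr (_ * _ * _).
    have -> : 4 - (2 * sin t) ^+ 2 = (2 * cos t) ^+ 2.
      by have := cos2Dsin2 t; nra.
    rewrite max_l ?sqr_ge0// sqrtr_sqr ger0_norm// mulr_ge0//.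
    exact: cos_ge0_pihalf.
  rewrite (@continuous_FTC2 R (fun t => (2 * pi)^-1 * (2 * cos t) * (2 * cos t))
    (fun t => (2 * pi)^-1 * (2 * t + 2 * sin t * cos t)))//.
  + rewrite sinN cosN cos_pihalf !mulr0 !addr0 -EFinB.
    congr EFin; move: (pi) pi0 => p p0; field; exact: lt0r_neq0.
  + lra.
  + apply: continuous_subspaceT => t.
    by apply: cvgM; [apply: cvgM; [exact: cvg_cst|exact: cF]|exact: cF].
  + split.
    * by move=> x _; apply: ex_derive.
    * by apply: cvg_at_right_filter; exact: cP.
    * by apply: cvg_at_left_filter; exact: cP.
  + by move=> t _; rewrite derive1E; exact: (derive_val (is_derive := dprim t)).
- lra.
Qed.

HB.instance Definition _ := Measure_isProbability.Build _ _ _ semicircle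
  semicircle_setT.

End semicircle.

Definition weak_cvg (R : realType)
    (mu : nat -> probability (measurableTypeR R) R)
    (nu : probability (measurableTypeR R) R) : Prop :=
  forall f : R -> R, continuous f -> (exists M : R, forall x, `|f x| <= M) ->
    (\int[mu n]_x (f x)%:E @[n --> \oo] --> \int[nu]_x (f x)%:E)%E.

(* Main.v *)
(* For 0 < k <= 1/2 let H = (1 + i k W)^-1 and s_ij = E|w_ij|^2.  The averages of
   E Re H_ii and E Im H_ii are the integrals of q = 1 / (1 + k^2 x^2) and
   - k x q against E mu_W, and these functions determine weak convergence.
   Expanding H to second order in each independent pair w_ij, w_ji gives, with
   Lindeberg errors, the loop equation
     E (1 - H_ii - k^2 H_ii \sum_j s_ij H_jj) (al + be conj H_ii) ~ 0,
   and the integral h of q against the semicircle law is the solution of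
   h = 1 - k^2 h^2.

   If the row sums rho_i = \sum_j s_ij are close to 1 on average, taking
   al + be conj H_ii = conj (H_ii - h) shows that the average y of E|H_ii - h|^2
   satisfies (1 - k^2) y <= o(1).

   Conversely, let D be the average of \sum_j s_ij E Re (1 - H_ii H_jj).  The loop
   equation with al = 1, be = 0 yields avg rho - D -> h^2 = 1 - O(k^2), and D is
   small with k because, by the hypothesis on small sets of rows, the rho_i are
   uniformly integrable; hence avg rho -> 1 and D = O(k^2).  On the other hand
   E Re (1 - H_ii H_jj) is nearly k^2 (rho_i + rho_j), so the bound D <= 2 k^2 + o(1)
   says that the mean square of the truncated row sums is at most 1 + o(1): their
   variance vanishes. *)
Require Import Defs.
From mathcomp Require Import all_boot all_order all_algebra.
From mathcomp Require Import sesquilinear spectral.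
From mathcomp Require Import all_classical all_reals all_analysis.
From mathcomp Require Import measurable_realfun complex ring lra.

Set Implicit Arguments.
Unset Strict Implicit.
Unset Printing Implicit Defensive.

Import Order.TTheory GRing.Theory Num.Theory.
Import numFieldNormedType.Exports.

Local Open Scope classical_set_scope.
Local Open Scope ring_scope.

(** Up to the factor [i k], [H] inverts [W - i / k], so only points of the imaginary axis at
    distance at least 2 from the real line are used. The Hermitian part of [1 + i k W] is 1: entries
    of [H] are bounded by 1, diagonal ones have nonnegative real part, and the contraction factor is
    [k ^+ 2 <= 1 / 4]. The price is that only [k <= 1 / 2] is available, so a density theorem has to
    recover all bounded continuous functions. The same theorem makes the spectral distribution
    measurable, since the eigenvalues are reached only through resolvent traces. The free factor
    [al + be conj H_ii] replaces concentration of the trace: it puts second moments of single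
    diagonal entries into the loop equation. In the converse the constant 2 in
    [D <= 2 k ^+ 2 + o(1)] is decisive, and no direct estimate of [D] gives it. A crude bound,
    linear in [k] with a constant depending on the truncation level [K], first yields avg rho -> 1;
    the loop equation then returns the sharp one. Truncation is needed because the row sums are only
    uniformly integrable, and the parameters are fixed in the order [K], [k], Lindeberg level,
    [n]. *)

Notation nm := ComplexField.Normc.normc.

(** * Complex modulus, and second-order expansion in one pair of entries *)

Section complex_norm.
Variable R : realType.
Implicit Types z w : R[i].
Local Notation ii := ('i%C : R[i]).

Lemma conjCc z : z^* = conjc z.
Proof. by []. Qed.

Lemma conjRC (r : R) : (r%:C%C : R[i])^* = r%:C%C.
Proof. by rewrite conjCc conjc_real. Qed.

Lemma conj_i : ii^* = - ii.
Proof. by rewrite conjCc/=; apply/eqP; rewrite eq_complex/= oppr0 !eqxx. Qed.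

Lemma mulii : ii * ii = -1.
Proof. by rewrite -expr2 sqr_i. Qed.

Lemma nm_ge0 z : 0 <= nm z.
Proof. by case: z => a b; exact: sqrtr_ge0. Qed.

Lemma nmM z w : nm (z * w) = nm z * nm w.
Proof. exact: ComplexField.Normc.normcM. Qed.

Lemma nmD z w : nm (z + w) <= nm z + nm w.
Proof. exact: le_normcD. Qed.

Lemma nmN z : nm (- z) = nm z.
Proof. exact: normcN. Qed.

Lemma nmB z w : nm (z - w) <= nm z + nm w.
Proof. by rewrite -(nmN w) nmD. Qed.

Lemma nm0 : nm (0 : R[i]) = 0.
Proof. exact: ComplexField.Normc.normc0. Qed.

Lemma nm1 : nm (1 : R[i]) = 1.
Proof. exact: ComplexField.Normc.normc1. Qed.

Lemma nm_i : nm ii = 1.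
Proof. by rewrite /= expr0n/= expr1n add0r sqrtr1. Qed.

Lemma nmRC (r : R) : nm r%:C%C = `|r|.
Proof. by rewrite /= expr0n/= addr0 sqrtr_sqr. Qed.

Lemma nm_conj z : nm z^* = nm z.
Proof. by case: z => a b /=; rewrite sqrrN. Qed.

Lemma nm_sqr z : nm z ^+ 2 = complex.Re z ^+ 2 + complex.Im z ^+ 2.
Proof. by case: z => a b /=; rewrite sqr_sqrtr// addr_ge0// sqr_ge0. Qed.

Lemma nm_Re z : `|complex.Re z| <= nm z.
Proof.
rewrite -(ler_pXn2r (n := 2))// ?nnegrE ?nm_ge0//.
by rewrite nm_sqr real_normK ?num_real// lerDl sqr_ge0.
Qed.

Lemma nm_Im z : `|complex.Im z| <= nm z.
Proof.
rewrite -(ler_pXn2r (n := 2))// ?nnegrE ?nm_ge0//.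
by rewrite nm_sqr real_normK ?num_real// lerDr sqr_ge0.
Qed.

Lemma nm_sum (I : Type) (r : seq I) (Q : pred I) (F : I -> R[i]) :
  nm (\sum_(i <- r | Q i) F i) <= \sum_(i <- r | Q i) nm (F i).
Proof.
elim/big_rec2: _ => [|i y z _ h]; first by rewrite nm0.
by apply: (le_trans (nmD _ _)); rewrite lerD2l.
Qed.

Lemma cReD z w : complex.Re (z + w) = complex.Re z + complex.Re w.
Proof. by case: z; case: w. Qed.

Lemma cImD z w : complex.Im (z + w) = complex.Im z + complex.Im w.
Proof. by case: z; case: w. Qed.

Lemma cReN z : complex.Re (- z) = - complex.Re z.
Proof. by case: z. Qed.

Lemma cReB z w : complex.Re (z - w) = complex.Re z - complex.Re w.
Proof. by rewrite cReD cReN. Qed.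

Lemma cReM z w :
  complex.Re (z * w) = complex.Re z * complex.Re w - complex.Im z * complex.Im w.
Proof. by case: z => a b; case: w. Qed.

Lemma cImM z w :
  complex.Im (z * w) = complex.Re z * complex.Im w + complex.Im z * complex.Re w.
Proof. by case: z => a b; case: w. Qed.

Lemma cReZ (r : R) z : complex.Re (r%:C%C * z) = r * complex.Re z.
Proof. by rewrite cReM/= mul0r subr0. Qed.

Lemma cImZ (r : R) z : complex.Im (r%:C%C * z) = r * complex.Im z.
Proof. by rewrite cImM/= mul0r addr0. Qed.

Lemma cRe_conj z : complex.Re z^* = complex.Re z.
Proof. by case: z. Qed.

Lemma cIm_conj z : complex.Im z^* = - complex.Im z.
Proof. by case: z. Qed.

Lemma cRe_sum (I : Type) (r : seq I) (Q : pred I) (F : I -> R[i]) :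
  complex.Re (\sum_(i <- r | Q i) F i) = \sum_(i <- r | Q i) complex.Re (F i).
Proof. by apply: (big_morph (fun z => complex.Re z)) => // x y; exact: cReD. Qed.

Lemma cIm_sum (I : Type) (r : seq I) (Q : pred I) (F : I -> R[i]) :
  complex.Im (\sum_(i <- r | Q i) F i) = \sum_(i <- r | Q i) complex.Im (F i).
Proof. by apply: (big_morph (fun z => complex.Im z)) => // x y; exact: cImD. Qed.

Lemma mul_conj z : z * z^* = (nm z ^+ 2)%:C%C.
Proof.
apply/eqP; rewrite eq_complex nm_sqr; case: z => a b /=.
by apply/andP; split; apply/eqP; ring.
Qed.

Lemma Re_mul_le z w : complex.Re (z * w) <= nm z * nm w.
Proof. by rewrite -nmM; apply: (le_trans (ler_norm _)); exact: nm_Re. Qed.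

(* [x] and [y] solve the fixed point equations of a resolvent perturbed by the
   Hermitian rank-two matrix with entries [w], [w^*]; the bracket is their
   expansion to second order in [w]. *)
Lemma first_order_expansion (a b c d w x y : R[i]) (al be : R) :
  nm a <= 1 -> nm b <= 1 -> nm c <= 1 -> nm d <= 1 -> nm x <= 1 -> nm y <= 1 ->
  `|al| <= 1 -> `|be| <= 1 ->
  x = c - ii * (c * w * x + d * w^* * y) ->
  y = a - ii * (a * w * x + b * w^* * y) ->
  nm (ii * w * x * (al%:C%C + be%:C%C * y^*) -
      (ii * w * (c * (al%:C%C + be%:C%C * a^*)) +
       w * w * (c * c * (al%:C%C + be%:C%C * a^*) - be%:C%C * c * a^* * b^*) +
       w * w^* * (d * a * (al%:C%C + be%:C%C * a^*) - be%:C%C * c * a^* * c^*)))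
    <= 16 * (nm w ^+ 2 * Num.min 1 (nm w)).
Proof.
move=> a1 b1 c1 d1 x1 y1 al1 be1 xe ye.
set A := al%:C%C; set B := be%:C%C.
have nA : nm A <= 1 by rewrite nmRC.
have nB : nm B <= 1 by rewrite nmRC.
have cl (u v : R[i]) : nm u <= 1 -> nm v <= 1 -> nm (u * v) <= 1.
  by move=> u1 v1; rewrite nmM mulr_ile1 ?nm_ge0.
have p2 (u1 u2 v1 v2 : R[i]) m : nm u1 <= 1 -> nm u2 <= 1 -> nm v1 <= m -> nm v2 <= m ->
    nm (ii * (u1 * w * v1 + u2 * w^* * v2)) <= 2 * nm w * m.
  move=> hu1 hu2 hv1 hv2; rewrite nmM nm_i mul1r; apply: (le_trans (nmD _ _)).
  rewrite !nmM nm_conj.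
  have := nm_ge0 w; have := nm_ge0 u1; have := nm_ge0 u2.
  have := nm_ge0 v1; have := nm_ge0 v2.
  move: (nm w) (nm u1) (nm u2) (nm v1) (nm v2) hu1 hu2 hv1 hv2 => W U1 U2 V1 V2.
  move=> hu1 hu2 hv1 hv2 V20 V10 U20 U10 W0.
  have h1 : U1 * W * V1 <= W * m.
    by apply: ler_pM => //; [exact: mulr_ge0 | rewrite -[leRHS]mul1r ler_wpM2r].
  have h2 : U2 * W * V2 <= W * m.
    by apply: ler_pM => //; [exact: mulr_ge0 | rewrite -[leRHS]mul1r ler_wpM2r].
  lra.
(* First iterates of the two fixed point equations started at [c] and [a]. One more use of the
   equations shows that they miss [x] and [y] by a further factor [2 * nm w]. *)
set x1' := c - ii * (c * w * c + d * w^* * a).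
set y1' := a - ii * (a * w * c + b * w^* * a).
have xc : nm (x - c) <= 2 * nm w.
  have -> : x - c = - (ii * (c * w * x + d * w^* * y)) by rewrite {1}xe; ring.
  by rewrite nmN -[leRHS]mulr1; apply: p2.
have ya : nm (y - a) <= 2 * nm w.
  have -> : y - a = - (ii * (a * w * x + b * w^* * y)) by rewrite {1}ye; ring.
  by rewrite nmN -[leRHS]mulr1; apply: p2.
have xc2 : nm (x - c) <= 2 by apply: (le_trans (nmB _ _)); lra.
have ya2 : nm (y - a) <= 2 by apply: (le_trans (nmB _ _)); lra.
have xx e : nm (x - c) <= e -> nm (y - a) <= e -> nm (x - x1') <= 2 * nm w * e.
  move=> h1 h2.
  have -> : x - x1' = - (ii * (c * w * (x - c) + d * w^* * (y - a))).
    by rewrite {1}xe /x1'; ring.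
  by rewrite nmN; apply: p2.
have yy e : nm (x - c) <= e -> nm (y - a) <= e -> nm (y - y1') <= 2 * nm w * e.
  move=> h1 h2.
  have -> : y - y1' = - (ii * (a * w * (x - c) + b * w^* * (y - a))).
    by rewrite {1}ye /y1'; ring.
  by rewrite nmN; apply: p2.
have ey1 : y1'^* = a^* + ii * (a^* * w^* * c^* + b^* * w * a^*).
  rewrite /y1' rmorphB !rmorphM rmorphD !rmorphM/= conj_i conjCK.
  by rewrite mulNr opprK.
have -> : ii * w * x * (A + B * y^*) -
      (ii * w * (c * (A + B * a^*)) +
       w * w * (c * c * (A + B * a^*) - B * c * a^* * b^*) +
       w * w^* * (d * a * (A + B * a^*) - B * c * a^* * c^*)) =
    ii * w * ((x - x1') * (A + B * a^*) + c * B * (y - y1')^*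
      + B * ((x - c) * (y - a)^*)).
  have -> : (y - y1')^* = y^* - y1'^* by exact: rmorphB.
  have -> : (y - a)^* = y^* - a^* by exact: rmorphB.
  rewrite ey1 /x1'.
  have e1 : w * w * (c * c * (A + B * a^*) - B * c * a^* * b^*) =
    - (ii * ii) * (w * w * (c * c * (A + B * a^*) - B * c * a^* * b^*)).
    by rewrite mulii opprK mul1r.
  have e2 : w * w^* * (d * a * (A + B * a^*) - B * c * a^* * c^*) =
    - (ii * ii) * (w * w^* * (d * a * (A + B * a^*) - B * c * a^* * c^*)).
    by rewrite mulii opprK mul1r.
  rewrite e1 e2; ring.
have nAB : nm (A + B * a^*) <= 2.
  apply: (le_trans (nmD _ _)); have := cl B a^* nB.
  by rewrite nm_conj => /(_ a1); lra.
(* [e] is any common bound for [nm (x - c)] and [nm (y - a)]; it is left free so that both the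
   trivial bound 2 and the bound [2 * nm w] can be inserted. *)
have step e : nm (x - c) <= e -> nm (y - a) <= e -> e <= 2 -> e <= 2 * nm w ->
  nm (ii * w * ((x - x1') * (A + B * a^*) + c * B * (y - y1')^*
      + B * ((x - c) * (y - a)^*))) <= nm w * (8 * (nm w * e)).
  move=> h1 h2 e2 ew; rewrite !nmM nm_i mul1r; apply: ler_wpM2l; first exact: nm_ge0.
  apply: (le_trans (nmD _ _)); apply: (@le_trans _ _
    (nm (x - x1') * nm (A + B * a^*) + nm (c * B) * nm (y - y1')
     + nm B * (nm (x - c) * nm (y - a)))).
    rewrite !nmM nm_conj; apply: lerD => //; apply: (le_trans (nmD _ _)).
    by rewrite !nmM nm_conj.
  have {}xx := xx _ h1 h2; have {}yy := yy _ h1 h2.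
  have cB := cl _ _ c1 nB.
  have := nm_ge0 (x - x1'); have := nm_ge0 (y - y1'); have := nm_ge0 (A + B * a^*).
  have := nm_ge0 (c * B); have := nm_ge0 B; have := nm_ge0 (x - c).
  have := nm_ge0 (y - a); have := nm_ge0 w.
  move: (nm (x - x1')) (nm (y - y1')) (nm (A + B * a^*)) (nm (c * B)) (nm B)
    (nm (x - c)) (nm (y - a)) (nm w) nAB xx yy cB nB h1 h2 ew.
  move=> p q r s t u v W r2 pW qW s1 t1 ue ve eW W0 v0 u0 t0 s0 r0 q0 p0.
  have e0 : 0 <= e by lra.
  have k1 : p * r <= 2 * W * e * 2 by apply: ler_pM.
  have k2 : s * q <= 1 * (2 * W * e) by apply: ler_pM.
  have k3 : t * (u * v) <= 1 * (u * v) by apply: ler_wpM2r => //; exact: mulr_ge0.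
  have k4 : u * v <= (2 * W) * e by apply: ler_pM => //; lra.
  lra.
(* A small [w] leaves a cubic remainder. For a large [w] only boundedness is used and the remainder
   is quadratic, which is what a Lindeberg condition can absorb. *)
case: (leP (nm w) 1) => w1.
- have h := step (2 * nm w) xc ya; apply: (le_trans (h _ _)); [lra|lra|].
  by rewrite le_eqVlt; apply/orP; left; apply/eqP; ring.
- have h := step 2 xc2 ya2; apply: (le_trans (h _ _)); [lra|lra|].
  by rewrite le_eqVlt; apply/orP; left; apply/eqP; ring.
Qed.

End complex_norm.

(** * Resolvent of a Hermitian matrix: Ward identities and removal of one pair *)

Section resolvent.
Variable R : realType.
Local Notation ii := ('i%C : R[i]).
Local Open Scope sesquilinear_scope.

Definition resolvent (n : nat) (X : 'M[R[i]]_n) : 'M[R[i]]_n :=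
  invmx (1%:M + ii *: X).

Lemma hermsymmx_sym (n : nat) (X : 'M[R[i]]_n) :
  X \is hermsymmx -> forall i j, X i j = (X j i)^*.
Proof.
move=> /is_hermitianmxP; rewrite expr0 scale1r => {1}-> i j.
by rewrite !mxE.
Qed.

Lemma sym_hermsymmx (n : nat) (X : 'M[R[i]]_n) :
  (forall i j, X i j = (X j i)^*) -> X \is hermsymmx.
Proof.
move=> h; apply/is_hermitianmxP; rewrite expr0 scale1r.
by apply/matrixP => i j; rewrite !mxE -h.
Qed.

Lemma hermsymmx_scale (n : nat) (X : 'M[R[i]]_n) (k : R) :
  X \is hermsymmx -> k%:C%C *: X \is hermsymmx.
Proof.
move=> hX; apply: sym_hermsymmx => i j.
by rewrite !mxE rmorphM/= conjRC -hermsymmx_sym.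
Qed.

(** Diagonalisation reduces the inverse to the scalars [1 + i k lambda]. Their real part is 1
    because the eigenvalues are real, so none of them vanishes. *)
Lemma spectral_resolvent_inv (n : nat) (W : 'M[R[i]]_n) (k : R) :
  W \is hermsymmx ->
  (1%:M + ii *: (k%:C%C *: W)) *m (invmx (spectralmx W) *m
    diag_mx (\row_j (1 + ii * (k%:C%C * spectral_diag W 0 j))^-1) *m spectralmx W)
  = 1%:M.
Proof.
move=> hW; have nW := hermitian_normalmx hW.
have Wreal := hermitian_spectral_diag_real hW.
have uP := spectral_unit W; set P := spectralmx W in uP *.
set g := diag_mx _.
have eW : W = invmx P *m diag_mx (spectral_diag W) *m P by exact/orthomx_spectralP.
set D := diag_mx (spectral_diag W) in eW.
have -> : 1%:M + ii *: (k%:C%C *: W) =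
    invmx P *m (1%:M + (ii * k%:C%C) *: D) *m P.
  rewrite mulmxDr mulmxDl mulmx1 mulVmx//; congr (_ + _).
  by rewrite [in LHS]eW -!scalemxAr -!scalemxAl scalerA.
rewrite !mulmxA mulmxK// -(mulmxA _ _ g).
have -> : (1%:M + (ii * k%:C%C) *: D) *m g = 1%:M.
  have -> : (1%:M + (ii * k%:C%C) *: D) =
      diag_mx (\row_j (1 + ii * (k%:C%C * spectral_diag W 0 j))).
    apply/matrixP => i j; rewrite !mxE; case: eqVneq => [->|_].
      by rewrite !mulr1n mulrA.
    by rewrite !mulr0n mulr0 addr0.
  rewrite /g; apply/matrixP => i j; rewrite mul_diag_mx !mxE.
  case: eqVneq => [->|_]; last by rewrite !mulr0n mulr0.
  rewrite !mulr1n divff//.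
  have /mxOverP/(_ 0 j)/complex_realP[r ->] := Wreal.
  have e : complex.Re (1 + ii * (k%:C%C * r%:C%C)) = 1.
    by rewrite cReD (cReM ii) (cImM k%:C%C)/= !(mul0r, mulr0, subr0, addr0).
  by apply: contra_eq_neq e => ->; rewrite eq_sym oner_eq0.
by rewrite mulmx1 mulVmx.
Qed.

Lemma resolvent_scaleE (n : nat) (W : 'M[R[i]]_n) (k : R) : W \is hermsymmx ->
  resolvent (k%:C%C *: W) = invmx (spectralmx W) *m
    diag_mx (\row_j (1 + ii * (k%:C%C * spectral_diag W 0 j))^-1) *m spectralmx W.
Proof.
move=> hW; have h := spectral_resolvent_inv k hW.
have [u _] := mulmx1_unit h; rewrite /resolvent.
by apply: (can_inj (mulKmx u)); rewrite h mulmxV.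
Qed.

Lemma trace_resolvent (n : nat) (W : 'M[R[i]]_n) (k : R) : W \is hermsymmx ->
  \tr (resolvent (k%:C%C *: W)) =
  \sum_j (1 + ii * (k%:C%C * spectral_diag W 0 j))^-1.
Proof.
move=> hW; rewrite resolvent_scaleE// mxtrace_mulC mulmxA mulmxV ?spectral_unit//.
by rewrite mul1mx mxtrace_diag; apply: eq_bigr => j _; rewrite mxE.
Qed.

Section hermitian.
Variables (n : nat) (X : 'M[R[i]]_n).
Hypothesis hX : X \is hermsymmx.
Local Notation H := (resolvent X).

Lemma resolvent_unit : 1%:M + ii *: X \in unitmx.
Proof.
have := spectral_resolvent_inv 1 hX; rewrite [1%:C%C]/(1 : R[i]) scale1r.
by move=> /mulmx1_unit[].
Qed.

Lemma mul_resolvent : (1%:M + ii *: X) *m H = 1%:M.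
Proof. by rewrite mulmxV// resolvent_unit. Qed.

Lemma resolvent_mul : H *m (1%:M + ii *: X) = 1%:M.
Proof. by rewrite mulVmx// resolvent_unit. Qed.

Let adj : (1%:M + ii *: X) ^t* = 1%:M - ii *: X.
Proof.
apply/matrixP => i j; rewrite !mxE rmorphD rmorphM/= -hermsymmx_sym// conj_i.
by rewrite rmorph_nat eq_sym mulNr.
Qed.

Let adjM (A B : 'M[R[i]]_n) : (A *m B) ^t* = B ^t* *m A ^t*.
Proof. by rewrite trmx_mul map_mxM. Qed.

Let adj_sum : (1%:M + ii *: X) + (1%:M + ii *: X) ^t* = 2%:M.
Proof. by rewrite adj addrACA subrr addr0 -raddfD. Qed.

Let adj1 : (1%:M : 'M[R[i]]_n) ^t* = 1%:M.
Proof. by rewrite trmx1 map_mx1. Qed.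

(** [1 + i X] and its adjoint add up to 2; multiplying this by [H] on the left and by its adjoint on
    the right gives [H + H^* = 2 H H^*], read here on the diagonal. All bounds on entries of [H]
    come from it, and so does the summability of the off-diagonal errors along a row. *)
Lemma ward_row i : \sum_j nm (H i j) ^+ 2 = complex.Re (H i i).
Proof.
have e : H + H ^t* = 2 *: (H *m H ^t*).
  have -> : 2 *: (H *m H ^t*) = H *m 2%:M *m H ^t*.
    by rewrite mul_mx_scalar -scalemxAl.
  rewrite -adj_sum mulmxDr mulmxDl resolvent_mul mul1mx -mulmxA -adjM.
  by rewrite resolvent_mul adj1 mulmx1 addrC.
have := congr1 (fun M : 'M[R[i]]_n => complex.Re (M i i)) e.
rewrite /= !mxE cReD cRe_conj.
rewrite (_ : (2 : R[i]) = (2 : R)%:C%C); last by rewrite rmorph_nat.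
rewrite cReZ cRe_sum (eq_bigr (fun j => nm (H i j) ^+ 2)); last first.
  by move=> j _; rewrite !mxE mul_conj.
by move=> ?; lra.
Qed.

Lemma ward_col i : \sum_j nm (H j i) ^+ 2 = complex.Re (H i i).
Proof.
have e : H + H ^t* = 2 *: (H ^t* *m H).
  have -> : 2 *: (H ^t* *m H) = H ^t* *m 2%:M *m H.
    by rewrite mul_mx_scalar -scalemxAl.
  rewrite -adj_sum mulmxDr mulmxDl -adjM mul_resolvent adj1 mul1mx -mulmxA.
  by rewrite mul_resolvent mulmx1 addrC.
have := congr1 (fun M : 'M[R[i]]_n => complex.Re (M i i)) e.
rewrite /= !mxE cReD cRe_conj.
rewrite (_ : (2 : R[i]) = (2 : R)%:C%C); last by rewrite rmorph_nat.
rewrite cReZ cRe_sum (eq_bigr (fun j => nm (H j i) ^+ 2)); last first.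
  by move=> j _; rewrite !mxE mulrC mul_conj.
by move=> ?; lra.
Qed.

Lemma Re_resolvent_ge0 i : 0 <= complex.Re (H i i).
Proof. by rewrite -ward_row; apply: sumr_ge0 => j _; exact: sqr_ge0. Qed.

Let nm_diag i : nm (H i i) <= 1.
Proof.
have h : nm (H i i) ^+ 2 <= nm (H i i).
  apply: (@le_trans _ _ (complex.Re (H i i))).
    rewrite -ward_row (bigD1 i)//= lerDl; apply: sumr_ge0 => j _; exact: sqr_ge0.
  by apply: (le_trans (ler_norm _)); exact: nm_Re.
by have := nm_ge0 (H i i) => h0; nra.
Qed.

Lemma ward_row_le1 i : \sum_j nm (H i j) ^+ 2 <= 1.
Proof. by rewrite ward_row (le_trans (ler_norm _))// (le_trans (nm_Re _)). Qed.

Lemma ward_col_le1 i : \sum_j nm (H j i) ^+ 2 <= 1.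
Proof. by rewrite ward_col (le_trans (ler_norm _))// (le_trans (nm_Re _)). Qed.

Lemma nm_resolvent_le1 i j : nm (H i j) <= 1.
Proof.
rewrite -(ler_pXn2r (n := 2))// ?nnegrE ?nm_ge0// expr1n.
apply: le_trans (ward_row_le1 i); rewrite (bigD1 j)//= lerDl.
by apply: sumr_ge0 => k _; exact: sqr_ge0.
Qed.

Lemma one_sub_resolvent_diag i : 1 - H i i = ii * \sum_j X i j * H j i.
Proof.
have := congr1 (fun M : 'M[R[i]]_n => M i i) mul_resolvent.
rewrite /= mulmxDl mul1mx -scalemxAl !mxE eqxx.
by rewrite -[true%:R]/(1 : R[i]) => <-; rewrite addrAC subrr add0r.
Qed.

End hermitian.

(** Both conjugate entries are erased, so the matrix stays Hermitian and its resolvent keeps the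
    bound 1, while being a function of the remaining entries only. *)
Definition decoupled (n : nat) (i j : 'I_n) (X : 'M[R[i]]_n) : 'M[R[i]]_n :=
  \matrix_(a, b) (if ((a == i) && (b == j)) || ((a == j) && (b == i)) then 0
    else X a b).

Lemma decoupled_herm (n : nat) (i j : 'I_n) (X : 'M[R[i]]_n) :
  X \is hermsymmx -> decoupled i j X \is hermsymmx.
Proof.
move=> hX; apply: sym_hermsymmx => a b; rewrite !mxE orbC.
rewrite (andbC (a == j)) (andbC (a == i)); case: ifP => _; first by rewrite rmorph0.
exact: hermsymmx_sym.
Qed.

(** Resolvent identity for a rank-two perturbation. On the diagonal the two conjugate entries are
    the same one and would be counted twice, hence [i != j]. Keeping one factor of each resolvent
    makes the identity an exact fixed point equation for the entries of the full one. *)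
Lemma resolvent_decoupled (n : nat) (i j : 'I_n) (X : 'M[R[i]]_n) (k l : 'I_n) :
  X \is hermsymmx -> i != j ->
  resolvent X k l = resolvent (decoupled i j X) k l -
    ii * (resolvent (decoupled i j X) k i * X i j * resolvent X j l +
          resolvent (decoupled i j X) k j * (X i j)^* * resolvent X i l).
Proof.
move=> hX ij; have hX' := decoupled_herm i j hX.
set Y := decoupled i j X in hX' *; set H := resolvent X; set H' := resolvent Y.
have eX : X = Y + (X i j *: delta_mx i j + (X i j)^* *: delta_mx j i).
  apply/matrixP => a b; rewrite !mxE.
  case: (eqVneq a i) => [->|ai]; case: (eqVneq b j) => [->|bj];
    rewrite ?eqxx/= ?(negPf ij) ?[j == i]eq_sym ?(negPf ij)/= ?mulr1 ?mulr0 ?addr0 ?add0r//.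
  - by case: (a == j); rewrite /= ?mulr0 ?addr0.
  - case: (eqVneq a j) => [->|]; case: (eqVneq b i) => [->|];
      rewrite /= ?mulr1 ?mulr0 ?addr0 ?add0r//.
    exact: hermsymmx_sym.
have e : H' = H + ii *: (H' *m (X i j *: delta_mx i j + (X i j)^* *: delta_mx j i) *m H).
  rewrite -[LHS]mulmx1 -(mul_resolvent hX) [in (1%:M + _)]eX scalerDr addrA mulmxA.
  by rewrite mulmxDr mulmxDl resolvent_mul// mul1mx -scalemxAr -scalemxAl.
have dm (M M' : 'M[R[i]]_n) (a b : 'I_n) : (M *m delta_mx a b *m M') k l = M k a * M' b l.
  rewrite -(mul_delta_mx (0 : 'I_1)) mulmxA -colE -mulmxA -rowE !mxE.
  by rewrite big_ord_recl big_ord0 addr0 !mxE.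
have eD (M M' : 'M[R[i]]_n) : (M + M') k l = M k l + M' k l by rewrite mxE.
have eZ z (M : 'M[R[i]]_n) : (z *: M) k l = z * M k l by rewrite mxE.
rewrite mulmxDr mulmxDl -!scalemxAr -!scalemxAl in e.
by have := congr1 (fun M : 'M[R[i]]_n => M k l) e; rewrite /= !(eD, eZ, dm) => ->; ring.
Qed.

End resolvent.

(** * Measurability of complex variables and of resolvent entries *)

Section complex_measurability.
Context d (T : measurableType d) (R : realType).
Implicit Types X Y : T -> R[i].

Definition cmeasurable X : Prop :=
  measurable_fun [set: T] (fun t => complex.Re (X t)) /\
  measurable_fun [set: T] (fun t => complex.Im (X t)).

Lemma cmeasurable_cst (z : R[i]) : cmeasurable (fun=> z).
Proof. by split; exact: measurable_cst. Qed.

Lemma cmeasurableD X Y : cmeasurable X -> cmeasurable Y ->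
  cmeasurable (fun t => X t + Y t).
Proof.
move=> [Xr Xi] [Yr Yi]; split.
  by under eq_fun do rewrite cReD; exact: measurable_funD.
by under eq_fun do rewrite cImD; exact: measurable_funD.
Qed.

Lemma cmeasurableM X Y : cmeasurable X -> cmeasurable Y ->
  cmeasurable (fun t => X t * Y t).
Proof.
move=> [Xr Xi] [Yr Yi]; split.
  by under eq_fun do rewrite cReM; apply: measurable_funB; exact: measurable_funM.
by under eq_fun do rewrite cImM; apply: measurable_funD; exact: measurable_funM.
Qed.

Lemma cmeasurableN X : cmeasurable X -> cmeasurable (fun t => - X t).
Proof.
move=> mX; under eq_fun do rewrite -mulN1r.
exact: (cmeasurableM (cmeasurable_cst _)).
Qed.

Lemma cmeasurableB X Y : cmeasurable X -> cmeasurable Y ->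
  cmeasurable (fun t => X t - Y t).
Proof. by move=> mX mY; apply: cmeasurableD => //; exact: cmeasurableN. Qed.

Lemma cmeasurable_conj X : cmeasurable X -> cmeasurable (fun t => (X t)^*).
Proof.
move=> [Xr Xi]; split; first by under eq_fun do rewrite cRe_conj.
by under eq_fun do rewrite cIm_conj; exact: measurable_funN.
Qed.

Lemma measurable_nm X : cmeasurable X -> measurable_fun [set: T] (fun t => nm (X t)).
Proof.
move=> [Xr Xi].
have -> : (fun t => nm (X t)) =
    (@Num.sqrt R) \o (fun t => complex.Re (X t) ^+ 2 + complex.Im (X t) ^+ 2).
  by apply/funext => t /=; case: (X t).
apply: measurableT_comp.
  by apply: continuous_measurable_fun; exact: sqrt_continuous.
by apply: measurable_funD; exact: measurable_funX.
Qed.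

Lemma cmeasurableV X : cmeasurable X -> cmeasurable (fun t => (X t)^-1).
Proof.
(* The power [-1] is a measurable real function, and a vanishing [X t] causes no exception because
   the conjugate factor vanishes with it. *)
move=> mX; have e t : (X t)^-1 = ((nm (X t) ^+ 2) `^ (-1))%:C%C * (X t)^*.
  rewrite powR_inv1 ?sqr_ge0//; have [->|X0] := eqVneq (X t) 0.
    by rewrite invr0 conjC0 mulr0.
  by rewrite fmorphV/= -mul_conj invfM -mulrA mulVf ?mulr1// conjC_eq0.
under eq_fun do rewrite e; apply: cmeasurableM; last exact: cmeasurable_conj.
split => /=; last exact: measurable_cst.
apply: (measurableT_comp (measurable_powR (-1))).
exact/measurable_funX/measurable_nm.
Qed.

Lemma cmeasurable_sum (I : Type) (s : seq I) (F : I -> T -> R[i]) :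
  (forall k, cmeasurable (F k)) -> cmeasurable (fun t => \sum_(k <- s) F k t).
Proof.
move=> mF; elim: s => [|k s ih].
  by under eq_fun do rewrite big_nil; exact: cmeasurable_cst.
by under eq_fun do rewrite big_cons; exact: cmeasurableD.
Qed.

Lemma cmeasurable_prod (I : Type) (s : seq I) (F : I -> T -> R[i]) :
  (forall k, cmeasurable (F k)) -> cmeasurable (fun t => \prod_(k <- s) F k t).
Proof.
move=> mF; elim: s => [|k s ih].
  by under eq_fun do rewrite big_nil; exact: cmeasurable_cst.
by under eq_fun do rewrite big_cons; exact: cmeasurableM.
Qed.

Lemma cmeasurable_det (n : nat) (M : T -> 'M[R[i]]_n) :
  (forall i j, cmeasurable (fun t => M t i j)) -> cmeasurable (fun t => \det (M t)).
Proof.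
move=> mM; rewrite /determinant; apply: cmeasurable_sum => s.
by apply: cmeasurableM; [exact: cmeasurable_cst | exact: cmeasurable_prod].
Qed.

(** By Cramer's rule the entries are rational functions of those of [X], with a determinant that
    never vanishes. *)
Lemma cmeasurable_resolvent (n : nat) (X : T -> 'M[R[i]]_n) :
  (forall t, X t \is hermsymmx) -> (forall i j, cmeasurable (fun t => X t i j)) ->
  forall i j, cmeasurable (fun t => resolvent (X t) i j).
Proof.
move=> hX mX i j.
have mA k l : cmeasurable (fun t => (1%:M + 'i%C *: X t) k l).
  under eq_fun do rewrite !mxE.
  apply: cmeasurableD; first exact: cmeasurable_cst.
  exact: cmeasurableM (cmeasurable_cst _) (mX _ _).
have e t : resolvent (X t) i j =
    (\det (1%:M + 'i%C *: X t))^-1 * cofactor (1%:M + 'i%C *: X t) j i.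
  by rewrite /resolvent /invmx resolvent_unit// !mxE.
under eq_fun do rewrite e; rewrite /cofactor; apply: cmeasurableM.
  by apply: cmeasurableV; exact: cmeasurable_det.
apply: cmeasurableM; first exact: cmeasurable_cst.
by apply: cmeasurable_det => k l; under eq_fun do rewrite [_ k l]mxE [_ _ l]mxE.
Qed.

End complex_measurability.

(** * Real expectations and products of independent variables *)

Section expectation_toolkit.
Context d (T : measurableType d) (R : realType) (P : probability T R).
Implicit Types f g : T -> R.

Definition L1 f : Prop := P.-integrable [set: T] (EFin \o f).
Definition Ex f : R := \int[P]_t f t.

Lemma L1_measurable f : L1 f -> measurable_fun [set: T] f.
Proof. by move=> /measurable_int /measurable_EFinP. Qed.

Lemma Ex_ext f g : (forall t, f t = g t) -> Ex f = Ex g.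
Proof. by move=> fg; apply: eq_Rintegral => t _. Qed.

Lemma L1_dom g f : L1 g -> measurable_fun [set: T] f ->
  (forall t, `|f t| <= g t) -> L1 f.
Proof.
move=> ig mf fg; apply: (le_integrable _ _ _ ig) => //.
  exact/measurable_EFinP.
move=> t _ /=; rewrite lee_fin; apply: (le_trans (fg t)); exact: ler_norm.
Qed.

Lemma L1_cst (r : R) : L1 (fun=> r).
Proof. exact: finite_measure_integrable_cst. Qed.

Lemma L1_bounded (M : R) f : measurable_fun [set: T] f ->
  (forall t, `|f t| <= M) -> L1 f.
Proof. exact: L1_dom (L1_cst M). Qed.

Lemma L1D f g : L1 f -> L1 g -> L1 (fun t => f t + g t).
Proof. by move=> hf hg; exact: (integrableD measurableT hf hg). Qed.

Lemma L1B f g : L1 f -> L1 g -> L1 (fun t => f t - g t).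
Proof. by move=> hf hg; exact: (integrableB measurableT hf hg). Qed.

Lemma L1Z (r : R) f : L1 f -> L1 (fun t => r * f t).
Proof. by move=> hf; exact: (integrableZl measurableT r hf). Qed.

Lemma L1N f : L1 f -> L1 (fun t => - f t).
Proof. by move=> hf; exact: (integrableN hf). Qed.

Lemma L1_sum (I : Type) (s : seq I) (F : I -> T -> R) :
  (forall k, L1 (F k)) -> L1 (fun t => \sum_(k <- s) F k t).
Proof.
move=> mF; elim: s => [|k s ih].
  by under eq_fun do rewrite big_nil; exact: L1_cst.
by under eq_fun do rewrite big_cons; exact: L1D.
Qed.

Lemma Ex_cst (r : R) : Ex (fun=> r) = r.
Proof.
rewrite /Ex Rintegral_cst//.
rewrite (_ : fine _ = 1); last exact: (congr1 fine (@probability_setT _ _ _ P)).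
by rewrite mulr1.
Qed.

Lemma ExD f g : L1 f -> L1 g -> Ex (fun t => f t + g t) = Ex f + Ex g.
Proof. by move=> hf hg; exact: RintegralD. Qed.

Lemma ExB f g : L1 f -> L1 g -> Ex (fun t => f t - g t) = Ex f - Ex g.
Proof. by move=> hf hg; exact: RintegralB. Qed.

Lemma ExZ (r : R) f : L1 f -> Ex (fun t => r * f t) = r * Ex f.
Proof. by move=> hf; exact: RintegralZl. Qed.

Lemma ExN f : L1 f -> Ex (fun t => - f t) = - Ex f.
Proof.
by move=> hf; rewrite -mulN1r -ExZ//; apply: Ex_ext => t; rewrite mulN1r.
Qed.

Lemma Ex_sum (I : Type) (s : seq I) (F : I -> T -> R) :
  (forall k, L1 (F k)) -> Ex (fun t => \sum_(k <- s) F k t) = \sum_(k <- s) Ex (F k).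
Proof.
move=> mF; elim: s => [|k s ih].
  by rewrite big_nil -[RHS]Ex_cst; apply: Ex_ext => t; rewrite big_nil.
rewrite big_cons -ih -ExD//; last exact: L1_sum.
by apply: Ex_ext => t; rewrite big_cons.
Qed.

Lemma Ex_le f g : L1 f -> L1 g -> (forall t, f t <= g t) -> Ex f <= Ex g.
Proof. by move=> hf hg fg; apply: le_Rintegral => // t _. Qed.

Lemma Ex_ge0 f : (forall t, 0 <= f t) -> 0 <= Ex f.
Proof. by move=> f0; apply: Rintegral_ge0 => t _. Qed.

Lemma Ex_norm_le f g : L1 f -> L1 g -> (forall t, `|f t| <= g t) -> `|Ex f| <= Ex g.
Proof.
move=> hf hg fg; rewrite ler_norml; apply/andP; split.
  rewrite -ExN//; apply: Ex_le => //; first exact: L1N.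
  by move=> t; have := fg t; rewrite ler_norml => /andP[].
by apply: Ex_le => // t; have := fg t; rewrite ler_norml => /andP[].
Qed.

Lemma expectationE f : L1 f -> ('E_P[f])%E = (Ex f)%:E.
Proof.
move=> hf; rewrite unlock /Ex /Rintegral fineK//.
exact: integrable_fin_num.
Qed.

Lemma ExpectationE f : fine ('E_P[f])%E = Ex f.
Proof. by rewrite unlock. Qed.

(* The law of [(U, V)] is the product of the marginal laws. *)
Lemma Ex_indepM (U V : T -> R) :
  (forall A B, measurable A -> measurable B ->
    P (U @^-1` A `&` V @^-1` B) = (P (U @^-1` A) * P (V @^-1` B))%E) ->
  L1 U -> L1 V -> L1 (fun t => U t * V t) ->
  Ex (fun t => U t * V t) = Ex U * Ex V.
Proof.
move=> UV iU iV iUV.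
have mU := L1_measurable iU; have mV := L1_measurable iV.
pose U' : {mfun T >-> R} := mfun_Sub (mem_set mU).
pose V' : {mfun T >-> R} := mfun_Sub (mem_set mV).
have mW : measurable_fun [set: T] (fun t => (U t, V t)) by exact: measurable_fun_pair.
pose W' : {mfun T >-> (R * R)%type} := mfun_Sub (mem_set mW).
pose mu := distribution P U'; pose nu := distribution P V'; pose la := distribution P W'.
have prodE X : measurable X -> (mu \x nu)%E X = la X.
  apply: product_measure_unique => A B mA mB.
  by rewrite /la /mu /nu /distribution /pushforward /= -UV.
pose h (z : R * R) : \bar R := (z.1 * z.2)%:E.
have mh : measurable_fun [set: (R * R)%type] h.
  apply/measurable_EFinP; apply: measurable_funM.
    exact: measurable_fst.
  exact: measurable_snd.
have lah : la.-integrable [set: _] h by apply: (integrable_pushforward mW).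
have pih : (mu \x nu)%E.-integrable [set: _] h.
  apply/integrableP; split => //; have /integrableP[_] := lah.
  by rewrite (@eq_measure_integral _ _ _ _ la (mu \x nu)%E)// => A mA _; exact: prodE.
have muE : (\int[mu]_x (x%:E) = \int[P]_t (U t)%:E)%E.
  rewrite (integral_pushforward mU)//; exact/measurable_EFinP.
have nuE : (\int[nu]_x (x%:E) = \int[P]_t (V t)%:E)%E.
  rewrite (integral_pushforward mV)//; exact/measurable_EFinP.
have inu : nu.-integrable [set: R] (EFin \o id).
  by apply: (integrable_pushforward mV) => //; exact/measurable_EFinP.
have imu : mu.-integrable [set: R] (EFin \o id).
  by apply: (integrable_pushforward mU) => //; exact/measurable_EFinP.
have e : (\int[P]_t (U t * V t)%:E = (Ex U)%:E * (Ex V)%:E)%E.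
  transitivity (\int[la]_z h z)%E.
    by rewrite (integral_pushforward mW).
  rewrite (eq_measure_integral (mu \x nu)%E); last by move=> X mX _; apply/esym; exact: prodE.
  rewrite -integral12_prod_meas1// /fubini_F.
  transitivity (\int[mu]_x ((Ex V)%:E * x%:E))%E.
    apply: eq_integral => x _; rewrite /h /=; under eq_integral do rewrite EFinM.
    rewrite integralZl//; rewrite muleC; congr (_ * _)%E.
    by rewrite nuE /Ex /Rintegral fineK//; exact: integrable_fin_num.
  rewrite integralZl// muleC; congr (_ * _)%E.
  by rewrite muE /Ex /Rintegral fineK//; exact: integrable_fin_num.
by rewrite {1}/Ex /Rintegral e.
Qed.

End expectation_toolkit.

(** * Independence of one pair of entries from all the others *)

Section wigner_independence.
Context d (T : measurableType d) (R : realType) (P : probability T R).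
Variables (n : nat) (W : T -> 'M[R[i]]_n).
Hypothesis hW : hermitian_wigner P W.

Let X (p : 'I_n * 'I_n) : T -> (R * R)%type := re_im (fun t => W t p.1 p.2).

Let mX p : measurable_fun [set: T] (X p).
Proof. by case: hW => _ + _; exact. Qed.

Let hermW t : W t \is hermsymmx.
Proof. by case: hW. Qed.

Lemma wigner_cmeasurable i j : cmeasurable (fun t => W t i j).
Proof. by have /measurable_fun_pairP[] := mX (i, j). Qed.

(* A pi-system generating the sigma-algebra of all entries except [(i, j)]
   and [(j, i)]. *)
Definition other_entries (i j : 'I_n) : set (set T) :=
  [set A | exists B : 'I_n * 'I_n -> set (R * R), (forall k, measurable (B k)) /\
    A = \bigcap_(k in [set k | k \in upper_triangle n :\ (i, j) :\ (j, i)]) (X k @^-1` B k)].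

Local Notation T' i j := (g_sigma_algebraType (other_entries i j)).

Let bigcap_mX (J : {set 'I_n * 'I_n}) (B : 'I_n * 'I_n -> set (R * R)) :
  (forall k, measurable (B k)) ->
  measurable (\bigcap_(k in [set k | k \in J]) (X k @^-1` B k)).
Proof.
move=> mB; apply: fin_bigcap_measurable; first exact: finite_finset.
by move=> k _; rewrite -[_ @^-1` _]classical_sets.setTI; exact: mX.
Qed.

Let other_entriesC (i j : 'I_n) : other_entries i j = other_entries j i.
Proof. by rewrite /other_entries finset.setDDl finset.setUC -finset.setDDl. Qed.

(** As functions of [E], both sides are finite measures, and they agree on the generating pi-system;
    uniqueness of measures extends the equality to the whole sigma-algebra. *)
Let indep_set (i j : 'I_n) : (i < j)%N -> forall A, measurable A ->
  forall E, <<s other_entries i j >> E ->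
  P (X (i, j) @^-1` A `&` E) = (P (X (i, j) @^-1` A) * P E)%E.
Proof.
move=> ij A mA E sE.
have mXA : measurable (X (i, j) @^-1` A) by rewrite -[_ @^-1` _]classical_sets.setTI; exact: mX.
pose r : {nonneg R} := NngNum (fine_ge0 (measure_ge0 P (X (i, j) @^-1` A))).
have rE : (r%:num)%:E = P (X (i, j) @^-1` A) by rewrite /= fineK// fin_num_measure.
rewrite classical_sets.setIC -rE.
apply: (@g_sigma_algebra_measure_unique _ _ _ (other_entries i j) _ (fun=> [set: T])
  _ _ (mrestr P mXA) (mscale r P)) => //.
- by move=> _ [B [mB ->]]; exact: bigcap_mX.
- move=> _; exists (fun=> setT); split => //.
  by apply/seteqP; split => // t _ k _.
- by apply/seteqP; split => // t _; exists 0%N.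
- move=> _ _ [B [mB ->]] [B' [mB' ->]].
  exists (fun k => B k `&` B' k); split; first by move=> k; exact: measurableI.
  rewrite -bigcapI; apply: eq_bigcapr => k _; by rewrite preimage_setI.
- move=> _ [B [mB ->]].
  set E0 := \bigcap_(k in _) _.
  suff : P (X (i, j) @^-1` A `&` E0) = (P (X (i, j) @^-1` A) * P E0)%E.
    by rewrite -rE classical_sets.setIC.
  rewrite /E0 => {E0}.
  have [_ _ ind] := hW.
  (* The event becomes one intersection over the whole upper triangle, with [A] in place [(i, j)].
     Since [i < j], the index [(j, i)] is not in the triangle, and removing it changes nothing. *)
  pose B' k := if k == (i, j) then A else B k.
  have mB' k : measurable (B' k) by rewrite /B'; case: ifP.
  have U_ji k : k \in upper_triangle n -> k != (j, i).
    by apply: contraL => /eqP->; rewrite inE/= leqNgt ij.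
  have ijU : (i, j) \in upper_triangle n by rewrite inE/= ltnW.
  have -> : X (i, j) @^-1` A `&`
      \bigcap_(k in [set k | k \in upper_triangle n :\ (i, j) :\ (j, i)]) X k @^-1` B k =
      \bigcap_(k in [set k | k \in upper_triangle n]) X k @^-1` B' k.
    apply/seteqP; split => [t [tA tB] k /= kU|t tB].
      rewrite /B'; case: eqVneq => [->//|kij].
      by apply: tB => /=; rewrite !in_setD1 kij kU andbT (U_ji _ kU).
    split; first by have := tB _ ijU; rewrite /B' eqxx.
    move=> k /=; rewrite !in_setD1 => /and3P[_ kij kU].
    by have := tB _ kU; rewrite /B' (negPf kij).
  rewrite [LHS]ind// (bigD1 (i, j))//= {1}/B' eqxx.
  congr (_ * _)%E; rewrite [RHS]ind//; last by rewrite finset.setDDl finset.subsetDl.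
  apply: eq_big => k; first by rewrite !in_setD1 andbC; case kU: (k \in _); rewrite ?andbF// (U_ji _ kU).
  by move=> /andP[_ kij]; rewrite /B' (negPf kij).
- move=> _; suff : (P ([set: T] `&` X (i, j) @^-1` A) < +oo)%E by [].
  by rewrite classical_sets.setTI (le_lt_trans (probability_le1 _ _))// ltry.
Qed.

Let other_measurable (i j : 'I_n) k : k \in upper_triangle n :\ (i, j) :\ (j, i) ->
  @measurable_fun _ _ (T' i j) _ setT (X k).
Proof.
move=> kJ _ B mB; rewrite classical_sets.setTI; apply: sub_sigma_algebra.
exists (fun l => if l == k then B else setT); split.
  by move=> l; case: ifP.
apply/seteqP; split => [t tB l _|t /(_ _ kJ)]; last by rewrite eqxx.
by rewrite /preimage /=; case: (eqVneq l k) => [->|].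
Qed.

(** The sigma-algebra is the one of the other entries, not the ambient one: this is what makes
    resolvents of the decoupled matrix independent of the erased pair. Entries below the diagonal
    are reached by conjugation, the generators being upper triangular. *)
Lemma decoupled_cmeasurable (i j a b : 'I_n) :
  cmeasurable (T := T' i j) (fun t => decoupled i j (W t) a b).
Proof.
case cE : (((a == i) && (b == j)) || ((a == j) && (b == i))).
  have e0 t : decoupled i j (W t) a b = 0 by rewrite mxE cE.
  by under eq_fun do rewrite e0; exact: cmeasurable_cst.
have ne := negbT cE; have e1 t : decoupled i j (W t) a b = W t a b by rewrite mxE cE.
under eq_fun do rewrite e1.
have key (k l : 'I_n) : (k <= l)%N -> (k, l) != (i, j) -> (k, l) != (j, i) ->
    cmeasurable (T := T' i j) (fun t => W t k l).
  move=> kl klij klji; have kJ : (k, l) \in upper_triangle n :\ (i, j) :\ (j, i).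
    by rewrite !in_setD1 klij klji inE.
  by have /measurable_fun_pairP[] := other_measurable kJ.
have [ab|ba] := leqP a b.
  apply: key => //; apply: contra ne => /eqP[-> ->]; by rewrite !eqxx ?orbT.
have e t : W t a b = (W t b a)^* by exact: hermsymmx_sym.
under eq_fun do rewrite e; apply: (cmeasurable_conj (T := T' i j)).
apply: key; first exact: ltnW.
  by apply: contra ne => /eqP[-> ->]; rewrite !eqxx orbT.
by apply: contra ne => /eqP[-> ->]; rewrite !eqxx.
Qed.

Lemma decoupled_resolvent_cmeasurable (k : R) (i j a b : 'I_n) :
  cmeasurable (T := T' i j)
    (fun t => resolvent (decoupled i j (k%:C%C *: W t)) a b).
Proof.
apply: cmeasurable_resolvent => [t|a' b'].
  exact/decoupled_herm/hermsymmx_scale.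
have e t : decoupled i j (k%:C%C *: W t) a' b' = k%:C%C * decoupled i j (W t) a' b'.
  by rewrite !mxE; case: ifP; rewrite ?mulr0// mxE.
under eq_fun do rewrite e.
exact: cmeasurableM (cmeasurable_cst _ _) (decoupled_cmeasurable _ _ _ _).
Qed.

Lemma other_entries_measurable (i j : 'I_n) (K : T -> R) :
  @measurable_fun _ _ (T' i j) _ setT K -> measurable_fun [set: T] K.
Proof.
move=> mK _ B mB; have := mK measurableT B mB; rewrite !classical_sets.setTI.
by apply: smallest_sub; [exact: sigma_algebra_measurable | move=> _ [B' [mB' ->]]; exact: bigcap_mX].
Qed.

Lemma wigner_indep (i j : 'I_n) (A : set (R * R)) E : i != j -> measurable A ->
  <<s other_entries i j >> E ->
  P (X (i, j) @^-1` A `&` E) = (P (X (i, j) @^-1` A) * P E)%E.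
Proof.
move=> ij mA sE; have [ltij|] := ltnP i j; first exact: indep_set.
rewrite leq_eqVlt => /orP[/eqP/val_inj e|ltji]; first by rewrite e eqxx in ij.
(* Below the diagonal, conjugation turns an event on [W i j] into one on [W j i], described by the
   reflected set. *)
have -> : X (i, j) @^-1` A = X (j, i) @^-1` ((fun z => (z.1, - z.2)) @^-1` A).
  by apply/funext => t; rewrite /X /re_im /= hermsymmx_sym//= cRe_conj cIm_conj.
apply: indep_set => //; last by rewrite other_entriesC.
rewrite -[X in measurable X]classical_sets.setTI.
have mf : measurable_fun [set: R * R] (fun z : R * R => (z.1, - z.2)).
  by apply: measurable_fun_pair; [exact: measurable_fst|apply: measurable_funN; exact: measurable_snd].
exact: mf.
Qed.

Lemma wigner_Ex_indepM (i j : 'I_n) (F : R * R -> R) (K : T -> R) (M : R) :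
  i != j -> measurable_fun setT F -> @measurable_fun _ _ (T' i j) _ setT K ->
  (forall t, `|K t| <= M) -> L1 P (F \o X (i, j)) ->
  Ex P (fun t => F (X (i, j) t) * K t) = Ex P (F \o X (i, j)) * Ex P K.
Proof.
move=> ij mF mK KM iF.
have mK' := other_entries_measurable mK; have mFX := L1_measurable iF.
have M0 : 0 <= M by apply: le_trans (KM point).
apply: (@Ex_indepM _ _ _ P (F \o X (i, j)) K) => //.
- move=> A B mA mB; rewrite comp_preimage; apply: wigner_indep => //.
    by rewrite -[X in measurable X]classical_sets.setTI; exact: mF.
  by have := mK measurableT B mB; rewrite classical_sets.setTI.
- exact: L1_bounded mK' KM.
- apply: (@L1_dom _ _ _ _ (fun t => M * `|F (X (i, j) t)|)).
  + apply: L1Z; apply: L1_dom (integrable_norm iF) _ _ => [|t] /=.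
      exact: measurableT_comp.
    by rewrite normr_id.
  + exact: measurable_funM.
  + by move=> t /=; rewrite normrM mulrC ler_wpM2r.
Qed.

End wigner_independence.

(** * Returning from the decoupled resolvent to the full one *)

Section pair_perturbation.
Variable R : realType.
Implicit Types a b c d p w x y z : R[i].
Local Notation ii := ('i%C : R[i]).

Lemma perturbation_le (u0 u w u1 v1 u2 v2 : R[i]) :
  nm u0 <= 1 -> nm u <= 1 -> nm u1 <= 1 -> nm v1 <= 1 -> nm u2 <= 1 -> nm v2 <= 1 ->
  u = u0 - ii * (u1 * w * v1 + u2 * w^* * v2) ->
  nm (u0 - u) <= 2 * Num.min 1 (nm w).
Proof.
move=> h0 h h1 k1 h2 k2 e.
have a1 : nm (u0 - u) <= 2 by apply: (le_trans (nmB _ _)); lra.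
have a2 : nm (u0 - u) <= 2 * nm w.
  have -> : u0 - u = ii * (u1 * w * v1 + u2 * w^* * v2) by rewrite {1}e; ring.
  rewrite nmM nm_i mul1r; apply: (le_trans (nmD _ _)); rewrite !nmM nm_conj.
  have key (r s : R) : 0 <= r -> r <= 1 -> 0 <= s -> s <= 1 -> r * nm w * s <= nm w.
    move=> r0 r1 s0 s1; have w0 := nm_ge0 w.
    have -> : r * nm w * s = (r * s) * nm w by ring.
    by rewrite -[leRHS]mul1r ler_wpM2r// mulr_ile1.
  have := key _ _ (nm_ge0 u1) h1 (nm_ge0 v1) k1.
  have := key _ _ (nm_ge0 u2) h2 (nm_ge0 v2) k2.
  lra.
by case: (leP 1 (nm w)) => _; lra.
Qed.

(** Here [a], [b], [c], [d] are the entries [ii], [ij], [ji], [jj] of the decoupled resolvent and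
    [y], [p], [x], [z] those of the full one. The coefficient of [w * w] contains only products of
    off-diagonal entries, and the one of [w * w^*] is the diagonal product up to such terms. Squares
    of off-diagonal entries are summable by the Ward identities, so they are the right currency for
    the error. *)
Lemma second_order_coefficients (a b c d p w x y z : R[i]) (al be : R) :
  nm a <= 1 -> nm b <= 1 -> nm c <= 1 -> nm d <= 1 ->
  nm p <= 1 -> nm x <= 1 -> nm y <= 1 -> nm z <= 1 ->
  `|al| <= 1 -> `|be| <= 1 ->
  y = a - ii * (a * w * x + b * w^* * y) ->
  x = c - ii * (c * w * x + d * w^* * y) ->
  z = d - ii * (c * w * z + d * w^* * p) ->
  p = b - ii * (a * w * z + b * w^* * p) ->
  nm (c * c * (al%:C%C + be%:C%C * a^*) - be%:C%C * c * a^* * b^*) +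
  `|complex.Re (d * a * (al%:C%C + be%:C%C * a^*) - be%:C%C * c * a^* * c^*) -
    complex.Re (z * y * (al%:C%C + be%:C%C * y^*))| <=
  8 * (nm p ^+ 2 + nm x ^+ 2) + 74 * Num.min 1 (nm w).
Proof.
move=> ha hb hc hd hp hx hy hz hal hbe ey ex ez ep.
set A := al%:C%C; set B := be%:C%C; set m := Num.min 1 (nm w).
have dy : nm (a - y) <= 2 * m by apply: perturbation_le ey.
have dx : nm (c - x) <= 2 * m by apply: perturbation_le ex.
have dz : nm (d - z) <= 2 * m by apply: perturbation_le ez.
have dp : nm (b - p) <= 2 * m by apply: perturbation_le ep.
have m0 : 0 <= m by rewrite le_min ler01 nm_ge0.
have m1 : m <= 1 by rewrite ge_min lexx.
have nA : nm A <= 1 by rewrite nmRC.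
have nB : nm B <= 1 by rewrite nmRC.
have cl (u v : R[i]) : nm u <= 1 -> nm v <= 1 -> nm (u * v) <= 1.
  by move=> u1 v1; rewrite nmM mulr_ile1 ?nm_ge0.
have nAB : nm (A + B * a^*) <= 2.
  apply: (le_trans (nmD _ _)); have := cl B a^* nB.
  by rewrite nm_conj => /(_ ha); lra.
have pl (r s M : R) : 0 <= r -> 0 <= s -> r <= 1 -> s <= M -> r * s <= M.
  by move=> r0 s0 r1 sM; apply: le_trans sM; rewrite -[leRHS]mul1r ler_wpM2r.
have b1 : nm (c * c * (A + B * a^*) - B * c * a^* * b^*) <=
    2 * nm c ^+ 2 + nm c * nm b.
  apply: (le_trans (nmB _ _)); apply: lerD.
    by rewrite !nmM -expr2 mulrC ler_wpM2r// sqr_ge0.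
  rewrite !nmM !nm_conj.
  have -> : nm B * nm c * nm a * nm b = (nm B * nm a) * (nm c * nm b) by ring.
  apply: pl => //; rewrite ?mulr_ge0 ?nm_ge0//.
  by rewrite -nmM; exact: cl.
have b2 : `|complex.Re (d * a * (A + B * a^*) - B * c * a^* * c^*) -
    complex.Re (z * y * (A + B * y^*))| <= 10 * m + nm c ^+ 2.
  rewrite -cReB; apply: (le_trans (nm_Re _)).
  have -> : d * a * (A + B * a^*) - B * c * a^* * c^* - z * y * (A + B * y^*) =
    (a * (d - z) * (A + B * a^*) + z * (a - y) * (A + B * a^*)
      + z * y * B * (a - y)^*) - B * a^* * (c * c^*).
    by rewrite rmorphB/=; ring.
  apply: (le_trans (nmB _ _)); apply: lerD.
    apply: (le_trans (nmD _ _)); have -> : 10 * m = 8 * m + 2 * m by ring.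
    apply: lerD; last first.
      rewrite nmM nm_conj; apply: pl; rewrite ?nm_ge0//.
      by apply: (cl _ _) => //; exact: cl.
    apply: (le_trans (nmD _ _)); have -> : 8 * m = 2 * m * 2 + 2 * m * 2 by ring.
    apply: lerD.
      rewrite nmM; apply: ler_pM => //; rewrite ?nm_ge0// nmM.
      by apply: pl; rewrite ?nm_ge0.
    rewrite nmM; apply: ler_pM => //; rewrite ?nm_ge0// nmM.
    by apply: pl; rewrite ?nm_ge0.
  rewrite nmM (nmM c) nm_conj -expr2; apply: pl; rewrite ?nm_ge0 ?sqr_ge0//.
  by apply: cl => //; rewrite nm_conj.
(* Squares absorb the perturbation linearly in [m], since [m <= 1] gives [m * m <= m]. *)
have sq (u v : R[i]) : nm (u - v) <= 2 * m -> nm u ^+ 2 <= 2 * nm v ^+ 2 + 8 * m.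
  move=> uv; have : nm u <= nm v + 2 * m.
    by apply: (le_trans _ (lerD (lexx _) uv)); rewrite -{1}(subrK v u) addrC nmD.
  have := nm_ge0 u; have := nm_ge0 v; move: (nm u) (nm v) => U V V0 U0 UV.
  have : U ^+ 2 <= (V + 2 * m) ^+ 2 by rewrite ler_sqr// nnegrE; lra.
  have : 0 <= (V - 2 * m) ^+ 2 by exact: sqr_ge0.
  have : m * m <= m by rewrite -[leRHS]mul1r ler_wpM2r.
  rewrite !expr2; lra.
have cc := sq _ _ dx; have bb := sq _ _ dp.
have : 0 <= (nm c - nm b) ^+ 2 by exact: sqr_ge0.
have := sqr_ge0 (nm p); have := sqr_ge0 (nm x).
rewrite !expr2 in b1 b2 cc bb *; lra.
Qed.

End pair_perturbation.

(** * Lindeberg truncation of a single entry *)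

Section truncated_moments.
Context d (T : measurableType d) (R : realType) (P : probability T R).
Variable X : T -> R[i].
Hypothesis mX : cmeasurable X.
Hypothesis L2X : L1 P (fun t => nm (X t) ^+ 2).

Definition secm : R := Ex P (fun t => nm (X t) ^+ 2).
Definition truncm (e : R) : R :=
  Ex P (fun t => nm (X t) ^+ 2 * \1_[set u | e < nm (X u)] t).

Let mN : measurable_fun [set: T] (fun t => nm (X t)).
Proof. exact: measurable_nm. Qed.

Let mI (e : R) : measurable_fun [set: T] (\1_[set u | e < nm (X u)] : T -> R).
Proof.
apply: measurable_indic; rewrite -[X in measurable X]setTI.
exact: measurable_fun_ltr (measurable_cst _) mN measurableT [set true] _.
Qed.

Let i01 (e : R) t : 0 <= (\1_[set u | e < nm (X u)] t : R) <= 1.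
Proof. by rewrite indicE; case: (_ \in _); rewrite /= ?ler01 ?lexx. Qed.

Let iE (e : R) t : (\1_[set u | e < nm (X u)] t : R) = (e < nm (X t))%R%:R.
Proof. by rewrite indicE mem_setE. Qed.

Lemma secm_ge0 : 0 <= secm.
Proof. by apply: Ex_ge0 => t; exact: sqr_ge0. Qed.

Lemma truncm_ge0 e : 0 <= truncm e.
Proof. by apply: Ex_ge0 => t; rewrite mulr_ge0 ?sqr_ge0//; case/andP: (i01 e t). Qed.

Lemma L1_truncm e : L1 P (fun t => nm (X t) ^+ 2 * \1_[set u | e < nm (X u)] t).
Proof.
apply: (L1_dom L2X) => [|t].
  by apply: measurable_funM; [exact: measurable_funX | exact: mI].
rewrite normrM ger0_norm ?sqr_ge0//; case/andP: (i01 e t) => h0 h1.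
by rewrite ger0_norm// -[leRHS]mulr1 ler_wpM2l ?sqr_ge0.
Qed.

Lemma L1_nm : L1 P (fun t => nm (X t)).
Proof.
apply: (L1_dom (L1D (L1_cst P 1) L2X)) => // t.
by rewrite ger0_norm ?nm_ge0//; have := nm_ge0 (X t); rewrite expr2; nra.
Qed.

Let m := fun t => Num.min 1 (nm (X t)).

Lemma measurable_min1_nm : measurable_fun [set: T] m.
Proof. exact: measurable_minr (measurable_cst _) mN. Qed.

Let m01 t : 0 <= m t <= 1.
Proof. by rewrite /m le_min ler01 nm_ge0 ge_min lexx. Qed.

Lemma L1_min1_nm : L1 P m.
Proof.
by apply: (@L1_bounded _ _ _ _ 1) => [|t]; [exact: measurable_min1_nm|case/andP: (m01 t) => ? ?; rewrite ger0_norm].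
Qed.

Lemma L1_sqr_min1_nm : L1 P (fun t => nm (X t) ^+ 2 * m t).
Proof.
apply: (L1_dom L2X) => [|t].
  by apply: measurable_funM; [exact: measurable_funX | exact: measurable_min1_nm].
rewrite normrM ger0_norm ?sqr_ge0//; case/andP: (m01 t) => h0 h1.
by rewrite ger0_norm// -[leRHS]mulr1 ler_wpM2l ?sqr_ge0.
Qed.

Variable e : R.
Hypothesis e01 : 0 < e <= 1.

Lemma Ex_sqr_min1_le : Ex P (fun t => nm (X t) ^+ 2 * m t) <= e * secm + truncm e.
Proof.
rewrite /secm -ExZ// -ExD; [|exact: L1Z|exact: L1_truncm].
apply: Ex_le => [||t]; [exact: L1_sqr_min1_nm|by apply: L1D; [exact: L1Z|exact: L1_truncm]|].
rewrite iE; case/andP: (m01 t) => h0 h1; case/andP: e01 => e0 e1.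
have v0 := nm_ge0 (X t); have := sqr_ge0 (nm (X t)); case: ltP => [_|ve] q0.
  by rewrite mulr1; nra.
have : m t <= e by rewrite /m ge_min ve orbT.
by rewrite mulr0; nra.
Qed.

Lemma secm_le : secm <= e ^+ 2 + truncm e.
Proof.
rewrite -[e ^+ 2](Ex_cst P) -ExD; [|exact: L1_cst|exact: L1_truncm].
apply: Ex_le => // [|t]; first by apply: L1D; [exact: L1_cst|exact: L1_truncm].
rewrite iE; case/andP: e01 => e0 e1; have v0 := nm_ge0 (X t); case: ltP => [_|ve].
  by rewrite mulr1 lerDr sqr_ge0.
by rewrite mulr0 addr0 ler_sqr ?nnegrE// ltW.
Qed.

(** Above the level [e] the modulus is at most its square divided by [e]. This serves the diagonal
    entries, which are estimated in first moment instead of being expanded. *)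
Lemma Ex_nm_le : Ex P (fun t => nm (X t)) <= e + truncm e / e.
Proof.
case/andP: e01 => e0 e1.
rewrite -[X in _ <= X + _](Ex_cst P) mulrC -ExZ; last exact: L1_truncm.
rewrite -ExD; [|exact: L1_cst|exact/L1Z/L1_truncm].
apply: Ex_le => [||t]; [exact: L1_nm|by apply: L1D; [exact: L1_cst|exact/L1Z/L1_truncm]|].
rewrite iE; have v0 := nm_ge0 (X t); case: ltP => [ev|ve]; last by rewrite !mulr0 addr0.
have : nm (X t) <= e^-1 * nm (X t) ^+ 2.
  by rewrite ler_pdivlMl// expr2 ler_wpM2r// ltW.
by rewrite mulr1; lra.
Qed.

(** By Chebyshev the probability of exceeding [e] is at most [truncm e / e ^+ 2]. The division by
    [e ^+ 2] is harmless because [secm] is itself at most [e ^+ 2 + truncm e]: in the product the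
    first part cancels it, and in the second part the probability is bounded by 1. *)
Lemma secm_Ex_min1_le : secm * Ex P m <= e * secm + 2 * truncm e.
Proof.
case/andP: e01 => e0 e1.
pose I := (\1_[set u | e < nm (X u)] : T -> R).
have LI : L1 P I.
  apply: (@L1_bounded _ _ _ _ 1) => [|t]; first exact: mI.
  by case/andP: (i01 e t) => ? ?; rewrite ger0_norm.
have h1 : Ex P m <= e + Ex P I.
  rewrite -[X in _ <= X + _](Ex_cst P) -ExD//; last exact: L1_cst.
  apply: Ex_le => [||t]; [exact: L1_min1_nm|by apply: L1D => //; exact: L1_cst|].
  rewrite /I iE; case/andP: (m01 t) => k0 k1; case: ltP => [_|ve]; first by rewrite -[true%:R]/(1 : R); lra.
  by rewrite addr0 /m ge_min ve orbT.
have h2 : e ^+ 2 * Ex P I <= truncm e.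
  rewrite -ExZ//; apply: Ex_le => [||t]; [exact: L1Z|exact: L1_truncm|].
  rewrite /I iE; case: ltP => [ev|_]; last by rewrite !mulr0.
  by rewrite !mulr1 ler_sqr ?nnegrE ?nm_ge0// ltW.
have h3 : Ex P I <= 1.
  rewrite -[leRHS](Ex_cst P); apply: Ex_le => [||t] //; first exact: L1_cst.
  by case/andP: (i01 e t).
have h4 : 0 <= Ex P I by apply: Ex_ge0 => t; case/andP: (i01 e t).
have h5 := secm_le; have h6 := secm_ge0; have h7 := truncm_ge0 e.
have : secm * Ex P m <= secm * (e + Ex P I) by rewrite ler_wpM2l.
have : secm * Ex P I <= (e ^+ 2 + truncm e) * Ex P I by rewrite ler_wpM2r.
have : truncm e * Ex P I <= truncm e * 1 by rewrite ler_wpM2l.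
lra.
Qed.

End truncated_moments.

(** * The loop equation for one pair of entries *)

Section loop_equation.
Context d (T : measurableType d) (R : realType) (P : probability T R).
Variables (n : nat) (W : T -> 'M[R[i]]_n) (k : R).
Hypothesis hW : hermitian_wigner P W.
Hypothesis W0 : forall i j, ccentered P (fun t => W t i j).
Hypothesis W2 : forall i j, L1 P (fun t => nm (W t i j) ^+ 2).
Hypothesis k01 : 0 <= k <= 1.
Local Notation ii := ('i%C : R[i]).
Local Notation H t := (resolvent (k%:C%C *: W t)).

Definition mvar (i j : 'I_n) : R := secm P (fun t => W t i j).
Definition mtrunc (e : R) (i j : 'I_n) : R := truncm P (fun t => W t i j) e.

Lemma L1_Re_bounded (M : R) (K : T -> R[i]) :
  cmeasurable K -> (forall t, nm (K t) <= M) -> L1 P (fun t => complex.Re (K t)).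
Proof.
move=> [mK _] KM; apply: (@L1_bounded _ _ _ _ M) => // t.
exact: le_trans (nm_Re _) (KM t).
Qed.

Let hX t : k%:C%C *: W t \is hermsymmx.
Proof. by apply: hermsymmx_scale; case: hW. Qed.

Let mW i j : cmeasurable (fun t => W t i j).
Proof. exact: wigner_cmeasurable hW i j. Qed.

Lemma wigner_resolvent_cmeasurable i j : cmeasurable (fun t => H t i j).
Proof.
apply: cmeasurable_resolvent => // a b; under eq_fun do rewrite mxE.
exact: cmeasurableM (cmeasurable_cst _ _) (mW _ _).
Qed.

Let H1 t i j : nm (H t i j) <= 1.
Proof. exact: nm_resolvent_le1. Qed.

Let cl (u v : R[i]) : nm u <= 1 -> nm v <= 1 -> nm (u * v) <= 1.
Proof. by move=> u1 v1; rewrite nmM mulr_ile1 ?nm_ge0. Qed.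

Lemma nm_affine_le2 (al be : R) (y : R[i]) : `|al| <= 1 -> `|be| <= 1 ->
  nm y <= 1 -> nm (al%:C%C + be%:C%C * y) <= 2.
Proof.
move=> al1 be1 y1; apply: (le_trans (nmD _ _)); rewrite nmM !nmRC.
have h : `|be| * nm y <= 1 by rewrite mulr_ile1// nm_ge0.
exact: (lerD al1 h).
Qed.

Lemma L1_hopping_term i j (al be : R) : `|al| <= 1 -> `|be| <= 1 ->
  L1 P (fun t => complex.Re (ii * (k%:C%C * W t i j) * H t j i *
                   (al%:C%C + be%:C%C * (H t i i)^*))).
Proof.
move=> al1 be1.
have mu : cmeasurable (fun t => ii * (k%:C%C * W t i j) * H t j i *
    (al%:C%C + be%:C%C * (H t i i)^*)).
  do ![apply: cmeasurableM | apply: cmeasurableD | apply: cmeasurable_conj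
    | exact: wigner_resolvent_cmeasurable | exact: cmeasurable_cst | exact: mW].
have L1W := L1_nm (mW i j) (W2 i j).
have [mu1 _] := mu; apply: (L1_dom (L1Z 2 L1W)) => // t.
apply: (le_trans (nm_Re _)); rewrite !nmM nm_i mul1r nmRC.
have [k0 k1] := andP k01; rewrite ger0_norm//.
have -> : 2 * nm (W t i j) = nm (W t i j) * 1 * 2 by ring.
apply: ler_pM; rewrite ?mulr_ge0 ?nm_ge0//; last first.
  by apply: nm_affine_le2 => //; rewrite nm_conj.
apply: ler_pM; rewrite ?mulr_ge0 ?nm_ge0//.
by rewrite -[leRHS]mul1r ler_wpM2r ?nm_ge0.
Qed.

Lemma L1_diagonal_term i j (al be : R) : `|al| <= 1 -> `|be| <= 1 ->
  L1 P (fun t => complex.Re (H t j j * H t i i * (al%:C%C + be%:C%C * (H t i i)^*))).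
Proof.
move=> al1 be1; apply: (@L1_Re_bounded 2) => [|t].
  do ![apply: cmeasurableM | apply: cmeasurableD | apply: cmeasurable_conj
    | exact: wigner_resolvent_cmeasurable | exact: cmeasurable_cst].
rewrite nmM -[leRHS]mul1r ler_pM ?nm_ge0 ?cl//.
by apply: nm_affine_le2 => //; rewrite nm_conj.
Qed.

Lemma L1_sqr_resolvent i j : L1 P (fun t => nm (H t i j) ^+ 2).
Proof.
apply: (@L1_bounded _ _ _ _ 1) => [|t].
  exact/measurable_funX/measurable_nm/wigner_resolvent_cmeasurable.
by rewrite ger0_norm ?sqr_ge0// exprn_ile1 ?nm_ge0.
Qed.

Section pair.
Variables (i j : 'I_n) (al be : R).
Hypotheses (ij : i != j) (al1 : `|al| <= 1) (be1 : `|be| <= 1).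
Local Notation H' t := (resolvent (decoupled i j (k%:C%C *: W t))).
Local Notation A := (al%:C%C : R[i]).
Local Notation B := (be%:C%C : R[i]).
Local Notation T' := (g_sigma_algebraType (other_entries W i j)).

Let mH' a b : cmeasurable (T := T') (fun t => H' t a b).
Proof. exact: (decoupled_resolvent_cmeasurable hW). Qed.

Let H'1 t a b : nm (H' t a b) <= 1.
Proof. apply: nm_resolvent_le1; exact: decoupled_herm. Qed.

Let AB1 (y : R[i]) : nm y <= 1 -> nm (A + B * y) <= 2.
Proof. exact: nm_affine_le2. Qed.

(** Coefficients of [w], [w * w] and [w * w^*] in the second-order expansion. They are built from
    the decoupled resolvent, hence independent of [w]. *)
Let G1 t := H' t j i * (A + B * (H' t i i)^*).
Let F1 t := H' t j i * H' t j i * (A + B * (H' t i i)^*) -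
  B * H' t j i * (H' t i i)^* * (H' t i j)^*.
Let F2 t := H' t j j * H' t i i * (A + B * (H' t i i)^*) -
  B * H' t j i * (H' t i i)^* * (H' t j i)^*.

Let mAB : cmeasurable (T := T') (fun t => A + B * (H' t i i)^*).
Proof.
apply: (cmeasurableD (T := T')); first exact: cmeasurable_cst.
by apply: (cmeasurableM (T := T')); [exact: cmeasurable_cst|apply: (cmeasurable_conj (T := T'))].
Qed.

Let mG1 : cmeasurable (T := T') G1.
Proof. exact: (cmeasurableM (T := T')). Qed.

Let mBHH a b c e : cmeasurable (T := T') (fun t => B * H' t a b * (H' t i i)^* * (H' t c e)^*).
Proof.
by do ![apply: (cmeasurableM (T := T')) | apply: (cmeasurable_conj (T := T'))
  | exact: mH' | exact: cmeasurable_cst].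
Qed.

Let mF1 : cmeasurable (T := T') F1.
Proof.
apply: (cmeasurableB (T := T')) (mBHH _ _ _ _).
by do 2 apply: (cmeasurableM (T := T')) => //.
Qed.

Let mF2 : cmeasurable (T := T') F2.
Proof.
apply: (cmeasurableB (T := T')) (mBHH _ _ _ _).
by do 2 apply: (cmeasurableM (T := T')) => //.
Qed.

Let G1_2 t : nm (G1 t) <= 2.
Proof.
rewrite nmM -[leRHS]mul1r ler_pM ?nm_ge0//; apply: AB1; by rewrite nm_conj.
Qed.

Let BHH1 t a b c e : nm (B * H' t a b * (H' t i i)^* * (H' t c e)^*) <= 1.
Proof. by apply: (cl (cl (cl _ _) _) _); rewrite ?nm_conj ?nmRC. Qed.

Let F1_3 t : nm (F1 t) <= 3.
Proof.
apply: (le_trans (nmB _ _)); have -> : (3 : R) = 1 * 2 + 1 by ring.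
apply: lerD => //; rewrite nmM ler_pM ?nm_ge0//; first exact: cl.
by apply: AB1; rewrite nm_conj.
Qed.

Let F2_3 t : nm (F2 t) <= 3.
Proof.
apply: (le_trans (nmB _ _)); have -> : (3 : R) = 1 * 2 + 1 by ring.
apply: lerD => //; rewrite nmM ler_pM ?nm_ge0//; first exact: cl.
by apply: AB1; rewrite nm_conj.
Qed.

Let w t : R[i] := k%:C%C * W t i j.

Let nmw t : nm (w t) = k * nm (W t i j).
Proof. by rewrite nmM nmRC ger0_norm//; case/andP: k01. Qed.

Let mN : measurable_fun [set: T] (fun t => nm (W t i j)).
Proof. exact: measurable_nm. Qed.

Let L1W : L1 P (fun t => nm (W t i j)).
Proof. exact: L1_nm. Qed.

Let L1ReW : L1 P (fun t => complex.Re (W t i j)).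
Proof. by apply: (L1_dom L1W) => [|t]; [case: (mW i j)|exact: nm_Re]. Qed.

Let L1ImW : L1 P (fun t => complex.Im (W t i j)).
Proof. by apply: (L1_dom L1W) => [|t]; [case: (mW i j)|exact: nm_Im]. Qed.

(** [G1] is a function of the other entries and [W i j] is centered. The real part is split into two
    real products, as the factorisation of expectations is for real variables. *)
Let linear_term : L1 P (fun t => complex.Re (ii * w t * G1 t)) /\
  Ex P (fun t => complex.Re (ii * w t * G1 t)) = 0.
Proof.
have e t : complex.Re (ii * w t * G1 t) = - k *
    (complex.Re (W t i j) * complex.Im (G1 t) + complex.Im (W t i j) * complex.Re (G1 t)).
  by rewrite -mulrA cReM/= mul0r mul1r sub0r cImM /w cReZ cImZ; ring.
have [m1 m2] := mG1.
have hr t : `|complex.Re (G1 t)| <= 2 by exact: le_trans (nm_Re _) (G1_2 t).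
have hi t : `|complex.Im (G1 t)| <= 2 by exact: le_trans (nm_Im _) (G1_2 t).
have L (f g : T -> R) : L1 P f -> @measurable_fun _ _ T' _ setT g ->
    (forall t, `|g t| <= 2) -> L1 P (fun t => f t * g t).
  move=> Lf mg g2; have mg' := other_entries_measurable hW mg.
  apply: (L1_dom (L1Z 2 (integrable_norm Lf))) => [|t].
    by apply: measurable_funM => //; exact: L1_measurable Lf.
  by rewrite /= normrM mulrC ler_wpM2r.
have Lr := L _ _ L1ReW m2 hi; have Li := L _ _ L1ImW m1 hr.
have [c1 c2] := W0 i j.
have e1 : Ex P (fun t => complex.Re (W t i j) * complex.Im (G1 t)) = 0.
  have := wigner_Ex_indepM hW ij measurable_fst m2 hi L1ReW.
  rewrite /re_im /= => ->.
  have -> : Ex P (fst \o re_im (fun t => W t i j)) = 0.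
    by have := congr1 fine c1; rewrite ExpectationE.
  by rewrite mul0r.
have e2 : Ex P (fun t => complex.Im (W t i j) * complex.Re (G1 t)) = 0.
  have := wigner_Ex_indepM hW ij measurable_snd m1 hr L1ImW.
  rewrite /re_im /= => ->.
  have -> : Ex P (snd \o re_im (fun t => W t i j)) = 0.
    by have := congr1 fine c2; rewrite ExpectationE.
  by rewrite mul0r.
split; first by under eq_fun do rewrite e; apply: L1Z; exact: L1D.
by rewrite (Ex_ext _ e) ExZ ?ExD ?e1 ?e2 ?addr0 ?mulr0//; exact: L1D.
Qed.

Let sqr_indep (K : T -> R) : @measurable_fun _ _ T' _ setT K ->
  (forall t, `|K t| <= 3) ->
  L1 P (fun t => nm (W t i j) ^+ 2 * K t) /\
  Ex P (fun t => nm (W t i j) ^+ 2 * K t) = mvar i j * Ex P K.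
Proof.
move=> mK K3; have mK' := other_entries_measurable hW mK; split.
  apply: (L1_dom (L1Z 3 (W2 i j))) => [|t].
    by apply: measurable_funM => //; exact: L1_measurable (W2 i j).
  by rewrite normrM [leRHS]mulrC ger0_norm ?sqr_ge0// ler_wpM2l ?sqr_ge0.
pose F (z : R * R) := z.1 ^+ 2 + z.2 ^+ 2.
have mF : measurable_fun setT F.
  apply: measurable_funD; apply: measurable_funX; [exact: measurable_fst|exact: measurable_snd].
have eF t : F (re_im (fun t => W t i j) t) = nm (W t i j) ^+ 2 by rewrite nm_sqr.
have LF : L1 P (F \o re_im (fun t => W t i j)).
  have -> : F \o re_im (fun t => W t i j) = fun t => nm (W t i j) ^+ 2.
    by apply/funext => t; rewrite -eF.
  exact: W2.
have := wigner_Ex_indepM hW ij mF mK K3 LF.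
rewrite (@Ex_ext _ _ _ _ _ (fun t => nm (W t i j) ^+ 2 * K t)); last by move=> t; rewrite eF.
by move=> ->; congr (_ * _); apply: Ex_ext => t; rewrite /= eF.
Qed.

Let u t := complex.Re (ii * w t * H t j i * (A + B * (H t i i)^*)).
Let g t := complex.Re (H t j j * H t i i * (A + B * (H t i i)^*)).

Let sub_eq t a b : H t a b = H' t a b -
    ii * (H' t a i * w t * H t j b + H' t a j * (w t)^* * H t i b).
Proof. by rewrite [LHS](resolvent_decoupled _ _ _ ij)// mxE. Qed.

Let L1u : L1 P u.
Proof. exact: L1_hopping_term. Qed.

Let L1g : L1 P g.
Proof. exact: L1_diagonal_term. Qed.

Let L1sqr a b : L1 P (fun t => nm (H t a b) ^+ 2).
Proof. exact: L1_sqr_resolvent. Qed.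

Let V2m t := nm (W t i j) ^+ 2 * Num.min 1 (nm (W t i j)).

Let min_nmw t : Num.min 1 (nm (w t)) <= Num.min 1 (nm (W t i j)).
Proof.
rewrite le_min !ge_min lexx/= nmw; apply/orP; right.
by rewrite -[leRHS]mul1r ler_wpM2r ?nm_ge0//; case/andP: k01.
Qed.

(** The [w * w] term moves to the error side: the expectation of [W i j ^+ 2] need not vanish, so
    this term is controlled only through the smallness of [F1]. *)
Let pointwise1 t : `|u t - complex.Re (ii * w t * G1 t) -
    k ^+ 2 * (nm (W t i j) ^+ 2 * complex.Re (F2 t))|
  <= 16 * V2m t + nm (W t i j) ^+ 2 * nm (F1 t).
Proof.
have := first_order_expansion (H'1 t i i) (H'1 t i j) (H'1 t j i) (H'1 t j j)
  (H1 t j i) (H1 t i i) al1 be1 (sub_eq t j i) (sub_eq t i i).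
set E := (X in nm X <= _) => hE.
have k2 : k ^+ 2 <= 1 by case/andP: k01 => *; rewrite exprn_ile1.
have -> : u t - complex.Re (ii * w t * G1 t) -
    k ^+ 2 * (nm (W t i j) ^+ 2 * complex.Re (F2 t)) =
    complex.Re (E + w t * w t * F1 t).
  have -> : E + w t * w t * F1 t = ii * w t * H t j i * (A + B * (H t i i)^*) -
      (ii * w t * G1 t + w t * (w t)^* * F2 t).
    rewrite -[E]/(ii * w t * H t j i * (A + B * (H t i i)^*) -
      (ii * w t * G1 t + w t * w t * F1 t + w t * (w t)^* * F2 t)).
    move: (_ * (A + B * _)) (ii * w t * G1 t) (w t * w t * F1 t) (_ * F2 t) => *; ring.
  have e2 : complex.Re (w t * (w t)^* * F2 t) =
      k ^+ 2 * (nm (W t i j) ^+ 2 * complex.Re (F2 t)).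
    by rewrite mul_conj cReZ nmw exprMn -[LHS]mulrA.
  have e3 (z1 z2 z3 : R[i]) : complex.Re (z1 - (z2 + z3)) =
      complex.Re z1 - complex.Re z2 - complex.Re z3.
    by rewrite cReB cReD opprD addrA.
  by rewrite [RHS]e3 e2.
apply: (le_trans (nm_Re _)); apply: (le_trans (nmD _ _)); apply: lerD.
  apply: (le_trans hE); rewrite ler_wpM2l//; apply: ler_pM; last exact: min_nmw.
  - exact: sqr_ge0.
  - by rewrite le_min ler01 nm_ge0.
  by rewrite nmw exprMn -[leRHS]mul1r ler_wpM2r ?sqr_ge0.
rewrite (nmM (w t * w t) (F1 t)); apply: ler_pM; rewrite ?nm_ge0//.
by rewrite nmM -expr2 nmw exprMn -[leRHS]mul1r ler_wpM2r ?sqr_ge0.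
Qed.

Let pointwise2 t : nm (F1 t) + `|complex.Re (F2 t) - g t| <=
  8 * (nm (H t i j) ^+ 2 + nm (H t j i) ^+ 2) + 74 * Num.min 1 (nm (W t i j)).
Proof.
have := second_order_coefficients (H'1 t i i) (H'1 t i j) (H'1 t j i) (H'1 t j j)
  (H1 t i j) (H1 t j i) (H1 t i i) (H1 t j j) al1 be1
  (sub_eq t i i) (sub_eq t j i) (sub_eq t j j) (sub_eq t i j).
by move=> h; apply: (le_trans h); rewrite lerD2l ler_wpM2l.
Qed.

(** In expectation the linear term drops out and the quadratic ones factor through [mvar i j]. Then
    [F2] is traded for the full diagonal product and [F1] for squares of off-diagonal entries, at a
    cost of order [mvar i j] times the expected minimum, which Chebyshev controls. *)
Lemma pair_bound (e : R) : 0 < e <= 1 ->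
  `|Ex P (fun t => complex.Re (ii * (k%:C%C * W t i j) * H t j i *
                     (A + B * (H t i i)^*))) -
    k ^+ 2 * mvar i j * Ex P (fun t => complex.Re (H t j j * H t i i *
                     (A + B * (H t i i)^*)))| <=
  164 * (e * mvar i j + mtrunc e i j + mvar i j *
    (Ex P (fun t => nm (H t i j) ^+ 2) + Ex P (fun t => nm (H t j i) ^+ 2))).
Proof.
move=> e01; rewrite -/u -/g -/(Ex P u) -/(Ex P g).
have k2 : 0 <= k ^+ 2 <= 1.
  by case/andP: k01 => ? ?; rewrite sqr_ge0 exprn_ile1.
have [Ll El] := linear_term.
have mF1n := measurable_nm (T := T') mF1.
have F1n3 t : `|nm (F1 t)| <= 3 by rewrite ger0_norm ?nm_ge0.
have [LQ1 EQ1] := sqr_indep mF1n F1n3.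
have [LQ2 EQ2] := sqr_indep (proj1 mF2) (fun t => le_trans (nm_Re _) (F2_3 t)).
have LF1 : L1 P (fun t => nm (F1 t)).
  exact: L1_bounded (other_entries_measurable hW mF1n) F1n3.
have LF2 : L1 P (fun t => complex.Re (F2 t)).
  apply: (@L1_bounded _ _ _ _ 3) => [|t].
    by apply: (other_entries_measurable hW (i := i) (j := j)); case: mF2.
  exact: le_trans (nm_Re _) (F2_3 t).
have LV : L1 P V2m by apply: L1_sqr_min1_nm.
have Lm : L1 P (fun t => Num.min 1 (nm (W t i j))) by apply: L1_min1_nm.
have b1 : `|Ex P u - k ^+ 2 * mvar i j * Ex P (fun t => complex.Re (F2 t))| <=
    16 * Ex P V2m + mvar i j * Ex P (fun t => nm (F1 t)).
  rewrite -mulrA -EQ2 -EQ1 -ExZ// -ExZ// -ExD//; last exact: L1Z.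
  have -> : Ex P u = Ex P (fun t => u t - complex.Re (ii * w t * G1 t)).
    by rewrite ExB// El subr0.
  rewrite -ExB; [|exact: L1B|exact: L1Z].
  apply: Ex_norm_le => [||t]; last exact: pointwise1.
    by apply: L1B; [exact: L1B|exact: L1Z].
  by apply: L1D => //; exact: L1Z.
have LD : L1 P (fun t => complex.Re (F2 t) - g t) by exact: L1B.
have LDn : L1 P (fun t => `|complex.Re (F2 t) - g t|) by exact: integrable_norm LD.
have b2 : `|Ex P (fun t => complex.Re (F2 t)) - Ex P g| <=
    Ex P (fun t => `|complex.Re (F2 t) - g t|).
  by rewrite -ExB//; apply: Ex_norm_le.
have b3 : Ex P (fun t => nm (F1 t)) + Ex P (fun t => `|complex.Re (F2 t) - g t|) <=
    8 * (Ex P (fun t => nm (H t i j) ^+ 2) + Ex P (fun t => nm (H t j i) ^+ 2)) +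
    74 * Ex P (fun t => Num.min 1 (nm (W t i j))).
  rewrite -ExD// -ExD// -!ExZ//; last exact: L1D.
  rewrite -ExD; [|by apply: L1Z; exact: L1D|exact: L1Z].
  apply: Ex_le => [||t]; [exact: L1D| |exact: pointwise2].
  by apply: L1D; [by apply: L1Z; exact: L1D|exact: L1Z].
have b4 := Ex_sqr_min1_le (mW i j) (W2 i j) e01.
have b5 := secm_Ex_min1_le (mW i j) (W2 i j) e01.
have t0 : 0 <= mtrunc e i j by exact: truncm_ge0.
have s0 : 0 <= mvar i j by exact: secm_ge0.
rewrite -/(mvar i j) -/(mtrunc e i j) -/V2m in b4 b5.
have x0 : 0 <= Ex P (fun t => nm (H t i j) ^+ 2) by apply: Ex_ge0 => t; exact: sqr_ge0.
have y0 : 0 <= Ex P (fun t => nm (H t j i) ^+ 2) by apply: Ex_ge0 => t; exact: sqr_ge0.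
move: (Ex P u) (Ex P g) (Ex P V2m) (mvar i j) (mtrunc e i j)
  (Ex P (fun t => nm (F1 t))) (Ex P (fun t => complex.Re (F2 t)))
  (Ex P (fun t => `|complex.Re (F2 t) - g t|))
  (Ex P (fun t => nm (H t i j) ^+ 2)) (Ex P (fun t => nm (H t j i) ^+ 2))
  (Ex P (fun t => Num.min 1 (nm (W t i j)))) b1 b2 b3 b4 b5 t0 s0 x0 y0.
move=> U G V s ta f1 f2 df x y mm b1 b2 b3 b4 b5 t0 s0 x0 y0.
have -> : U - k ^+ 2 * s * G = (U - k ^+ 2 * s * f2) + k ^+ 2 * s * (f2 - G) by ring.
apply: (le_trans (ler_normD _ _)).
have b6 : `|k ^+ 2 * s * (f2 - G)| <= s * df.
  case/andP: k2 => k20 k21; rewrite normrM (ger0_norm (mulr_ge0 k20 s0)).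
  by apply: ler_pM => //; [exact: mulr_ge0|rewrite -[leRHS]mul1r ler_wpM2r].
have b7 : s * (f1 + df) <= s * (8 * (x + y) + 74 * mm) by rewrite ler_wpM2l.
have se : 0 <= e * s by rewrite mulr_ge0// ltW//; case/andP: e01.
have sx : 0 <= s * x by rewrite mulr_ge0.
have sy : 0 <= s * y by rewrite mulr_ge0.
lra.
Qed.

End pair.

End loop_equation.

(** * The loop equation summed along one row *)

Section loop_equation_row.
Context d (T : measurableType d) (R : realType) (P : probability T R).
Variables (n : nat) (W : T -> 'M[R[i]]_n) (k : R).
Hypothesis hW : hermitian_wigner P W.
Hypothesis W0 : forall i j, ccentered P (fun t => W t i j).
Hypothesis W2 : forall i j, L1 P (fun t => nm (W t i j) ^+ 2).
Hypothesis k01 : 0 <= k <= 1.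
Local Notation ii := ('i%C : R[i]).
Local Notation H t := (resolvent (k%:C%C *: W t)).
Local Notation mvar := (mvar P W).
Local Notation mtrunc := (mtrunc P W).

Let hX t : k%:C%C *: W t \is hermsymmx.
Proof. by apply: hermsymmx_scale; case: hW. Qed.

Let mW i j : cmeasurable (fun t => W t i j).
Proof. exact: wigner_cmeasurable hW i j. Qed.

Let H1 t i j : nm (H t i j) <= 1.
Proof. exact: nm_resolvent_le1. Qed.

Let cl (u v : R[i]) : nm u <= 1 -> nm v <= 1 -> nm (u * v) <= 1.
Proof. by move=> u1 v1; rewrite nmM mulr_ile1 ?nm_ge0. Qed.

Lemma loop_equation_bound (i : 'I_n) (al be e : R) :
  `|al| <= 1 -> `|be| <= 1 -> 0 < e <= 1 ->
  `|Ex P (fun t => complex.Re ((1 - H t i i - (k ^+ 2)%:C%C * H t i i *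
       \sum_j (mvar i j)%:C%C * H t j j) * (al%:C%C + be%:C%C * (H t i i)^*)))| <=
  500 * (e * (1 + \sum_j mvar i j) + (\sum_j mtrunc e i j) / e).
Proof.
move=> al1 be1 e01; have [e0 e1] := andP e01; have [k0 k1] := andP k01.
pose u j t := complex.Re (ii * (k%:C%C * W t i j) * H t j i *
  (al%:C%C + be%:C%C * (H t i i)^*)).
pose g j t := complex.Re (H t j j * H t i i * (al%:C%C + be%:C%C * (H t i i)^*)).
have Lu j : L1 P (u j) by exact: (L1_hopping_term hW W2 k01).
have Lg j : L1 P (g j) by exact: (L1_diagonal_term k hW).
have ptw t : complex.Re ((1 - H t i i - (k ^+ 2)%:C%C * H t i i *
       \sum_j (mvar i j)%:C%C * H t j j) * (al%:C%C + be%:C%C * (H t i i)^*)) =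
    \sum_j (u j t - k ^+ 2 * mvar i j * g j t).
  rewrite (one_sub_resolvent_diag (hX t)) mulrBl cReB sumrB; congr (_ - _).
    rewrite mulr_sumr mulr_suml cRe_sum; apply: eq_bigr => j _.
    by rewrite /u mxE !mulrA.
  rewrite mulr_sumr mulr_suml cRe_sum; apply: eq_bigr => j _.
  rewrite /g -cReZ; congr complex.Re; rewrite [in RHS]rmorphM/=.
  by move: (k ^+ 2)%:C%C (mvar i j)%:C%C (H t i i) (H t j j) (_ + _) => *; ring.
rewrite (Ex_ext _ ptw) Ex_sum; last by move=> j; apply: L1B => //; exact: L1Z.
apply: (le_trans (ler_norm_sum _ _ _)).
have s0 j : 0 <= mvar i j by exact: secm_ge0.
have t0 j : 0 <= mtrunc e i j by exact: truncm_ge0.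
have te j : mtrunc e i j <= mtrunc e i j / e.
  by rewrite ler_pdivlMr// -[leRHS]mulr1 ler_wpM2l.
have se j : mvar i j <= e ^+ 2 + mtrunc e i j by exact: secm_le.
pose x j := Ex P (fun t => nm (H t i j) ^+ 2).
pose y j := Ex P (fun t => nm (H t j i) ^+ 2).
have x0 j : 0 <= x j by apply: Ex_ge0 => t; exact: sqr_ge0.
have y0 j : 0 <= y j by apply: Ex_ge0 => t; exact: sqr_ge0.
have x1 j : x j <= 1.
  rewrite -[leRHS](Ex_cst P); apply: Ex_le => [||t]; [exact: (L1_sqr_resolvent k hW)|exact: L1_cst|].
  by rewrite exprn_ile1 ?nm_ge0.
have y1 j : y j <= 1.
  rewrite -[leRHS](Ex_cst P); apply: Ex_le => [||t]; [exact: (L1_sqr_resolvent k hW)|exact: L1_cst|].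
  by rewrite exprn_ile1 ?nm_ge0.
have sx : \sum_j x j <= 1.
  rewrite -Ex_sum; last by move=> j; exact: (L1_sqr_resolvent k hW).
  rewrite -[leRHS](Ex_cst P); apply: Ex_le => [||t]; last exact: ward_row_le1.
    by apply: L1_sum => j; exact: (L1_sqr_resolvent k hW).
  exact: L1_cst.
have sy : \sum_j y j <= 1.
  rewrite -Ex_sum; last by move=> j; exact: (L1_sqr_resolvent k hW).
  rewrite -[leRHS](Ex_cst P); apply: Ex_le => [||t]; last exact: ward_col_le1.
    by apply: L1_sum => j; exact: (L1_sqr_resolvent k hW).
  exact: L1_cst.
(* The extra [4 * e] on the diagonal pays for the first moment of [W i i] ([2 * e]) and for its
   variance ([2 * e ^+ 2]). It occurs once per row. *)
have term j : `|Ex P (fun t => u j t - k ^+ 2 * mvar i j * g j t)| <=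
    164 * (e * mvar i j) + 496 * (mtrunc e i j / e) + 164 * e * (x j + y j) +
    (if j == i then 4 * e else 0).
  rewrite ExB//; last exact: L1Z.
  rewrite ExZ//; have es0 : 0 <= e * mvar i j by rewrite mulr_ge0// ltW.
  have ee : e ^+ 2 <= e by rewrite expr2 -[leRHS]mulr1 ler_wpM2l// ltW.
  have xy0 : 0 <= e * (x j + y j) by rewrite mulr_ge0 ?addr_ge0// ltW.
  have te0 := le_trans (t0 j) (te j).
  have [ji|ji] := eqVneq j i; last first.
    rewrite addr0; apply: (le_trans (pair_bound hW W0 W2 k01 _ al1 be1 e01)); first by rewrite eq_sym.
    rewrite -/(x j) -/(y j).
    (* Inserting [mvar i j <= e ^+ 2 + mtrunc e i j] leaves a multiple of [x j + y j] by [e], whose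
       sum over [j] is at most [2 * e] by the Ward identities, and a truncated moment. *)
    have : mvar i j * (x j + y j) <= e * (x j + y j) + 2 * (mtrunc e i j).
      apply: (@le_trans _ _ ((e + mtrunc e i j) * (x j + y j))).
        rewrite ler_wpM2r ?addr_ge0//; have := se j; lra.
      rewrite mulrDl lerD2l mulrC ler_wpM2r//; have := x1 j; have := y1 j; lra.
    have := te j; lra.
  rewrite ji in es0 xy0 te0 *; apply: (le_trans (ler_normB _ _)).
  have u1 : `|Ex P (u i)| <= 2 * Ex P (fun t => nm (W t i i)).
    have LW := L1_nm (mW i i) (W2 i i).
    rewrite -ExZ//; apply: Ex_norm_le => [//||t]; first exact: L1Z.
    apply: (le_trans (nm_Re _)); rewrite !nmM nm_i mul1r nmRC ger0_norm//.
    have -> : 2 * nm (W t i i) = nm (W t i i) * 1 * 2 by ring.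
    apply: ler_pM; rewrite ?mulr_ge0 ?nm_ge0//; last first.
      by apply: nm_affine_le2 => //; rewrite nm_conj.
    apply: ler_pM; rewrite ?mulr_ge0 ?nm_ge0//.
    by rewrite -[leRHS]mul1r ler_wpM2r ?nm_ge0.
  have g1 : `|Ex P (g i)| <= 2.
    rewrite -[leRHS](Ex_cst P); apply: Ex_norm_le => [//||t]; first exact: L1_cst.
    apply: (le_trans (nm_Re _)); rewrite nmM -[leRHS]mul1r ler_pM ?nm_ge0 ?cl//.
    by apply: nm_affine_le2 => //; rewrite nm_conj.
  have V1 := Ex_nm_le (mW i i) (W2 i i) e01; rewrite -/(mtrunc e i i) /= in V1.
  have g2 : `|k ^+ 2 * mvar i i * Ex P (g i)| <= mvar i i * 2.
    rewrite normrM ger0_norm ?mulr_ge0 ?sqr_ge0//; apply: ler_pM => //.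
      by rewrite mulr_ge0 ?sqr_ge0.
    by rewrite -[leRHS]mul1r ler_wpM2r// exprn_ile1.
  have {}se := se i; have {}te := te i; have {}t0 := t0 i.
  rewrite mulrDr in xy0 *.
  move: (Ex P (u i)) (Ex P (g i)) (Ex P (fun t => nm (W t i i))) (mvar i i)
    (mtrunc e i i) u1 g2 V1 se te t0 es0 te0 => *; lra.
apply: (le_trans (ler_sum _ (fun j _ => term j))).
rewrite !big_split/= -!mulr_sumr -big_mkcond/= big_pred1_eq big_split/= -mulr_suml.
have es0 : 0 <= e * \sum_j mvar i j by rewrite mulr_ge0 ?sumr_ge0// ltW.
have te0 : 0 <= (\sum_j mtrunc e i j) / e by rewrite divr_ge0 ?sumr_ge0// ltW.
have : e * (\sum_j x j + \sum_j y j) <= e * 2 by rewrite (ler_wpM2l (ltW e0))//; lra.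
lra.
Qed.

End loop_equation_row.

(** * Moments of the diagonal resolvent entries *)

Section resolvent_diagonal.
Context d (T : measurableType d) (R : realType) (P : probability T R).
Variables (n : nat) (W : T -> 'M[R[i]]_n) (k : R).
Hypothesis hW : hermitian_wigner P W.
Hypothesis W0 : forall i j, ccentered P (fun t => W t i j).
Hypothesis W2 : forall i j, L1 P (fun t => nm (W t i j) ^+ 2).
Hypothesis k01 : 0 <= k <= 1.
Local Notation ii := ('i%C : R[i]).
Local Notation H t := (resolvent (k%:C%C *: W t)).
Local Notation mvar := (mvar P W).
Local Notation mtrunc := (mtrunc P W).

Let hX t : k%:C%C *: W t \is hermsymmx.
Proof. by apply: hermsymmx_scale; case: hW. Qed.

Let mW i j : cmeasurable (fun t => W t i j).
Proof. exact: wigner_cmeasurable hW i j. Qed.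

Let H1 t i j : nm (H t i j) <= 1.
Proof. exact: nm_resolvent_le1. Qed.

Let cH i j : cmeasurable (fun t => H t i j).
Proof. exact: (wigner_resolvent_cmeasurable k hW). Qed.

Definition rowvar (i : 'I_n) : R := \sum_j mvar i j.
Definition row_error (e : R) (i : 'I_n) : R :=
  500 * (e * (1 + rowvar i) + (\sum_j mtrunc e i j) / e).

(** Distances of [H_ii] to its value 1 at [k = 0]. In rows with bounded [rowvar], and up to
    [row_error], [bE] is at most of order [k], [aE] of order [k ^+ 2] and [vE] of order [k ^+ 3];
    the converse rests on this gap between [aE] and [vE]. *)
Definition aE i : R := Ex P (fun t => complex.Re (1 - H t i i)).
Definition bE i : R := Ex P (fun t => nm (1 - H t i i)).
Definition vE i : R := Ex P (fun t => nm (1 - H t i i) ^+ 2).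
Definition dE i j : R := Ex P (fun t => complex.Re (1 - H t i i * H t j j)).

Let s0 i j : 0 <= mvar i j.
Proof. exact: secm_ge0. Qed.

Let c1 i : cmeasurable (fun t => 1 - H t i i).
Proof. by apply: cmeasurableB; first exact: cmeasurable_cst. Qed.

Let n2 t i : nm (1 - H t i i) <= 2.
Proof. by apply: (le_trans (nmB _ _)); rewrite nm1; have := H1 t i i; lra. Qed.

Let L1a i : L1 P (fun t => complex.Re (1 - H t i i)).
Proof. exact: (@L1_Re_bounded _ _ _ P 2). Qed.

Let L1b i : L1 P (fun t => nm (1 - H t i i)).
Proof.
apply: (@L1_bounded _ _ _ _ 2) => [|t]; first exact: measurable_nm.
by rewrite ger0_norm ?nm_ge0.
Qed.

Let L1v i : L1 P (fun t => nm (1 - H t i i) ^+ 2).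
Proof.
apply: (@L1_bounded _ _ _ _ (2 ^+ 2)) => [|t].
  exact/measurable_funX/measurable_nm.
by rewrite ger0_norm ?sqr_ge0// ler_sqr ?nnegrE ?nm_ge0.
Qed.

Let L1hh i j : L1 P (fun t => complex.Re (H t i i * H t j j)).
Proof.
apply: (@L1_Re_bounded _ _ _ P 1) => [|t]; first exact: cmeasurableM.
by rewrite nmM mulr_ile1 ?nm_ge0.
Qed.

Let Re1B (z : R[i]) : complex.Re (1 - z) = 1 - complex.Re z.
Proof. by rewrite cReB. Qed.

Let dE_eq i j : Ex P (fun t => complex.Re (H t i i * H t j j)) = 1 - dE i j.
Proof.
have -> : dE i j = 1 - Ex P (fun t => complex.Re (H t i i * H t j j)).
  rewrite -[X in X - _](Ex_cst P) -ExB//; last exact: L1_cst.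
  by apply: Ex_ext => t; exact: Re1B.
by rewrite opprB addrC subrK.
Qed.

Let L1d i j : L1 P (fun t => complex.Re (1 - H t i i * H t j j)).
Proof. by under eq_fun do rewrite Re1B; apply: L1B => //; exact: L1_cst. Qed.

Lemma aE_eq i e : 0 < e <= 1 ->
  `|aE i - k ^+ 2 * \sum_j mvar i j * (1 - dE i j)| <= row_error e i.
Proof.
move=> e01.
have := loop_equation_bound hW W0 W2 k01 i (al := 1) (be := 0) _ _ e01.
rewrite normr1 normr0 lexx ler01 => /(_ isT isT).
congr (`|_| <= _); under eq_bigr do rewrite -dE_eq.
rewrite /aE mulr_sumr; under [in RHS]eq_bigr do rewrite mulrA -ExZ//.
rewrite -[in RHS]Ex_sum; last by move=> j; exact: L1Z.
rewrite -ExB//; last by apply: L1_sum => j; exact: L1Z.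
apply: Ex_ext => t; rewrite mul0r addr0 mulr1 cReB; congr (_ - _).
rewrite mulr_sumr cRe_sum; apply: eq_bigr => j _.
rewrite -cReZ; congr complex.Re; rewrite [in RHS]rmorphM/=.
by move: (k ^+ 2)%:C%C (mvar i j)%:C%C (H t i i) (H t j j) => *; ring.
Qed.

(** With [al = 1] and [be = -1] the test factor is the conjugate of [1 - H_ii], so the loop equation
    produces the second moment itself. What remains carries [k ^+ 2] besides [bE], which gains two
    orders over the trivial bound by [2 * bE]. *)
Lemma vE_le i e : 0 < e <= 1 ->
  vE i <= k ^+ 2 * rowvar i * bE i + row_error e i.
Proof.
move=> e01.
have := loop_equation_bound hW W0 W2 k01 i (al := 1) (be := -1) _ _ e01.
rewrite normrN normr1 lexx => /(_ isT isT).
set f := (X in Ex P X); move=> hf; rewrite -/(rowvar i) -/(row_error e i) in hf.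
have fge t : nm (1 - H t i i) ^+ 2 - k ^+ 2 * rowvar i * nm (1 - H t i i) <= f t.
  have -> : f t = nm (1 - H t i i) ^+ 2 - complex.Re ((k ^+ 2)%:C%C *
       (H t i i * (\sum_j (mvar i j)%:C%C * H t j j) * (1 - H t i i)^*)).
    have -> : nm (1 - H t i i) ^+ 2 =
       complex.Re ((1 - H t i i) * (1 - H t i i)^*) by rewrite mul_conj.
    have e1 : (1 - H t i i)^* = 1 - (H t i i)^* by rewrite (rmorphB _ 1)/= rmorph1.
    have e2 : 1%:C%C + (-1)%:C%C * (H t i i)^* = 1 - (H t i i)^*.
      by rewrite rmorphN1 mulN1r.
    rewrite -cReB /f e2 e1; congr complex.Re.
    by move: (\sum_(_ < _) _) (k ^+ 2)%:C%C (H t i i) => *; ring.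
  rewrite lerD2l lerN2 cReZ -(mulrA (k ^+ 2)) ler_wpM2l ?sqr_ge0//.
  apply: (le_trans (Re_mul_le _ _)); rewrite nm_conj ler_wpM2r ?nm_ge0//.
  rewrite nmM; apply: (@le_trans _ _ (1 * nm (\sum_j (mvar i j)%:C%C * H t j j))).
    by rewrite ler_wpM2r ?nm_ge0.
  rewrite mul1r; apply: (le_trans (nm_sum _ _ _)); apply: ler_sum => j _.
  by rewrite nmM nmRC ger0_norm// -[leRHS]mulr1 ler_wpM2l.
have Lf : L1 P f.
  apply: (@L1_Re_bounded _ _ _ P ((2 + k ^+ 2 * rowvar i) * 2)) => [|t].
    do ![apply: cmeasurableM | apply: cmeasurableB | apply: cmeasurableD
      | apply: cmeasurable_conj | exact: cH | exact: cmeasurable_cst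
      | apply: cmeasurable_sum => j].
  rewrite nmM; apply: ler_pM; rewrite ?nm_ge0//; last first.
    apply: nm_affine_le2; rewrite ?normrN ?normr1// nm_conj//.
  apply: (le_trans (nmB _ _)); rewrite lerD// nmM; apply: ler_pM; rewrite ?nm_ge0//.
    by rewrite nmM nmRC ger0_norm ?sqr_ge0// -[leRHS]mulr1 ler_wpM2l ?sqr_ge0.
  apply: (le_trans (nm_sum _ _ _)); apply: ler_sum => j _.
  by rewrite nmM nmRC ger0_norm// -[leRHS]mulr1 ler_wpM2l.
have : vE i - k ^+ 2 * rowvar i * bE i <= Ex P f.
  rewrite -ExZ// -ExB//; last exact: L1Z.
  by apply: Ex_le => //; apply: L1B => //; exact: L1Z.
by have := ler_norm (Ex P f); lra.
Qed.

(** From [1 - z w = (1 - z) + (1 - w) - (1 - z) (1 - w)], the last product being bounded by half the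
    sum of the squares. *)
Lemma dE_ge i j : aE i + aE j - (vE i + vE j) / 2 <= dE i j.
Proof.
rewrite -ExD// -ExD// mulrC -ExZ; last exact: L1D.
rewrite -ExB; [|exact: L1D|by apply: L1Z; exact: L1D].
apply: Ex_le => [||t] //; first by apply: L1B; [exact: L1D|by apply: L1Z; exact: L1D].
have -> : 1 - H t i i * H t j j =
    (1 - H t i i) + (1 - H t j j) - (1 - H t i i) * (1 - H t j j).
  by move: (H t i i) (H t j j) => *; ring.
rewrite [in leRHS]cReB [in leRHS]cReD lerD2l lerN2; apply: (le_trans (Re_mul_le _ _)).
have : 0 <= (nm (1 - H t i i) - nm (1 - H t j j)) ^+ 2 by exact: sqr_ge0.
move: (nm (1 - H t i i)) (nm (1 - H t j j)) => x y; rewrite !expr2; lra.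
Qed.

Lemma dE_ge0 i j : 0 <= dE i j.
Proof.
apply: Ex_ge0 => t; rewrite Re1B subr_ge0; apply: (le_trans (Re_mul_le _ _)).
by rewrite mulr_ile1 ?nm_ge0.
Qed.

Lemma dE_le i j : dE i j <= bE i + bE j.
Proof.
rewrite -ExD//; apply: Ex_le => [||t] //; first exact: L1D.
apply: (le_trans (ler_norm _)); apply: (le_trans (nm_Re _)).
have -> : 1 - H t i i * H t j j = (1 - H t i i) + H t i i * (1 - H t j j).
  by move: (H t i i) (H t j j) => *; ring.
apply: (le_trans (nmD _ _)); rewrite lerD2l nmM.
by rewrite -[leRHS]mul1r ler_wpM2r ?nm_ge0.
Qed.

Lemma bE_ge0 i : 0 <= bE i.
Proof. by apply: Ex_ge0 => t; exact: nm_ge0. Qed.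

Lemma bE_le2 i : bE i <= 2.
Proof. by rewrite -[leRHS](Ex_cst P); apply: Ex_le => //; exact: L1_cst. Qed.

(** No loop equation is involved: [1 - H_ii] is a sum of products [k W_ij H_ji], and after the
    arithmetic-geometric inequality the squares of [H_ji] sum to at most 1. *)
Lemma bE_le i : bE i <= k * (1 + rowvar i) / 2.
Proof.
have -> : k * (1 + rowvar i) / 2 =
    Ex P (fun t => k / 2 * (1 + \sum_j nm (W t i j) ^+ 2)).
  rewrite ExZ; last by apply: L1D; [exact: L1_cst|exact: L1_sum].
  rewrite ExD ?Ex_cst ?Ex_sum//; [|exact: L1_cst|exact: L1_sum].
  by rewrite mulrAC.
apply: Ex_le => [||t] //.
  by apply: L1Z; apply: L1D; [exact: L1_cst|exact: L1_sum].
rewrite (one_sub_resolvent_diag (hX t)) nmM nm_i mul1r.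
apply: (le_trans (nm_sum _ _ _)).
have [k0 _] := andP k01.
apply: (@le_trans _ _ (\sum_j (k / 2) * (nm (W t i j) ^+ 2 + nm (H t j i) ^+ 2))).
  apply: ler_sum => j _; rewrite mxE !nmM nmRC ger0_norm// -!mulrA ler_wpM2l//.
  have : 0 <= (nm (W t i j) - nm (H t j i)) ^+ 2 by exact: sqr_ge0.
  move: (nm (W t i j)) (nm (H t j i)) => x y; rewrite !expr2; lra.
rewrite -mulr_sumr ler_wpM2l ?divr_ge0// big_split/= addrC lerD2r.
exact: ward_col_le1.
Qed.

Definition devE (h : R) i : R := Ex P (fun t => nm (H t i i - h%:C%C) ^+ 2).

(** The choice [al = - h], [be = 1] makes the test factor the conjugate of [x = H_ii - h], so the
    loop equation contains [- |x|^2] plus terms with a factor [k ^+ 2]. *)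
Lemma contraction_row (h : R) (i : 'I_n) (e : R) :
  0 <= h <= 1 -> h = 1 - k ^+ 2 * h ^+ 2 -> 0 < e <= 1 ->
  devE h i <= row_error e i + 2 * k ^+ 2 * `|rowvar i - 1| +
    k ^+ 2 * \sum_j mvar i j * ((devE h j + devE h i) / 2).
Proof.
move=> /andP[h0 h1] hE e01; set y := devE h.
have := loop_equation_bound hW W0 W2 k01 i (al := - h) (be := 1) _ _ e01.
rewrite normrN normr1 ger0_norm// h1 lexx => /(_ isT isT).
set f := (X in Ex P X); move=> hf; rewrite -/(rowvar i) -/(row_error e i) in hf.
pose x j t := H t j j - h%:C%C.
have mx j : cmeasurable (x j) by apply: cmeasurableB => //; exact: cmeasurable_cst.
have x2 j t : nm (x j t) <= 2.
  by apply: (le_trans (nmB _ _)); rewrite nmRC ger0_norm//; have := H1 t j j; lra.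
have Ly j : L1 P (fun t => nm (x j t) ^+ 2).
  apply: (@L1_bounded _ _ _ _ (2 ^+ 2)) => [|t].
    exact/measurable_funX/measurable_nm.
  by rewrite ger0_norm ?sqr_ge0// ler_sqr ?nnegrE ?nm_ge0.
have Lf : L1 P f.
  apply: (@L1_Re_bounded _ _ _ P ((2 + k ^+ 2 * rowvar i) * 2)) => [|t].
    do ![apply: cmeasurableM | apply: cmeasurableB | apply: cmeasurableD
      | apply: cmeasurable_conj | exact: cH | exact: cmeasurable_cst
      | apply: cmeasurable_sum => j].
  rewrite nmM; apply: ler_pM; rewrite ?nm_ge0//; last first.
    by apply: nm_affine_le2; rewrite ?normrN ?normr1 ?ger0_norm// nm_conj.
  apply: (le_trans (nmB _ _)); rewrite lerD// nmM; apply: ler_pM; rewrite ?nm_ge0//.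
    by rewrite nmM nmRC ger0_norm ?sqr_ge0// -[leRHS]mulr1 ler_wpM2l ?sqr_ge0.
  apply: (le_trans (nm_sum _ _ _)); apply: ler_sum => j _.
  by rewrite nmM nmRC ger0_norm// -[leRHS]mulr1 ler_wpM2l.
have ptw t : nm (x i t) ^+ 2 <= - f t + 2 * k ^+ 2 * `|rowvar i - 1| +
    k ^+ 2 * \sum_j mvar i j * ((nm (x j t) ^+ 2 + nm (x i t) ^+ 2) / 2).
  pose S : R[i] := \sum_j (mvar i j)%:C%C * H t j j.
  pose Y : R[i] := \sum_j (mvar i j)%:C%C * x j t.
  have SE : S = (rowvar i)%:C%C * h%:C%C + Y.
    rewrite /rowvar rmorph_sum mulr_suml -big_split/=; apply: eq_bigr => j _.
    by rewrite -mulrDr addrC subrK.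
  have ReS : 0 <= complex.Re S.
    rewrite /S cRe_sum sumr_ge0// => j _; rewrite cReZ mulr_ge0//.
    exact: Re_resolvent_ge0.
  have fE : f t = (k ^+ 2 * (1 - rowvar i) * h ^+ 2) * complex.Re (x i t)
      - nm (x i t) ^+ 2 - k ^+ 2 * (h * complex.Re (Y * (x i t)^*))
      - k ^+ 2 * (nm (x i t) ^+ 2 * complex.Re S).
    have e4 (z1 z2 z3 z4 : R[i]) : complex.Re (z1 - z2 - z3 - z4) =
        complex.Re z1 - complex.Re z2 - complex.Re z3 - complex.Re z4.
      by rewrite !cReB.
    (* The fixed point equation replaces the 1 of the loop equation. The terms free of [x] then
       combine into a multiple of [1 - rowvar i]. *)
    have hC : (1 : R[i]) = h%:C%C + (k ^+ 2)%:C%C * (h%:C%C * h%:C%C).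
      by rewrite -!rmorphM -rmorphD -expr2; congr (_%:C%C); lra.
    have xC : (- h)%:C%C + 1%:C%C * (H t i i)^* = (x i t)^*.
      by rewrite /x (rmorphB _ (H t i i))/= conjRC rmorphN mul1r addrC.
    have kC : (k ^+ 2 * (1 - rowvar i) * h ^+ 2)%:C%C =
        (k ^+ 2)%:C%C * (1 - (rowvar i)%:C%C) * (h%:C%C * h%:C%C).
      by move: (k ^+ 2) (rowvar i) => K r; rewrite expr2 !rmorphM rmorphB rmorph1.
    rewrite /f xC -/S; transitivity (complex.Re (
        (k ^+ 2 * (1 - rowvar i) * h ^+ 2)%:C%C * (x i t)^* - x i t * (x i t)^* -
        (k ^+ 2)%:C%C * (h%:C%C * (Y * (x i t)^*)) -
        (k ^+ 2)%:C%C * ((x i t * (x i t)^*) * S))).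
      congr complex.Re; rewrite kC SE.
      have -> : H t i i = x i t + h%:C%C by rewrite /x subrK.
      rewrite {1}hC; clear SE.
      move: (k ^+ 2)%:C%C h%:C%C (rowvar i)%:C%C Y (x i t) ((x i t)^*).
      by move=> *; ring.
    by rewrite e4 mul_conj !cReZ cRe_conj.
  have q1 : (k ^+ 2 * (1 - rowvar i) * h ^+ 2) * complex.Re (x i t) <=
      2 * k ^+ 2 * `|rowvar i - 1|.
    have r2 : `|complex.Re (x i t)| <= 2 by exact: le_trans (nm_Re _) (x2 _ _).
    have K0 := sqr_ge0 k; have g0 := sqr_ge0 h.
    have g1 : h ^+ 2 <= 1 by rewrite exprn_ile1.
    move: (k ^+ 2) (h ^+ 2) K0 g0 g1 => K g K0 g0 g1.
    apply: (le_trans (ler_norm _)); rewrite !normrM distrC (ger0_norm K0) (ger0_norm g0).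
    have -> : 2 * K * `|rowvar i - 1| = K * `|rowvar i - 1| * 1 * 2 by ring.
    by rewrite !ler_pM ?mulr_ge0.
  have q2 : - (h * complex.Re (Y * (x i t)^*)) <=
      \sum_j mvar i j * ((nm (x j t) ^+ 2 + nm (x i t) ^+ 2) / 2).
    apply: (@le_trans _ _ (nm (Y * (x i t)^*))).
      apply: (le_trans (ler_norm _)); rewrite normrN normrM (ger0_norm h0).
      by apply: (le_trans (ler_wpM2l h0 (nm_Re _))); rewrite -[leRHS]mul1r ler_wpM2r ?nm_ge0.
    rewrite /Y mulr_suml; apply: (le_trans (nm_sum _ _ _)); apply: ler_sum => j _.
    rewrite !nmM nm_conj nmRC ger0_norm// -mulrA ler_wpM2l//.
    have : 0 <= (nm (x j t) - nm (x i t)) ^+ 2 by exact: sqr_ge0.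
    by move: (nm (x j t)) (nm (x i t)) => u v; rewrite !expr2; lra.
  (* This quadratic term has the favourable sign because diagonal resolvent entries have nonnegative
     real part, so it is simply dropped. *)
  have q3 : 0 <= k ^+ 2 * (nm (x i t) ^+ 2 * complex.Re S).
    by apply: mulr_ge0; [exact: sqr_ge0|apply: mulr_ge0 => //; exact: sqr_ge0].
  have q4 := ler_wpM2l (sqr_ge0 k) q2; rewrite mulrN in q4.
  by rewrite fE; lra.
have LS : L1 P (fun t => \sum_j mvar i j * ((nm (x j t) ^+ 2 + nm (x i t) ^+ 2) / 2)).
  apply: L1_sum => j; apply: L1Z; under eq_fun do rewrite mulrC; apply: L1Z.
  exact: L1D.
have yE j : y j = Ex P (fun t => nm (x j t) ^+ 2) by [].
have sE : \sum_j mvar i j * ((y j + y i) / 2) =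
    Ex P (fun t => \sum_j mvar i j * ((nm (x j t) ^+ 2 + nm (x i t) ^+ 2) / 2)).
  rewrite Ex_sum => [|j]; last first.
    by apply: L1Z; under eq_fun do rewrite mulrC; apply: L1Z; exact: L1D.
  apply: eq_bigr => j _; rewrite ExZ; last first.
    by under eq_fun do rewrite mulrC; apply: L1Z; exact: L1D.
  congr (_ * _); rewrite !yE mulrC -ExD// -ExZ; last exact: L1D.
  by apply: Ex_ext => t; rewrite mulrC.
have : y i <= - Ex P f + 2 * k ^+ 2 * `|rowvar i - 1| +
    k ^+ 2 * \sum_j mvar i j * ((y j + y i) / 2).
  rewrite sE -ExN// -[X in _ <= _ + X + _](Ex_cst P) -ExD; [|exact: L1N|exact: L1_cst].
  rewrite -ExZ// -ExD; [|by apply: L1D; [exact: L1N|exact: L1_cst]|exact: L1Z].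
  apply: Ex_le => [||t]; [exact: Ly| |exact: ptw].
  by apply: L1D; [apply: L1D; [exact: L1N|exact: L1_cst]|exact: L1Z].
move: hf; rewrite ler_norml => /andP[hf _].
set S := k ^+ 2 * \sum_j _; set q := 2 * _ * _; move: S q => S q; lra.
Qed.

End resolvent_diagonal.

(** * Polynomial approximation on a segment *)

Section weierstrass.
Variable R : realType.

(* Bernstein polynomials through their recursion in the degree, which makes
   both positivity and the variance identity one-line inductions. *)
Fixpoint bernstein (n : nat) (g : nat -> R) : {poly R} :=
  if n is m.+1 then 'X * bernstein m (g \o S) + (1 - 'X) * bernstein m g
  else (g 0%N)%:P.

(** The bracket is the second moment about [y - a] of a binomial variable with parameters [n] and
    [x]. The shift [a] is there for the induction: replacing [g] by [g \o S] replaces [a] by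
    [1 + a]. *)
Lemma bernstein_approx (n : nat) (g : nat -> R) (v A B a y x : R) :
  0 <= x <= 1 ->
  (forall j, (j <= n)%N -> `|g j - v| <= A + B * (j%:R + a - y) ^+ 2) ->
  `|(bernstein n g).[x] - v| <=
    A + B * (n%:R * (x * (1 - x)) + (n%:R * x + a - y) ^+ 2).
Proof.
move=> /andP[x0 x1]; elim: n g a => [|n ih] g a h /=.
  by rewrite hornerC !mul0r !add0r; have := h 0%N isT; rewrite add0r.
have -> : ('X * bernstein n (g \o S) + (1 - 'X) * bernstein n g).[x] =
    x * (bernstein n (g \o S)).[x] + (1 - x) * (bernstein n g).[x].
  by rewrite !hornerE.
have h1 := ih (g \o S) (1 + a); have h2 := ih g a.
have {}h1 : `|(bernstein n (g \o S)).[x] - v| <=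
    A + B * (n%:R * (x * (1 - x)) + (n%:R * x + (1 + a) - y) ^+ 2).
  by apply: h1 => j jn; have := h j.+1 jn; rewrite -natr1 addrA.
have {}h2 := h2 (fun j jn => h j (leqW jn)).
have -> : x * (bernstein n (g \o S)).[x] + (1 - x) * (bernstein n g).[x] - v =
   x * ((bernstein n (g \o S)).[x] - v) + (1 - x) * ((bernstein n g).[x] - v) by ring.
have x1' : 0 <= 1 - x by rewrite subr_ge0.
apply: (le_trans (ler_normD _ _)); rewrite !normrM (ger0_norm x0) (ger0_norm x1').
have {}h1 := ler_wpM2l x0 h1.
have {}h2 := ler_wpM2l x1' h2.
apply: (le_trans (lerD h1 h2)); rewrite le_eqVlt; apply/orP; left; apply/eqP.
by rewrite -natr1; ring.
Qed.

Lemma unif_continuous_segment (f : R -> R) (a b e : R) : continuous f -> 0 < e ->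
  exists2 d, 0 < d & forall x y, a <= x <= b -> `|y - x| < d -> `|f y - f x| < e.
Proof.
move=> cf e0.
pose Q (d x : R) := forall y, `|y - x| < d -> `|f y - f x| < e.
have nc : near_covering `[a, b].
  by apply/compact_near_coveringP; exact: segment_compact.
have : \forall d \near 0^'+, `[a, b] `<=` Q d.
  apply: nc => x _.
  have /cvgrPdist_lt/(_ (e / 2)) : f z @[z --> x] --> f x by exact: cf.
  have e2 : 0 < e / 2 by rewrite divr_gt0.
  move=> /(_ e2)/nbhs_ballP[d /= d0 hd].
  exists (ball x (d / 2), [set d' | 0 < d' < d / 2]) => /=.
    split; first by apply: nbhsx_ballx; rewrite divr_gt0.
    near=> d'; apply/andP; split; near: d'; first exact: nbhs_right_gt.
    by apply: nbhs_right_lt; rewrite divr_gt0.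
  move=> [x' d'] /= [xx' /andP[d'0 d'd]] y yx'.
  have fx z : `|x - z| < d -> `|f x - f z| < e / 2 by move=> xz; exact: hd.
  have h1 : `|f x - f x'| < e / 2 by apply: fx; apply: (lt_trans xx'); lra.
  have h2 : `|f x - f y| < e / 2.
    apply: fx; have -> : x - y = (x - x') - (y - x') by ring.
    have xx2 : `|x - x'| < d / 2 by exact: xx'.
    apply: (le_lt_trans (ler_normB _ _)); lra.
  have -> : f y - f x' = (f x - f x') - (f x - f y) by ring.
  apply: (le_lt_trans (ler_normB _ _)); lra.
move=> h; have [d [d0 hd]] : exists d, 0 < d /\ `[a, b] `<=` Q d.
  near (0 : R)^'+ => d; exists d; split; near: d => //.
  exact: nbhs_right_gt.
by exists d => // x y xab; apply: hd; rewrite /= in_itv.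
Unshelve. all: by end_near. Qed.

Lemma weierstrass01 (f : R -> R) (M e : R) : continuous f ->
  (forall x, `|f x| <= M) -> 0 < e ->
  exists p : {poly R}, forall x, 0 <= x <= 1 -> `|p.[x] - f x| <= e.
Proof.
move=> cf fM e0.
have M0 : 0 <= M by apply: le_trans (fM 0).
have e2 : 0 < e / 2 by rewrite divr_gt0.
have [d d0 hd] := unif_continuous_segment 0 1 cf e2.
(* Large enough for [M / (d ^+ 2 * n) <= e / 2], which is what the variance term amounts to, since
   [x * (1 - x) <= 1 / 2]. *)
pose n := (Num.truncn (M / d ^+ 2 / (e / 2))).+1.
have nb : M / d ^+ 2 / (e / 2) < n%:R by exact: truncnS_gt.
have n0 : (0 : R) < n%:R by rewrite ltr0n.
exists (bernstein n (fun j => f (j%:R / n%:R))) => x x01.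
have [x0 x1] := andP x01.
(* Chebyshev weight: at a node farther than [d] from [x], the trivial bound [2 * M] is at most [B]
   times the squared distance scaled by [n]. *)
pose B := 2 * M / (d ^+ 2 * n%:R ^+ 2).
have dn0 : 0 < d ^+ 2 * n%:R ^+ 2 by rewrite mulr_gt0// exprn_gt0.
have B0 : 0 <= B by rewrite divr_ge0 ?mulr_ge0// ltW.
have := @bernstein_approx n (fun j => f (j%:R / n%:R)) (f x) (e / 2) B 0 (n%:R * x) x x01.
rewrite addr0 subrr expr0n/= addr0 => h; apply: (le_trans (h _)).
  move=> j _; have [close|far] := ltP `|j%:R / n%:R - x| d.
    apply: (le_trans (ltW (hd _ _ x01 close))); rewrite lerDl.
    by apply: mulr_ge0 => //; exact: sqr_ge0.
  apply: (@le_trans _ _ (2 * M)).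
    by apply: (le_trans (ler_normB _ _)); have := fM x; have := fM (j%:R / n%:R); lra.
  apply: (@le_trans _ _ (B * (j%:R + 0 - n%:R * x) ^+ 2)); last by rewrite lerDr ltW.
  rewrite /B mulrAC ler_pdivlMr// ler_wpM2l ?mulr_ge0//.
  have -> : (j%:R + 0 - n%:R * x) ^+ 2 = `|j%:R / n%:R - x| ^+ 2 * n%:R ^+ 2.
    rewrite real_normK ?num_real// -exprMn; congr (_ ^+ 2).
    by rewrite mulrBl divfK ?gt_eqF//; ring.
  by rewrite ler_wpM2r ?sqr_ge0// ler_sqr ?nnegrE ?normr_ge0// ltW.
rewrite [leRHS](_ : e = e / 2 + e / 2); last by field.
rewrite lerD2l; have xx : x * (1 - x) <= 1 / 2.
  by have := sqr_ge0 (x - 1 / 2); rewrite expr2; lra.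
have q0 : 0 <= x * (1 - x) by rewrite mulr_ge0// subr_ge0.
apply: (@le_trans _ _ (M / d ^+ 2 / n%:R)).
  have -> : B * (n%:R * (x * (1 - x))) = M / d ^+ 2 / n%:R * (2 * (x * (1 - x))).
    by rewrite /B; field; rewrite !gt_eqF.
  rewrite -[leRHS]mulr1 ler_wpM2l//; last lra.
  by rewrite !divr_ge0 ?sqr_ge0// ltW.
by rewrite ler_pdivrMr// [leRHS]mulrC; move: nb; rewrite ltr_pdivrMr// => /ltW.
Qed.

Lemma weierstrass (f : R -> R) (M L e : R) : continuous f ->
  (forall x, `|f x| <= M) -> 0 < L -> 0 < e ->
  exists p : {poly R}, forall x, `|x| <= L -> `|p.[x] - f x| <= e.
Proof.
move=> cf fM L0 e0; pose g t := f (2 * L * t - L).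
have cg : continuous g.
  move=> t; apply: (@continuous_comp _ _ _ (fun t => 2 * L * t - L) f); last exact: cf.
  apply: cvgB; last exact: cvg_cst.
  by apply: cvgM; [exact: cvg_cst|exact: cvg_id].
have [p hp] := weierstrass01 cg (fun t => fM _) e0.
exists (p \Po ((2 * L)^-1 *: ('X + L%:P))) => x.
rewrite ler_norml => /andP[x1 x2]; rewrite horner_comp !hornerE.
have := hp ((2 * L)^-1 * (x + L)); rewrite /g mulVKf ?addrK; last first.
  by rewrite mulf_neq0// gt_eqF.
by apply; rewrite mulrC divr_ge0 ?ler_pdivrMr ?mul1r ?mulr_gt0//; lra.
Qed.

End weierstrass.

(** * Bounded continuous functions from the functions [qk k] and [x * qk k] *)

Section density.
Variable R : realType.
Implicit Types f g : R -> R.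

Definition qk (k x : R) : R := (1 + k ^+ 2 * x ^+ 2)^-1.

Lemma qk_den_gt0 (k x : R) : 0 < 1 + k ^+ 2 * x ^+ 2.
Proof. by rewrite ltr_wpDr// mulr_ge0// sqr_ge0. Qed.

Lemma qk_ge0 k x : 0 <= qk k x.
Proof. by rewrite invr_ge0 ltW// qk_den_gt0. Qed.

Lemma qk_le1 k x : qk k x <= 1.
Proof. by rewrite invf_le1 ?qk_den_gt0// lerDl mulr_ge0 ?sqr_ge0. Qed.

Lemma xqk_le (k x : R) : 0 < k -> `|x * qk k x| <= (2 * k)^-1.
Proof.
move=> k0; rewrite normrM (ger0_norm (qk_ge0 _ _)) /qk ler_pdivrMr ?qk_den_gt0//.
rewrite -ler_pdivrMl ?invr_gt0 ?mulr_gt0// invrK.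
have := sqr_ge0 (k * `|x| - 1); rewrite -[x ^+ 2]real_normK ?num_real// !expr2.
by move: `|x| => y; lra.
Qed.

Lemma continuous_qk (k : R) : continuous (qk k).
Proof.
move=> x; apply: cvgV; first exact/lt0r_neq0/qk_den_gt0.
apply: cvgD; first exact: cvg_cst.
by apply: cvgM; [exact: cvg_cst|exact: exprn_continuous].
Qed.

Lemma continuous_xqk (k : R) : continuous (fun x : R => x * qk k x).
Proof. by move=> x; apply: cvgM; [exact: cvg_id|exact: continuous_qk]. Qed.

Lemma sqr_xqk (k x : R) : k != 0 ->
  (x * qk k x) ^+ 2 = (k ^+ 2)^-1 * (qk k x - qk k x ^+ 2).
Proof.
move=> k0; have := qk_den_gt0 k x; rewrite /qk => /lt0r_neq0 d0.
by field; rewrite !exprMn d0 k0.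
Qed.

Lemma qk_mul (k l x : R) : k ^+ 2 - l ^+ 2 != 0 ->
  qk l x * qk k x = (k ^+ 2 - l ^+ 2)^-1 * (k ^+ 2 * qk k x - l ^+ 2 * qk l x).
Proof.
move=> kl; have := qk_den_gt0 k x; have := qk_den_gt0 l x.
rewrite /qk => /lt0r_neq0 d0 /lt0r_neq0 d1.
by field; rewrite ?exprMn ?d0 ?d1 ?kl.
Qed.

Lemma qk_sub (k l x : R) :
  qk l x - qk k x = (k ^+ 2 - l ^+ 2) * x ^+ 2 * qk k x * qk l x.
Proof.
have := qk_den_gt0 k x; have := qk_den_gt0 l x.
rewrite /qk => /lt0r_neq0 d0 /lt0r_neq0 d1.
by field; rewrite !exprMn d0 d1.
Qed.

(* The class need not be closed under products: products of the [qk k] with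
   distinct parameters are linear combinations, and powers are limits. *)
Theorem density_of_qk (C : (R -> R) -> Prop) :
  (forall a f g, C f -> C g -> C (fun x => a * f x + g x)) ->
  C (fun=> 1) ->
  (forall k, 0 < k <= 1 / 2 -> C (qk k)) ->
  (forall k, 0 < k <= 1 / 2 -> C (fun x => x * qk k x)) ->
  (forall f M, (forall x, `|f x| <= M) ->
     (forall A e, 0 < e -> exists g, [/\ C g, forall x, `|g x| <= M + 1 &
       forall x, `|x| <= A -> `|g x - f x| <= e]) -> C f) ->
  forall f M, continuous f -> (forall x, `|f x| <= M) -> C f.
Proof.
move=> Clin C1 Cq Cxq Clim.
have C0 : C (fun=> 0).
  have := Clin (-1) _ _ C1 C1; congr C; apply/funext => x; ring.
have CZ a f : C f -> C (fun x => a * f x).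
  by move=> /Clin/(_ C0); move/(_ a); congr C; apply/funext => x; rewrite addr0.
have CB f g : C f -> C g -> C (fun x => f x - g x).
  by move=> Cf Cg; have := Clin (-1) _ _ Cg Cf; congr C; apply/funext => x; ring.
(* Powers and mixed products are proved together. Partial fractions turn a mixed product into lower
   ones, and the next pure power is the limit of mixed products as [l] tends to [k]. The prefactor
   [p] will be 1 or the identity. *)
have pow (p : R -> R) : (forall k, 0 < k <= 1 / 2 -> C (fun x => p x * qk k x)) ->
    (forall k, 0 < k -> exists B, forall x, `|p x| * qk k x <= B) ->
    forall m k, 0 < k <= 1 / 2 -> C (fun x => p x * qk k x ^+ m.+1) /\
      forall l, 0 < l <= 1 / 2 -> l != k -> C (fun x => p x * qk l x * qk k x ^+ m).
  move=> Cp pB; elim=> [|m ih] k kk.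
    split; first by have := Cp k kk; congr C; apply/funext => x; rewrite expr1.
    by move=> l ll _; have := Cp l ll; congr C; apply/funext => x; rewrite expr0 mulr1.
  have [ih1 ih2] := ih k kk; have [k0 k1] := andP kk.
  have mixed l : 0 < l <= 1 / 2 -> l != k -> C (fun x => p x * qk l x * qk k x ^+ m.+1).
    move=> ll lk; have [l0 l1] := andP ll.
    have kl : k ^+ 2 - l ^+ 2 != 0.
      rewrite subr_sqr; apply: mulf_neq0; first by rewrite subr_eq0 eq_sym.
      by rewrite gt_eqF//; lra.
    have := CZ (k ^+ 2 - l ^+ 2)^-1 _ (CB _ _ (CZ (k ^+ 2) _ ih1) (CZ (l ^+ 2) _ (ih2 l ll lk))).
    congr C; apply/funext => x.
    have -> : p x * qk l x * qk k x ^+ m.+1 = p x * qk k x ^+ m * (qk l x * qk k x).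
      by rewrite exprS; ring.
    rewrite qk_mul// [qk k x ^+ m.+1]exprS.
    by move: (k ^+ 2 - l ^+ 2)^-1 => *; ring.
  split; last exact: mixed.
  have [B hB] := pB k k0.
  have B0 : 0 <= B by apply: le_trans (hB 0); rewrite mulr_ge0 ?qk_ge0.
  have bnd l x : `|p x * qk l x * qk k x ^+ m.+1| <= B * qk l x.
    have q0 : 0 <= qk l x * qk k x ^+ m.+1 by rewrite mulr_ge0 ?exprn_ge0 ?qk_ge0.
    rewrite -mulrA normrM (ger0_norm q0) exprS.
    have -> : `|p x| * (qk l x * (qk k x * qk k x ^+ m)) =
       (`|p x| * qk k x * qk k x ^+ m) * qk l x by ring.
    rewrite ler_wpM2r ?qk_ge0// -[leRHS]mulr1 ler_pM ?mulr_ge0 ?exprn_ge0 ?qk_ge0//.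
    by rewrite exprn_ile1 ?qk_ge0 ?qk_le1.
  apply: (Clim _ B) => [x|A e e0].
    apply: (le_trans _ (le_trans (bnd k x) _)); first by rewrite exprS mulrA.
    by rewrite -[leRHS]mulr1 ler_wpM2l// qk_le1.
  (* With [l = k * (1 - eta)] the error is at most [2 * eta * (B + 1)]: in [qk_sub] the factor
     [k ^+ 2 * x ^+ 2 * qk k x] is at most 1, uniformly in [x]. *)
  pose eta := Num.min (1 / 2) (e / (2 * (B + 1))).
  have B10 : 0 < 2 * (B + 1) by lra.
  have eta0 : 0 < eta by rewrite lt_min divr_gt0//= divr_gt0.
  have eta1 : eta <= 1 / 2 by rewrite ge_min lexx.
  have eta2 : 2 * (B + 1) * eta <= e.
    by rewrite mulrC -ler_pdivlMr// ge_min lexx orbT.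
  pose l := k * (1 - eta).
  have l0 : 0 < l by rewrite mulr_gt0//; lra.
  have ll : 0 < l <= 1 / 2.
    rewrite l0/=; apply: le_trans k1; rewrite -[leRHS]mulr1 (ler_wpM2l (ltW k0))//; lra.
  have lk : l != k.
    rewrite lt_eqF// -[ltRHS]mulr1 ltr_pM2l//; lra.
  exists (fun x => p x * qk l x * qk k x ^+ m.+1); split; first exact: mixed.
    move=> x; apply: (le_trans (bnd l x)).
    by apply: (@le_trans _ _ (B * 1)); [rewrite ler_wpM2l// qk_le1|rewrite mulr1 lerDl].
  move=> x _.
  have -> : p x * qk l x * qk k x ^+ m.+1 - p x * qk k x ^+ m.+2 =
     (k ^+ 2 - l ^+ 2) * x ^+ 2 * qk k x * (p x * qk l x * qk k x ^+ m.+1).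
    by rewrite [qk k x ^+ m.+2]exprS; transitivity (p x * qk k x ^+ m.+1 * (qk l x - qk k x));
      [ring|rewrite qk_sub; ring].
  have kl : k ^+ 2 - l ^+ 2 = k ^+ 2 * (2 * eta - eta ^+ 2) by rewrite /l; ring.
  have ee : 0 <= 2 * eta - eta ^+ 2 <= 2 * eta by rewrite expr2; nra.
  have q1 : 0 <= k ^+ 2 * x ^+ 2 * qk k x <= 1.
    apply/andP; split; first by rewrite mulr_ge0 ?qk_ge0// -exprMn sqr_ge0.
    by rewrite /qk ler_pdivrMr ?qk_den_gt0// mul1r lerDr.
  have := bnd l x => /le_trans/(_ (_ : _ <= B)) hb.
  rewrite kl; have -> : k ^+ 2 * (2 * eta - eta ^+ 2) * x ^+ 2 * qk k x *
    (p x * qk l x * qk k x ^+ m.+1) = (2 * eta - eta ^+ 2) * (k ^+ 2 * x ^+ 2 * qk k x) *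
      (p x * qk l x * qk k x ^+ m.+1) by ring.
  move: ee q1 => /andP[ee0 ee1] /andP[q10 q11].
  rewrite 2!normrM (ger0_norm ee0) (ger0_norm q10).
  apply: (@le_trans _ _ (2 * eta * 1 * (B + 1))); last first.
    by apply: le_trans eta2; rewrite mulr1; lra.
  apply: ler_pM; [by rewrite mulr_ge0|exact: normr_ge0|by apply: ler_pM|].
  apply: (@le_trans _ _ B); last lra.
  by apply: hb; rewrite -[leRHS]mulr1 ler_wpM2l// qk_le1.
have qpow k m : 0 < k <= 1 / 2 -> C (fun x => qk k x ^+ m).
  move=> kk; case: m => [|m].
    by move: C1; congr C; apply/funext => x; rewrite expr0.
  have [] := pow (fun=> 1) _ _ m k kk.
  - by move=> l ll; have := Cq l ll; congr C; apply/funext => x; rewrite mul1r.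
  - by move=> l l0; exists 1 => x; rewrite normr1 mul1r qk_le1.
  by move=> h _; move: h; congr C; apply/funext => x; rewrite mul1r.
have xqpow k m : 0 < k <= 1 / 2 -> C (fun x => x * qk k x ^+ m.+1).
  move=> kk; have [] := pow id _ _ m k kk => //.
  move=> l l0; exists ((2 * l)^-1) => x; rewrite -[X in _ * X](ger0_norm (qk_ge0 l x)).
  by rewrite -normrM xqk_le.
(* Two factors [x * qk k x] are traded for powers of [qk k] by [sqr_xqk], so only the exponents 0
   and 1 remain. *)
have upow k m j : 0 < k <= 1 / 2 -> C (fun x => (x * qk k x) ^+ m * qk k x ^+ j).
  move=> kk; have [k0 k1] := andP kk.
  elim/ltn_ind: m j => -[|[|m]] ih j.
  - by have := qpow k j kk; congr C; apply/funext => x; rewrite expr0 mul1r.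
  - by have := xqpow k j kk; congr C; apply/funext => x; rewrite expr1 exprS mulrA.
  have h := CZ (k ^+ 2)^-1 _ (CB _ _ (ih m (ltnW (ltnSn m.+1)) j.+1) (ih m (ltnW (ltnSn m.+1)) j.+2)).
  move: h; congr C; apply/funext => x.
  have -> : (x * qk k x) ^+ m.+2 = (x * qk k x) ^+ m * (x * qk k x) ^+ 2.
    by rewrite -exprD addn2.
  rewrite sqr_xqk ?gt_eqF// (exprS _ j.+1) (exprS _ j).
  by move: (k ^+ 2)^-1 (qk k x) (qk k x ^+ j) => *; ring.
have upoly k (p : {poly R}) : 0 < k <= 1 / 2 -> C (fun x => p.[x * qk k x]).
  move=> kk; have -> : (fun x => p.[x * qk k x]) =
      fun x => \sum_(i < size p) p`_i * (x * qk k x) ^+ i.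
    by apply/funext => x; rewrite horner_coef.
  elim: (size p) => [|n ih].
    by move: C0; congr C; apply/funext => x; rewrite big_ord0.
  have hn := upow k n 0%N kk.
  have := Clin p`_n _ _ hn ih; congr C; apply/funext => x.
  by rewrite big_ord_recr/= expr0 mulr1 addrC.
move=> f M cf fM; have M0 : 0 <= M by apply: le_trans (fM 0).
(* The inverse of [x -> x * qk k x] on [[-1/k, 1/k]]: the smaller root of [k^2 u x^2 - x + u = 0],
   rationalised so that it is continuous at [u = 0]. Since [Num.sqrt] is 0 on negative numbers, it
   is continuous on the whole line. *)
pose psi k u : R := 2 * u / (1 + Num.sqrt (1 - 4 * k ^+ 2 * u ^+ 2)).
have psi_den k u : 0 < 1 + Num.sqrt (1 - 4 * k ^+ 2 * u ^+ 2).
  by rewrite ltr_wpDr// sqrtr_ge0.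
have cpsi k : continuous (psi k).
  move=> u; apply: cvgM; first by apply: cvgM; [exact: cvg_cst|exact: cvg_id].
  apply: cvgV; first by rewrite gt_eqF.
  apply: cvgD; first exact: cvg_cst.
  apply: (continuous_comp (f := fun u : R => 1 - 4 * k ^+ 2 * u ^+ 2)
    (g := @Num.sqrt R)); last exact: sqrt_continuous.
  apply: cvgB; first exact: cvg_cst.
  by apply: cvgM; [exact: cvg_cst|exact: exprn_continuous].
have psiK k x : 0 < k -> k * `|x| <= 1 -> psi k (x * qk k x) = x.
  move=> k0 kx; have d0 := qk_den_gt0 k x.
  have kx2 : k ^+ 2 * x ^+ 2 <= 1.
    rewrite -exprMn -[_ ^+ 2]real_normK ?num_real// normrM (gtr0_norm k0).
    by rewrite exprn_ile1// mulr_ge0// ltW.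
  have e1 : 1 - 4 * k ^+ 2 * (x * qk k x) ^+ 2 =
      ((1 - k ^+ 2 * x ^+ 2) * qk k x) ^+ 2.
    by rewrite /qk; field; rewrite !exprMn; exact: lt0r_neq0.
  rewrite /psi e1 sqrtr_sqr ger0_norm ?mulr_ge0 ?qk_ge0 ?subr_ge0//.
  have -> : 1 + (1 - k ^+ 2 * x ^+ 2) * qk k x = 2 * qk k x.
    by rewrite /qk; field; rewrite !exprMn; exact: lt0r_neq0.
  have q0 : qk k x != 0 by rewrite /qk invr_neq0// lt0r_neq0.
  by move: (qk k x) q0 => q q0; field.
(* Weierstrass is applied on the range [[-1/(2k), 1/(2k)]] of [x * qk k x]. The minimum with 1 keeps
   the approximants below [M + 1], as the closure hypothesis demands. *)
have Cpsi k : 0 < k <= 1 / 2 -> C (fun x => f (psi k (x * qk k x))).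
  move=> kk; have [k0 k1] := andP kk.
  apply: (Clim _ M) => [x|A e e0]; first exact: fM.
  have cg : continuous (f \o psi k).
    by move=> u; apply: continuous_comp; [exact: cpsi|exact: cf].
  have L0 : 0 < (2 * k)^-1 by rewrite invr_gt0 mulr_gt0.
  have e10 : 0 < Num.min e 1 by rewrite lt_min e0 ltr01.
  have [p hp] := weierstrass cg (fun u => fM _) L0 e10.
  have close x : `|p.[x * qk k x] - f (psi k (x * qk k x))| <= Num.min e 1.
    by apply: hp; exact: xqk_le.
  exists (fun x => p.[x * qk k x]); split; first exact: upoly.
  - move=> x; have -> : p.[x * qk k x] = f (psi k (x * qk k x)) +
        (p.[x * qk k x] - f (psi k (x * qk k x))) by ring.
    apply: (le_trans (ler_normD _ _)); apply: lerD => //.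
    by apply: (le_trans (close x)); rewrite ge_min lexx orbT.
  - by move=> x _; apply: (le_trans (close x)); rewrite ge_min lexx.
apply: (Clim _ M) => // A e e0.
(* Makes [k <= 1 / 2] and puts [[-A, A]] inside [[-1/k, 1/k]], where [psi k] undoes [x * qk k x]. *)
pose k : R := (2 + `|A|)^-1.
have A2 : 0 < 2 + `|A| by rewrite ltr_wpDr.
have k0 : 0 < k by rewrite invr_gt0.
have k1 : k <= 1 / 2.
  by rewrite div1r lef_pV2 ?posrE// lerDl.
exists (fun x => f (psi k (x * qk k x))); split; first by apply: Cpsi; rewrite k0.
  by move=> x; apply: (le_trans (fM _)); rewrite lerDl.
move=> x xA; have kx : k * `|x| <= 1.
  rewrite /k ler_pdivrMl// mulr1; apply: (le_trans xA); apply: (le_trans (ler_norm A)).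
  by rewrite lerDr.
by rewrite psiK// subrr normr0 ltW.
Qed.

End density.

(** * Monotone linear functionals determined by their values on indicators *)

Section bounded_functionals.
Variable R : realType.
Local Notation TR := (measurableTypeR R).

(** The sum counts the positive integers up to [y], so it is the integer part of [y]. *)
Lemma count_le_trunc (m : nat) (y : R) : 0 <= y <= m%:R ->
  \sum_(j < m) ((j.+1%:R <= y)%R : nat)%:R <= y <=
  \sum_(j < m) ((j.+1%:R <= y)%R : nat)%:R + 1.
Proof.
elim: m => [|m ih] /andP[y0 ym].
  by rewrite big_ord0; move: y0 ym => /= ? ?; apply/andP; split; lra.
rewrite big_ord_recr/=; have [ym'|ym'] := lerP y m%:R.
  have /andP[i1 i2] := ih (introT andP (conj y0 ym')).
  have -> : (m.+1%:R <= y)%R = false by apply/negbTE; rewrite -ltNge -natr1; lra.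
  by rewrite addr0 i1.
have -> : \sum_(j < m) ((j.+1%:R <= y)%R : nat)%:R = m%:R :> R.
  rewrite (eq_bigr (fun=> 1)); first by rewrite sumr_const card_ord.
  move=> j _; have -> // : j.+1%:R <= y.
  by apply: le_trans (ltW ym'); rewrite ler_nat.
by rewrite -natr1 in ym *; case: (lerP (m%:R + 1) y) => /= ?; apply/andP; split; lra.
Qed.

(* Discretised layer cake: a functional agreeing with the measure [nu] on
   indicators is the integral with respect to [nu]. *)
Lemma Ex_functional (nu : probability TR R) (D : (R -> R) -> Prop)
    (Phi : (R -> R) -> R) :
  (forall a f g, D f -> D g -> D (fun x => a * f x + g x) /\
     Phi (fun x => a * f x + g x) = a * Phi f + Phi g) ->
  (forall B : set TR, measurable B -> D \1_B /\ Phi \1_B = fine (nu B)) ->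
  (forall f g, D f -> D g -> (forall x, f x <= g x) -> Phi f <= Phi g) ->
  forall f M, D f -> measurable_fun [set: TR] f -> (forall x, `|f x| <= M) ->
  Ex nu f = Phi f.
Proof.
move=> Plin Pind Ple.
have [D1 P1] : D (fun=> 1) /\ Phi (fun=> 1) = 1.
  have := Pind setT measurableT; rewrite probability_setT/=.
  by have -> : (\1_[set: TR] : R -> R) = fun=> 1 by apply/funext => x; rewrite indicT.
have [D0 P0] : D (fun=> 0) /\ Phi (fun=> 0) = 0.
  have [h1 h2] := Plin (-1) _ _ D1 D1.
  have e : (fun=> 0) = (fun=> -1 * 1 + 1) :> (R -> R) by apply/funext => x; ring.
  by rewrite e h2 P1; split => //; ring.
have unit_case f : D f -> measurable_fun [set: TR] f -> (forall x, 0 <= f x <= 1) ->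
    Ex nu f = Phi f.
  move=> Df mf f01.
  have Lf : L1 nu f.
    by apply: (@L1_bounded _ _ _ _ 1) => // x; have /andP[? ?] := f01 x; rewrite ger0_norm.
  pose B (m j : nat) : set TR := [set x | (j.+1%:R <= m%:R * f x)%R].
  have mB m j : measurable (B m j).
    rewrite -[B m j]setTI.
    have mm : measurable_fun [set: TR] (fun x => m%:R * f x) by exact: measurable_funM.
    exact: measurable_fun_le.
  have L1B' m j : L1 nu (\1_(B m j) : R -> R) by exact: integrable_indic.
  have ExB' m j : Ex nu (\1_(B m j)) = fine (nu (B m j)).
    by rewrite /Ex /Rintegral integral_indic// setIT.
  (* At [n = m] this is the integer part of [m * f x] divided by [m], a combination of indicators
     below [f] by at most [1 / m]. *)
  pose s m n x : R := \sum_(j < n) m%:R^-1 * \1_(B m j) x.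
  have sP m n : [/\ D (s m n), Phi (s m n) = Ex nu (s m n) & L1 nu (s m n)].
    elim: n => [|n [Ds Ps Ls]].
      have -> : s m 0%N = fun=> 0 by apply/funext => x; rewrite /s big_ord0.
      by rewrite P0 Ex_cst; split => //; exact: L1_cst.
    have -> : s m n.+1 = fun x => m%:R^-1 * \1_(B m n) x + s m n x.
      by apply/funext => x; rewrite /s big_ord_recr/= addrC.
    have [DI PI] := Pind _ (mB m n); have [DP ->] := Plin m%:R^-1 _ _ DI Ds.
    split => //; last by apply: L1D => //; exact: L1Z.
    by rewrite ExD ?ExZ ?ExB' ?PI ?Ps//; exact: L1Z.
  have sf m x : (0 < m)%N -> s m m x <= f x <= s m m x + m%:R^-1.
    move=> m0; have m0' : 0 < m%:R :> R by rewrite ltr0n.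
    have /andP[f0 f1] := f01 x.
    have y01 : 0 <= m%:R * f x <= m%:R.
      by rewrite mulr_ge0//= -[leRHS]mulr1 ler_wpM2l.
    have /andP[h1 h2] := count_le_trunc y01.
    have sE : s m m x = m%:R^-1 * \sum_(j < m) ((j.+1%:R <= m%:R * f x)%R : nat)%:R.
      by rewrite /s mulr_sumr; apply: eq_bigr => j _; rewrite indicE mem_setE.
    rewrite sE ler_pdivrMl// h1/=; rewrite -[X in _ <= _ + X]mulr1 -mulrDr.
    by rewrite ler_pdivlMl.
  have key m : (0 < m)%N -> `|Ex nu f - Phi f| <= m%:R^-1.
    move=> m0; have [Ds Ps Ls] := sP m m.
    have e1 : Ex nu (s m m) <= Ex nu f.
      by apply: Ex_le => // x; case/andP: (sf m x m0).
    have e2 : Ex nu f <= Ex nu (s m m) + m%:R^-1.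
      rewrite -[X in _ <= _ + X](Ex_cst nu) -ExD//; last exact: L1_cst.
      apply: Ex_le => // [|x]; first by apply: L1D => //; exact: L1_cst.
      by case/andP: (sf m x m0).
    have p1 : Phi (s m m) <= Phi f by apply: Ple => // x; case/andP: (sf m x m0).
    have p2 : Phi f <= m%:R^-1 + Phi (s m m).
      have [D2 P2] := Plin m%:R^-1 _ _ D1 Ds.
      have e : m%:R^-1 + Phi (s m m) = Phi (fun x => m%:R^-1 * 1 + s m m x).
        by rewrite P2 P1 mulr1.
      rewrite e; apply: Ple => // x.
      by rewrite mulr1 addrC; case/andP: (sf m x m0).
    by rewrite ler_norml; apply/andP; split; lra.
  apply/eqP; rewrite -subr_eq0 -normr_eq0 eq_le normr_ge0 andbT.
  apply/ler_addgt0Pl => e e0; rewrite addr0.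
  pose m := (Num.truncn e^-1).+1.
  have me : e^-1 < m%:R by exact: truncnS_gt.
  apply: (le_trans (key m _)) => //.
  by rewrite invf_ple ?posrE ?ltr0n// ltW.
(* An affine change brings the values into [[0, 1]]; [M + 1] keeps the scale positive even for
   [M = 0]. *)
move=> f M Df mf fM; pose K := M + 1.
have M0 : 0 <= M by apply: le_trans (fM 0).
have K0 : 0 < 2 * K by rewrite /K; lra.
have [Dh Ph] := Plin (1 / 2) _ _ D1 D0; rewrite P0 P1 in Ph.
have [Dg Pg] := Plin (2 * K)^-1 _ _ Df Dh; rewrite Ph in Pg.
have Lf : L1 nu f by exact: (@L1_bounded _ _ _ _ M).
have mg : measurable_fun [set: TR] (fun x => (2 * K)^-1 * f x + (1 / 2 * 1 + 0)).
  by apply: measurable_funD; [exact: measurable_funM|exact: measurable_cst].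
have := unit_case _ Dg mg; rewrite Pg ExD ?ExZ ?Ex_cst//; [|exact: L1Z|exact: L1_cst].
have g01 x : 0 <= (2 * K)^-1 * f x + (1 / 2 * 1 + 0) <= 1.
  have := fM x; rewrite ler_norml => /andP[f1 f2].
  have h1 : - (1 / 2) <= (2 * K)^-1 * f x.
    by rewrite [leRHS]mulrC ler_pdivlMr//; rewrite /K; lra.
  have h2 : (2 * K)^-1 * f x <= 1 / 2.
    by rewrite [leLHS]mulrC ler_pdivrMr//; rewrite /K; lra.
  by apply/andP; split; lra.
move=> /(_ g01)/addIr; apply: mulfI.
by rewrite invr_neq0// gt_eqF.
Qed.

End bounded_functionals.

(** * Integrals against the semicircle law *)

Section semicircle_integrals.
Variable R : realType.
Notation leb := (@lebesgue_measure R).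
Notation TR := (measurableTypeR R).
Local Notation dens := (@semicircle_density R).

Lemma semicircle_density_ge0 (x : R) : 0 <= dens x.
Proof. by rewrite mulr_ge0 ?sqrtr_ge0// invr_ge0 mulr_ge0// pi_ge0. Qed.

Lemma continuous_semicircle_density : continuous dens.
Proof.
move=> x; apply: cvgM; first exact: cvg_cst.
apply: (continuous_comp (f := fun y : R => Num.max (4 - y ^+ 2) 0)
  (g := @Num.sqrt R)); last exact: sqrt_continuous.
apply: (@continuous_max _ _ (fun y : R => 4 - y ^+ 2) (cst 0)); last exact: cvg_cst.
by apply: cvgB; [exact: cvg_cst|exact: exprn_continuous].
Qed.

Lemma measurable_semicircle_density : measurable_fun [set: R] dens.
Proof. by apply: continuous_measurable_fun; exact: continuous_semicircle_density. Qed.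

Lemma integrable_semicircle_density : leb.-integrable [set: R] (EFin \o dens).
Proof.
apply/integrableP; split; first by apply/measurable_EFinP; exact: measurable_semicircle_density.
under eq_integral => x _ do rewrite /= ger0_norm ?semicircle_density_ge0//.
have h : semicircle [set: TR] = 1%E := @probability_setT _ _ _ (@semicircle R).
by rewrite -[X in (X < _)%E]/(semicircle [set: TR]) h ltry.
Qed.

Let bounded_density (f : R -> R) (M : R) : measurable_fun [set: R] f ->
  (forall x, `|f x| <= M) -> leb.-integrable [set: R] (EFin \o (fun x => f x * dens x)).
Proof.
move=> mf fM; have M0 : 0 <= M by apply: le_trans (fM 0).
apply: (le_integrable _ _ _ (integrableZl measurableT M integrable_semicircle_density)) => //.
  by apply/measurable_EFinP; apply: measurable_funM => //; exact: measurable_semicircle_density.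
move=> x _ /=; rewrite lee_fin !normrM (ger0_norm M0).
by rewrite ler_wpM2r.
Qed.

(** The density defines the measure of sets; [Ex_functional] carries this over to bounded functions,
    the functional being integration of [g * dens]. *)
Lemma Ex_semicircle (f : R -> R) (M : R) : measurable_fun [set: R] f ->
  (forall x, `|f x| <= M) ->
  Ex (@semicircle R) f = \int[leb]_x (f x * dens x).
Proof.
move=> mf fM.
pose D (g : R -> R) := measurable_fun [set: R] g /\ exists M, forall x, `|g x| <= M.
have LD g : D g -> leb.-integrable [set: R] (EFin \o (fun x => g x * dens x)).
  by move=> [mg [K gK]]; exact: bounded_density gK.
apply: (@Ex_functional _ _ D (fun g => \int[leb]_x (g x * dens x)) _ _ _ f M) => //.
- move=> a g1 g2 D1 D2; split.
    have [m1 [M1 h1]] := D1; have [m2 [M2 h2]] := D2; split.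
      by apply: measurable_funD => //; exact: measurable_funM.
    exists (`|a| * M1 + M2) => x; apply: (le_trans (ler_normD _ _)).
    by rewrite lerD// normrM ler_wpM2l.
  rewrite -RintegralZl//; last exact: LD.
  rewrite -RintegralD//; [|exact: integrableZl (LD _ D1)|exact: LD].
  by apply: eq_Rintegral => x _; rewrite mulrDl mulrA.
- move=> B mB; split.
    split; first exact: measurable_indic.
    by exists 1 => x; rewrite indicE; case: (_ \in _); rewrite ?normr1 ?normr0.
  rewrite /Rintegral; congr fine; rewrite /= /semicircle [RHS]integral_mkcond.
  apply: eq_integral => x _; rewrite patchE indicE; case: (_ \in _); first by rewrite mul1r.
  by rewrite mul0r.
- move=> g1 g2 D1 D2 g12; apply: le_Rintegral => //; [exact: LD|exact: LD|].
  by move=> x _; rewrite ler_wpM2r ?semicircle_density_ge0.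
- by split => //; exists M.
Qed.

Let weight (t : R) : R := (2 * pi)^-1 * (2 * cos t) * (2 * cos t).

Let cts_2sin : continuous (fun t : R => 2 * sin t).
Proof. by move=> t; apply: cvgM; [exact: cvg_cst|exact: continuous_sin]. Qed.

Let cts_2cos : continuous (fun t : R => 2 * cos t).
Proof. by move=> t; apply: cvgM; [exact: cvg_cst|exact: continuous_cos]. Qed.

Let dsin2 (t : R) : is_derive t 1 (fun x : R => 2 * sin x) (2 * cos t).
Proof. exact: is_deriveZ. Qed.

Lemma semicircle_substitution (f : R -> R) : continuous f ->
  (\int[leb]_x (f x * dens x)%:E =
   \int[leb]_(t in `[(- (pi / 2))%R, (pi / 2)%R]) (f (2 * sin t) * weight t)%:E)%E.
Proof.
move=> cf; have pi0 := pi_gt0 R.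
have -> : (\int[leb]_x (f x * dens x)%:E =
    \int[leb]_(x in `[(-2)%R, 2%R]) (f x * dens x)%:E)%E.
  rewrite [RHS]integral_mkcond; apply: eq_integral => x _.
  rewrite patchE; case: ifPn => //; rewrite notin_setE/= in_itv/= => x2.
  rewrite /semicircle_density max_r ?sqrtr0 ?mulr0//.
  rewrite leNgt; apply/negP => x4; apply: x2; apply/andP; split; nra.
have e2 : 2 = 2 * sin (pi / 2) :> R by rewrite sin_pihalf mulr1.
have em2 : -2 = 2 * sin (- (pi / 2)) :> R by rewrite sinN sin_pihalf mulrN1.
have dF : derive1 (fun x : R => 2 * sin x) = (fun t => 2 * cos t).
  by apply/funext => t; rewrite derive1E; exact: (derive_val (is_derive := dsin2 t)).
have -> : `[(-2)%R, 2%R]%classic =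
    `[2 * sin (- (pi / 2)), 2 * sin (pi / 2)]%classic :> set R.
  by rewrite -em2 -e2.
rewrite (@integration_by_substitution_increasing _ (fun x => 2 * sin x))//; last 6 first.
- by move=> x y xI yI xy; rewrite ltr_pM2l// ltr_sin.
- by move=> x _; rewrite dF; exact: cts_2cos.
- by rewrite dF; apply/cvgP; apply: cvg_at_right_filter; exact: cts_2cos.
- by rewrite dF; apply/cvgP; apply: cvg_at_left_filter; exact: cts_2cos.
- split.
  + by move=> x _; apply: ex_derive.
  + by apply: cvg_at_right_filter; exact: cts_2sin.
  + by apply: cvg_at_left_filter; exact: cts_2sin.
- apply: continuous_subspaceT => x.
  by apply: cvgM; [exact: cf|exact: continuous_semicircle_density].
- apply: eq_integral => t; rewrite inE/= => tI; congr EFin.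
  rewrite dF [LHS]/= /semicircle_density.
  change (f (2 * sin t) * ((2 * pi)^-1 * Num.sqrt (Num.max (4 - (2 * sin t) ^+ 2) 0)) *
    (2 * cos t) = f (2 * sin t) * ((2 * pi)^-1 * (2 * cos t) * (2 * cos t))).
  rewrite -mulrA; congr (_ * (_ * _ * _)).
  have -> : 4 - (2 * sin t) ^+ 2 = (2 * cos t) ^+ 2.
    by have := cos2Dsin2 t; nra.
  rewrite max_l ?sqr_ge0// sqrtr_sqr ger0_norm// mulr_ge0//.
  exact: cos_ge0_pihalf.
- lra.
Qed.

Section qk_integral.
Variable k : R.
Hypothesis k0 : 0 < k.
Let K : R := Num.sqrt (1 + 4 * k ^+ 2).

Let K2 : K ^+ 2 = 1 + 4 * k ^+ 2.
Proof. by rewrite sqr_sqrtr// addr_ge0// mulr_ge0// sqr_ge0. Qed.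

Let K1 : 1 < K.
Proof.
have K0 : 0 <= K by exact: sqrtr_ge0.
rewrite -(ltr_pXn2r (n := 2))// ?nnegrE// expr1n K2 ltrDl mulr_gt0// exprn_gt0//.
Qed.

Let den (t : R) : R := 1 + (K - 1) * (sin t * sin t).

Let den_gt0 t : 0 < den t.
Proof.
rewrite /den ltr_wpDr//; apply: mulr_ge0; first by rewrite subr_ge0 ltW.
by rewrite -expr2 sqr_ge0.
Qed.

Let dden (t : R) : is_derive t 1 den ((K - 1) * (sin t * cos t + sin t * cos t)).
Proof.
rewrite /den; apply: is_derive_eq.
by rewrite /GRing.scale/= add0r mul1r.
Qed.

(** The tangent of the difference between [atan (K * tan t)] and [t], multiplied out by
    [cos t ^+ 2]: the denominator is then at least 1, so nothing is singular at the endpoints. *)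
Let ratio (t : R) : R := (K - 1) * (sin t * cos t) * (den t)^-1.

Let dratio (t : R) : is_derive t 1 ratio
  ((K - 1) * (1 - 2 * (sin t * sin t)) / den t -
   2 * (K - 1) ^+ 2 * (sin t * sin t) * (1 - sin t * sin t) / den t ^+ 2).
Proof.
have dV := is_deriveV (lt0r_neq0 (den_gt0 t)) (dden t).
rewrite /ratio; apply: is_derive_eq.
rewrite /GRing.scale/=.
have cc : cos t * cos t = 1 - sin t * sin t.
  by have := cos2Dsin2 t; rewrite !expr2; lra.
have d0 := lt0r_neq0 (den_gt0 t).
rewrite /= in d0 *.
have := cc; move: (sin t) (cos t) (den t) d0 (K - 1) => s c D D0 L cc'.
transitivity (L * (c * c - s * s) / D - 2 * L ^+ 2 * (s * s) * (c * c) / D ^+ 2).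
  by field.
by rewrite cc'; field.
Qed.

(* [t + atan (ratio t)] is the smooth branch of [atan (K * tan t)]. *)
Let angle (t : R) : R := t + atan (ratio t).

Let dangle (t : R) : is_derive t 1 angle (K / (1 + 4 * k ^+ 2 * (sin t * sin t))).
Proof.
have da := is_derive1_comp (is_derive1_atan (ratio t)) (dratio t).
have h : is_derive t 1 (id + (atan \o ratio)) _ := is_deriveD (is_derive_id t 1) da.
apply: (is_derive_eq h).
have cc : cos t * cos t = 1 - sin t * sin t.
  by have := cos2Dsin2 t; rewrite !expr2; lra.
have d0 := den_gt0 t.
have rr : ratio t ^+ 2 = (K - 1) ^+ 2 * (sin t * sin t) * (1 - sin t * sin t) / den t ^+ 2.
  by rewrite -cc /ratio; field; exact: lt0r_neq0.
have e4 : 4 * k ^+ 2 = K ^+ 2 - 1 by rewrite K2; ring.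
rewrite rr e4.
have s0 : 0 <= sin t * sin t by rewrite -expr2 sqr_ge0.
have KK := K1; rewrite /den in d0 *; move: (sin t * sin t) K s0 KK d0 => S L S0 L1 D0.
have n0 : 0 < 1 + (L ^+ 2 - 1) * S.
  by rewrite ltr_wpDr// mulr_ge0// subr_ge0 exprn_ege1// ltW.
have n1 : 1 + (L - 1) ^+ 2 * S * (1 - S) / (1 + (L - 1) * S) ^+ 2 =
    (1 + (L ^+ 2 - 1) * S) / (1 + (L - 1) * S) ^+ 2.
  by field; exact: lt0r_neq0.
rewrite n1; field; do ?[apply/andP; split]; try exact: lt0r_neq0.
Qed.

(** Writing [4 k^2 cos^2 t = K^2 - (1 + 4 k^2 sin^2 t)] splits the integrand into a constant and a
    multiple of the derivative of [angle]. *)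
Let prim (t : R) : R := (2 * pi)^-1 * (k ^+ 2)^-1 * (K * angle t - t).

Let dprim (t : R) : is_derive t 1 prim (qk k (2 * sin t) * weight t).
Proof.
have da := dangle t; rewrite /prim; apply: is_derive_eq.
rewrite /GRing.scale/= /qk /weight.
have cc : cos t ^+ 2 = 1 - sin t ^+ 2 by have := cos2Dsin2 t; lra.
have -> : (2 * pi)^-1 * (2 * cos t) * (2 * cos t) = (2 * pi)^-1 * (4 * cos t ^+ 2) by ring.
rewrite cc.
have -> : K * (K / (1 + 4 * k ^+ 2 * (sin t * sin t))) =
    (1 + 4 * k ^+ 2) / (1 + 4 * k ^+ 2 * (sin t * sin t)) by rewrite mulrA -expr2 K2.
have s0 : 0 <= sin t ^+ 2 by exact: sqr_ge0.
have p0 := lt0r_neq0 (pi_gt0 R); have kk := lt0r_neq0 k0.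
have n0 : 1 + 4 * k ^+ 2 * sin t ^+ 2 != 0.
  rewrite lt0r_neq0// ltr_wpDr//; apply: mulr_ge0 => //.
  by apply: mulr_ge0 => //; exact: sqr_ge0.
move: (sin t) (pi : R) p0 kk n0 => s p p0 kk n0.
have n1 : 1 + k ^+ 2 * (2 * s) ^+ 2 != 0 by move: n0; congr (_ != 0); ring.
field; do ?[apply/andP; split] => //.
by move: n1; congr (_ != 0); ring.
Qed.

(** At both endpoints [ratio] vanishes, so the increment is [(K - 1) / (2 k^2)]; the factorisation
    [4 k^2 = (K - 1) (K + 1)] does the rest. *)
Lemma Ex_semicircle_qk : Ex (@semicircle R) (qk k) = 2 / (1 + K).
Proof.
have cq := @continuous_qk R k.
rewrite (@Ex_semicircle _ 1); last first.
- by move=> x; rewrite ger0_norm ?qk_ge0 ?qk_le1.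
- exact: continuous_measurable_fun.
rewrite /Rintegral semicircle_substitution//.
have pi0 := pi_gt0 R.
have cP : continuous prim.
  move=> t; apply: differentiable_continuous; apply/derivable1_diffP.
  exact: (ex_derive (is_derive := dprim t)).
rewrite (@continuous_FTC2 R (fun t => qk k (2 * sin t) * weight t) prim)//.
- have prat (t : R) : cos t = 0 -> ratio t = 0.
    by rewrite /ratio => ->; rewrite mulr0 mulr0 mul0r.
  rewrite /= /prim /angle !prat ?cosN ?cos_pihalf// atan0 !addr0.
  have kk : 4 * k ^+ 2 = K ^+ 2 - 1 by rewrite K2; ring.
  have k20 : k ^+ 2 = (K - 1) * (K + 1) / 4 by rewrite -subr_sqr_1 -kk; field.
  rewrite k20; move: (pi : R) pi0 K K1 => p p0 L L1.
  field; do ?[apply/andP; split]; rewrite lt0r_neq0//; lra.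
- lra.
- apply: continuous_subspaceT => t; apply: cvgM.
    by apply: (continuous_comp (f := fun t : R => 2 * sin t) (g := qk k)); [exact: cts_2sin|exact: cq].
  by apply: cvgM; [apply: cvgM; [exact: cvg_cst|exact: cts_2cos]|exact: cts_2cos].
- split.
  + by move=> x _; exact: (ex_derive (is_derive := dprim x)).
  + by apply: cvg_at_right_filter; exact: cP.
  + by apply: cvg_at_left_filter; exact: cP.
- by move=> t _; rewrite derive1E; exact: (derive_val (is_derive := dprim t)).
Qed.

Lemma semicircle_fixed_point : let h := Ex (@semicircle R) (qk k) in
  [/\ 0 <= h, h <= 1 & h = 1 - k ^+ 2 * h ^+ 2].
Proof.
rewrite /= Ex_semicircle_qk; split.
- by rewrite divr_ge0// addr_ge0// ltW// (lt_trans _ K1).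
- rewrite ler_pdivrMr ?mul1r; have := K1; lra.
- have kk : k ^+ 2 = (K ^+ 2 - 1) / 4 by rewrite K2; field.
  by rewrite kk; field; rewrite lt0r_neq0//; have := K1; lra.
Qed.

Lemma Ex_semicircle_xqk : Ex (@semicircle R) (fun x => x * qk k x) = 0.
Proof.
have cq := @continuous_xqk R k.
rewrite (@Ex_semicircle _ (2 * k)^-1); last first.
- by move=> x; exact: xqk_le.
- exact: continuous_measurable_fun.
have pi0 := pi_gt0 R.
rewrite /Rintegral semicircle_substitution//.
pose g t := 2 * sin t * qk k (2 * sin t) * weight t.
have cg : continuous g.
  move=> t; apply: cvgM.
    by apply: (continuous_comp (f := fun t : R => 2 * sin t) (g := fun x : R => x * qk k x)); [exact: cts_2sin|exact: cq].
  by apply: cvgM; [apply: cvgM; [exact: cvg_cst|exact: cts_2cos]|exact: cts_2cos].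
have gN t : g (- t) = - g t.
  by rewrite /g /weight sinN cosN /qk mulrN sqrrN !mulNr.
pose I := (\int[leb]_(t in `[(- (pi / 2))%R, (pi / 2)%R]) (g t)%:E)%E.
rewrite -[X in fine X]/I.
(* The reflection [t -> - t] preserves the interval and changes the sign of the integrand. *)
have eI : (I = - I)%E.
  rewrite {1}/I -[X in `[_, X]]opprK integration_by_substitution_oppr//; last 2 first.
  - lra.
  - exact: continuous_subspaceT.
  rewrite /I -mulN1e -integralZl//; last first.
    by apply: continuous_compact_integrable; [exact: segment_compact|exact: continuous_subspaceT].
  by apply: eq_integral => t _; rewrite /= gN -EFinM mulN1r.
by case: I eI => [r| |] //= [] e; lra.
Qed.

End qk_integral.
End semicircle_integrals.

Lemma cvgn_sum (R : realType) (I : Type) (r : seq I) (h : I -> nat -> R) (l : I -> R) :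
  (forall i, h i m @[m --> \oo] --> l i) ->
  \sum_(i <- r) h i m @[m --> \oo] --> \sum_(i <- r) l i.
Proof.
move=> hl; elim: r => [|i r ih].
  by rewrite big_nil; under eq_fun do rewrite big_nil; exact: cvg_cst.
by rewrite big_cons; under eq_fun do rewrite big_cons; exact: cvgD.
Qed.

(** * Spectral averages and resolvent traces *)

Section spectral_sums.
Context (R : realType) (n : nat).
Local Notation TR := (measurableTypeR R).
Local Notation M := 'M[R[i]]_n.+1.
Implicit Types f g : R -> R.

(** The integral of [f] against [esd A], kept as a finite sum so that it makes sense for every [f]
    without measurability. *)
Definition specsum f (A : M) : R :=
  n.+1%:R^-1 * \sum_(i < n.+1) f (complex.Re (spectral_diag A 0 i)).

Lemma specsumD (a : R) f g (A : M) :
  specsum (fun x => a * f x + g x) A = a * specsum f A + specsum g A.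
Proof. by rewrite /specsum big_split/= -mulr_sumr mulrDr mulrCA. Qed.

Lemma specsum_cst (a : R) (A : M) : specsum (fun=> a) A = a.
Proof. by rewrite /specsum sumr_const card_ord -[a *+ _]mulr_natl mulKf// pnatr_eq0. Qed.

Lemma le_specsum f g (A : M) : (forall x, f x <= g x) -> specsum f A <= specsum g A.
Proof.
by move=> fg; rewrite ler_wpM2l ?invr_ge0//; apply: ler_sum => i _; exact: fg.
Qed.

Lemma specsum_norm_le (K : R) f (A : M) : (forall x, `|f x| <= K) -> `|specsum f A| <= K.
Proof.
move=> fK; rewrite ler_norml; apply/andP; split.
  rewrite -(specsum_cst (- K) A); apply: le_specsum => x.
  by have := fK x; rewrite ler_norml => /andP[].
rewrite -[leRHS](specsum_cst K A); apply: le_specsum => x.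
by have := fK x; rewrite ler_norml => /andP[].
Qed.

Lemma specsum_indic (B : set TR) (A : M) : (specsum \1_B A)%:E = esd A B.
Proof.
by rewrite /specsum /esd EFinM -sumEFin; congr (_ * _)%E; apply: eq_bigr.
Qed.

Lemma cvg_specsum (h : nat -> R -> R) f (A : M) :
  (forall x, h m x @[m --> \oo] --> f x) -> specsum (h m) A @[m --> \oo] --> specsum f A.
Proof.
move=> hf; apply: cvgM; first exact: cvg_cst.
by apply: (cvgn_sum _ (h := fun i m => h m (complex.Re (spectral_diag A 0 i)))) => i; exact: hf.
Qed.

Section resolvent_trace.
Variables (A : M) (k : R).
Hypothesis hA : A \is hermsymmx.
Local Notation H := (resolvent (k%:C%C *: A)).

Let eigen_inv i : (1 + 'i%C * (k%:C%C * spectral_diag A 0 i))^-1 =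
  let x := complex.Re (spectral_diag A 0 i) in
  Complex (qk k x) (- (k * (x * qk k x))).
Proof.
have /mxOverP/(_ 0 i)/complex_realP[r er] := hermitian_spectral_diag_real hA.
rewrite er/= /qk; apply: (mulIf (_ : 1 + 'i%C * (k%:C%C * r%:C%C) != 0)).
  apply/eqP => /(congr1 (fun z => complex.Re z)).
  rewrite cReD (cReM 'i%C) (cImM k%:C%C)/= !(mul0r, mulr0, subr0, addr0).
  exact/eqP/oner_neq0.
rewrite mulVf; last first.
  apply/eqP => /(congr1 (fun z => complex.Re z)).
  rewrite cReD (cReM 'i%C) (cImM k%:C%C)/= !(mul0r, mulr0, subr0, addr0).
  exact/eqP/oner_neq0.
have d0 := lt0r_neq0 (qk_den_gt0 k r).
apply/eqP; rewrite eq_complex; apply/andP; split; apply/eqP.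
  rewrite cReM cReD cImD (cReM 'i%C) (cImM 'i%C) (cReM k%:C%C) (cImM k%:C%C)/=.
  by field; rewrite !exprMn.
rewrite cImM cReD cImD (cReM 'i%C) (cImM 'i%C) (cReM k%:C%C) (cImM k%:C%C)/=.
by field; rewrite !exprMn.
Qed.

Lemma specsum_qk : specsum (qk k) A = n.+1%:R^-1 * \sum_i complex.Re (H i i).
Proof.
rewrite /specsum -!cRe_sum -[X in complex.Re X]/(\tr H) trace_resolvent// cRe_sum.
by congr (_ * _); apply: eq_bigr => i _; rewrite eigen_inv.
Qed.

Lemma specsum_xqk :
  k * specsum (fun x => x * qk k x) A = - (n.+1%:R^-1 * \sum_i complex.Im (H i i)).
Proof.
rewrite /specsum -!cIm_sum -[X in complex.Im X]/(\tr H) trace_resolvent// cIm_sum.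
rewrite mulrCA -mulrN; congr (_ * _); rewrite -sumrN mulr_sumr.
by apply: eq_bigr => i _; rewrite eigen_inv/= opprK.
Qed.

End resolvent_trace.
End spectral_sums.

(** * Measurability and expectation of the spectral distribution *)

Section expected_spectral_distribution.
Context d (T : measurableType d) (R : realType) (P : probability T R) (n : nat).
Variable W : T -> 'M[R[i]]_n.+1.
Hypothesis hW : hermitian_wigner P W.
Local Notation TR := (measurableTypeR R).

Let hermW t : W t \is hermsymmx.
Proof. by case: hW. Qed.

Let mH k i j := wigner_resolvent_cmeasurable k hW i j.

Let m_qk (k : R) : measurable_fun [set: T] (fun t => specsum (qk k) (W t)).
Proof.
under eq_fun do rewrite specsum_qk//; apply: measurable_funM => //.
by apply: measurable_sum => i; case: (mH k i i).
Qed.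

Let m_xqk (k : R) : 0 < k ->
  measurable_fun [set: T] (fun t => specsum (fun x => x * qk k x) (W t)).
Proof.
move=> k0; have e t : specsum (fun x => x * qk k x) (W t) =
    k^-1 * (- (n.+1%:R^-1 * \sum_i complex.Im (resolvent (k%:C%C *: W t) i i))).
  by rewrite -specsum_xqk// mulKf// gt_eqF.
under eq_fun do rewrite e; apply: measurable_funM => //; apply: measurable_funN.
apply: measurable_funM => //.
by apply: measurable_sum => i; case: (mH k i i).
Qed.

(** Measurability of single eigenvalues is never established. The averages of [qk k] and [x * qk k]
    are resolvent traces, hence measurable, and the density theorem extends this to [f], pointwise
    limits preserving measurability. *)
Lemma measurable_specsum (f : R -> R) (M : R) : continuous f ->
  (forall x, `|f x| <= M) -> measurable_fun [set: T] (fun t => specsum f (W t)).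
Proof.
apply: (density_of_qk (C := fun f => measurable_fun [set: T] (fun t => specsum f (W t)))).
- move=> a g1 g2 m1 m2; under eq_fun do rewrite specsumD.
  by apply: measurable_funD => //; exact: measurable_funM.
- by under eq_fun do rewrite specsum_cst; exact: measurable_cst.
- by move=> k _; exact: m_qk.
- by move=> k /andP[k0 _]; exact: m_xqk.
move=> g K gK approx.
have approx' (m : nat) : exists h, measurable_fun [set: T] (fun t => specsum h (W t)) /\
    forall x, `|x| <= m%:R -> `|h x - g x| <= m.+1%:R^-1.
  have e0 : (0 : R) < m.+1%:R^-1 by rewrite invr_gt0.
  by have [h [h1 _ h3]] := approx m%:R _ e0; exists h.
have [h hP] := choice approx'.
apply: (@measurable_fun_cvg _ _ _ _ (fun m t => specsum (h m) (W t))).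
  by move=> m; have [] := hP m.
move=> t _; apply: cvg_specsum => x.
apply/cvgrPdist_le => e e0; near=> m.
have [_ hm] := hP m; rewrite distrC; apply: (le_trans (hm x _)).
  by near: m; exact: nbhs_infty_ger.
rewrite invf_ple ?posrE//; apply: (@le_trans _ _ m%:R); last by rewrite ler_nat.
by near: m; exact: nbhs_infty_ger.
Unshelve. all: by end_near. Qed.

(** Continuous functions converging pointwise to the indicator of the open half-line; they vanish at
    [x], which is why the half-line is open on the left. *)
Let ramp (x : R) (m : nat) (y : R) : R := Num.min 1 (Num.max 0 (m%:R * (y - x))).

Let ramp_cvg x y : ramp x m y @[m --> \oo] --> (\1_`]x, +oo[ y : R).
Proof.
rewrite indicE mem_setE in_itv/= andbT; have [xy|yx] := ltP x y; last first.
  have -> : (fun m => ramp x m y) = fun=> 0.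
    apply/funext => m; rewrite /ramp max_l ?min_r//.
    by rewrite mulr_ge0_le0// subr_le0.
  exact: cvg_cst.
apply/cvgrPdist_le => e e0; near=> m.
have h : 1 <= m%:R * (y - x).
  rewrite -ler_pdivrMr ?subr_gt0// mul1r.
  by near: m; exact: nbhs_infty_ger.
rewrite /ramp max_r; last exact: le_trans h.
by rewrite min_l// subrr normr0 ltW.
Unshelve. all: by end_near. Qed.

Let cts_ramp x m : continuous (ramp x m).
Proof.
move=> y; apply: (@continuous_min _ _ (cst 1) (fun y => Num.max 0 (m%:R * (y - x)))).
  exact: cvg_cst.
apply: (@continuous_max _ _ (cst 0) (fun y => m%:R * (y - x))); first exact: cvg_cst.
by apply: cvgM; [exact: cvg_cst|apply: cvgB; [exact: cvg_id|exact: cvg_cst]].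
Qed.

Let m_halfline (x : R) :
  measurable_fun [set: T] (fun t => specsum \1_(`]x, +oo[%classic : set TR) (W t)).
Proof.
apply: (@measurable_fun_cvg _ _ _ _ (fun m t => specsum (ramp x m) (W t))).
  move=> m; apply: (@measurable_specsum _ 1); first exact: cts_ramp.
  move=> y; rewrite ger0_norm /ramp ?ge_min ?lexx//.
  by rewrite le_min ler01 le_max lexx.
by move=> t _; apply: cvg_specsum => y; exact: ramp_cvg.
Qed.

Let G : set (set TR) := @RGenOInfty.G R.

Let setIG : setI_closed G.
Proof.
move=> _ _ [x ->] [y ->]; exists (Num.max x y).
by apply/seteqP; split => z /=; rewrite !in_itv/= !andbT gt_max => /andP.
Qed.

Let measG : (@measurable _ TR) = <<s G >>.
Proof. exact: RGenOInfty.measurableE. Qed.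

(** The sets with measurable mass form a lambda-system, and the open half-lines are a generating
    pi-system inside it. *)
Lemma measurable_esd (B : set TR) : measurable B ->
  measurable_fun [set: T] (fun t => esd (W t) B).
Proof.
pose L := [set B : set TR | measurable B /\
  measurable_fun [set: T] (fun t => esd (W t) B)].
suff : (@measurable _ TR) `<=` L by move=> h mB; have [] := h B mB.
rewrite [X in X `<=` _]measG; apply: lambda_system_subset => //.
- split => //.
  + split => //; under eq_fun do rewrite probability_setT; exact: measurable_cst.
  + move=> A B' BA [mA hA] [mB' hB']; split; first exact: measurableD.
    have e t : esd (W t) (A `\` B') = (esd (W t) A - esd (W t) B')%E.
      by rewrite measureD// ?setIidr// (le_lt_trans (probability_le1 _ _))// ltry.
    by under eq_fun do rewrite e; exact: emeasurable_funB.
  + move=> F ndF hF; split; first by apply: bigcup_measurable => j _; case: (hF j).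
    apply: (@emeasurable_fun_cvg _ _ _ _ (fun m t => esd (W t) (F m))).
      by move=> m; case: (hF m).
    move=> t _; apply: nondecreasing_cvg_mu => //.
      by move=> m; case: (hF m).
    by apply: bigcup_measurable => j _; case: (hF j).
- move=> _ [x ->]; split; first exact: measurable_itv.
  under eq_fun do rewrite -specsum_indic.
  exact/measurable_EFinP/m_halfline.
Qed.

Let mu t : probability TR R := esd (W t).
Let nu := expected_measure P mu.

(** The definition of [nu] prescribes its distribution function only. Complements give the open
    half-lines, and uniqueness of measures gives the remaining Borel sets. *)
Lemma expected_esdE (B : set TR) : measurable B -> nu B = (\int[P]_t mu t B)%E.
Proof.
have mmu B' : measurable B' -> measurable_fun [set: T] (fun t => mu t B').
  exact: measurable_esd.
move=> mB; rewrite -[RHS]/(mixture P mmu B).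
apply: (@measure_unique _ _ _ G (fun m => `]- (m%:R), +oo[%classic)) => //.
- by move=> m; exists (- m%:R).
- apply/seteqP; split => // x _; exists (Num.truncn `|x|).+1 => //=.
  rewrite in_itv/= andbT ltrNl; apply: (le_lt_trans (ler_norm _)).
  by rewrite normrN truncnS_gt.
- move=> _ [x ->]; have exm := expected_measureP P mmu x.
  have eC : `]x, +oo[%classic = ~` `]-oo, x]%classic :> set TR by rewrite setCitvl.
  have mx : measurable (`]-oo, x]%classic : set TR) by exact: measurable_itv.
  have h1 := @probability_setC _ _ _ nu _ mx.
  have h2 := @probability_setC _ _ _ (mixture P mmu) _ mx.
  rewrite eC; apply: (etrans h1); apply: etrans (esym h2); congr (1 - _)%E.
  exact: exm.
- by move=> m; rewrite (le_lt_trans (probability_le1 _ _))// ltry.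
Qed.

Lemma Ex_expected_esd (f : R -> R) (M : R) : continuous f ->
  (forall x, `|f x| <= M) -> Ex nu f = Ex P (fun t => specsum f (W t)).
Proof.
move=> cf fM.
pose D (g : R -> R) := measurable_fun [set: T] (fun t => specsum g (W t)) /\
  exists M, forall x, `|g x| <= M.
have LD g : D g -> L1 P (fun t => specsum g (W t)).
  move=> [mg [K gK]]; apply: (@L1_bounded _ _ _ _ K) => // t; exact: specsum_norm_le.
apply: (@Ex_functional _ _ D (fun g => Ex P (fun t => specsum g (W t))) _ _ _ f M) => //.
- move=> a g1 g2 D1 D2; split; last first.
    rewrite -ExZ; last exact: LD.
    rewrite -ExD; [|by apply: L1Z; exact: LD|exact: LD].
    by apply: Ex_ext => t; rewrite specsumD.
  have [m1 [M1 h1]] := D1; have [m2 [M2 h2]] := D2; split.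
    under eq_fun do rewrite specsumD.
    by apply: measurable_funD => //; exact: measurable_funM.
  exists (`|a| * M1 + M2) => x; apply: (le_trans (ler_normD _ _)).
  by rewrite lerD// normrM ler_wpM2l.
- move=> B mB; split.
    split; last by exists 1 => x; rewrite indicE; case: (_ \in _); rewrite ?normr1 ?normr0.
    have := measurable_esd mB; under eq_fun do rewrite -specsum_indic.
    by move=> /measurable_EFinP.
  rewrite expected_esdE// /Ex /Rintegral; congr fine.
  by apply: eq_integral => t _; rewrite specsum_indic.
- by move=> g1 g2 D1 D2 g12; apply: Ex_le => [||t]; [exact: LD|exact: LD|exact: le_specsum].
- split; [exact: measurable_specsum fM|by exists M].
- exact: continuous_measurable_fun.
Qed.

End expected_spectral_distribution.

(** * Deterministic inequalities for a symmetric variance profile *)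

Section variance_profile.
Context (R : realType) (n : nat).
Variable s : 'I_n -> 'I_n -> R.
Hypothesis s0 : forall i j, 0 <= s i j.
Hypothesis sC : forall i j, s i j = s j i.
Local Notation rho i := (\sum_j s i j).

Let rho0 i : 0 <= rho i.
Proof. by apply: sumr_ge0 => j _. Qed.

Lemma sum_profile_exchange (y : 'I_n -> R) :
  \sum_i \sum_j s i j * y j = \sum_i rho i * y i.
Proof.
rewrite exchange_big/=; apply: eq_bigr => i _; rewrite mulr_suml.
by apply: eq_bigr => j _; rewrite sC.
Qed.

(** By symmetry of [s] the averaged coupling term is [c] times the sum of [rho i * y i]. Replacing
    [rho i] by 1 costs [4 * c] times the deviation, because [y i <= 4]; with the [2 * c] already
    present this gives 6. *)
Lemma profile_contraction (c : R) (y E : 'I_n -> R) : 0 <= c ->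
  (forall i, 0 <= y i <= 4) ->
  (forall i, y i <= E i + 2 * c * `|rho i - 1| + c * \sum_j s i j * ((y j + y i) / 2)) ->
  (1 - c) * \sum_i y i <= \sum_i E i + 6 * c * \sum_i `|rho i - 1|.
Proof.
move=> c0 y04 h.
have e : \sum_i \sum_j s i j * ((y j + y i) / 2) = \sum_i rho i * y i.
  transitivity (\sum_i ((\sum_j s i j * y j) / 2 + rho i * y i / 2)).
    apply: eq_bigr => i _; rewrite !mulr_suml -big_split/=.
    by apply: eq_bigr => j _; ring.
  by rewrite big_split/= -!mulr_suml sum_profile_exchange; lra.
have h1 : \sum_i y i <= \sum_i E i + 2 * c * \sum_i `|rho i - 1| + c * \sum_i rho i * y i.
  rewrite -e !mulr_sumr -!big_split/=; apply: ler_sum => i _; exact: h.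
have h2 : \sum_i rho i * y i <= \sum_i y i + 4 * \sum_i `|rho i - 1|.
  rewrite mulr_sumr -big_split/=; apply: ler_sum => i _.
  have /andP[y0 y4] := y04 i.
  have : (rho i - 1) * y i <= `|rho i - 1| * 4.
    by apply: (le_trans (ler_wpM2r y0 (ler_norm _))); rewrite ler_wpM2l.
  by rewrite mulrBl mul1r; lra.
have := ler_wpM2l c0 h2; lra.
Qed.

Section bulk_rows.
Variable K : R.
Hypothesis K1 : 1 <= K.
Let S i := rho i <= K.

Definition tail_rows : R := \sum_(i | ~~ S i) rho i.
(** Columns are truncated along with rows: the block of bulk rows and bulk columns is symmetric, so
    sums over it can be exchanged. *)
Definition bulk_rho (i : 'I_n) : R := \sum_(j | S j) s i j.
Definition bulk_square : R := \sum_(i | S i) bulk_rho i ^+ 2.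

Let bulk_rho0 i : 0 <= bulk_rho i.
Proof. by apply: sumr_ge0 => j _. Qed.

Let bulk_rho_le i : bulk_rho i <= rho i.
Proof. by rewrite [leRHS](bigID S)/= lerDl sumr_ge0. Qed.

(** The mass lost in bulk rows sits in tail columns, and by symmetry of [s] it is part of the tail
    rows. *)
Let cross_le : \sum_(i | S i) (rho i - bulk_rho i) <= tail_rows.
Proof.
rewrite (eq_bigr (fun i => \sum_(j | ~~ S j) s i j)); last first.
  by move=> i _; rewrite /bulk_rho [X in X - _](bigID S)/= addrAC subrr add0r.
rewrite exchange_big/=; apply: ler_sum => j _.
rewrite [leRHS](bigID S)/= (eq_bigr (fun i => s j i)); last by move=> i _; rewrite sC.
by rewrite lerDl sumr_ge0.
Qed.

(** Cauchy-Schwarz in the form [|v| <= (u + v^2 / u) / 2], with [u] free. On tail rows [1 <= K]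
    gives [|rho i - 1| <= rho i]. In the expanded square the linear term loses [tail_rows] twice,
    once for dropped columns and once for dropped rows, hence the 4. *)
Lemma rho_deviation_le (u : R) : 0 < u ->
  \sum_i `|rho i - 1| <=
  (u * n%:R + (bulk_square - 2 * \sum_i rho i + 4 * tail_rows + n%:R) / u) / 2 + 2 * tail_rows.
Proof.
move=> u0; rewrite (bigID S)/=.
have h1 : \sum_(i | ~~ S i) `|rho i - 1| <= tail_rows.
  apply: ler_sum => i; rewrite /S -ltNge; move: K1; move: (rho i) => r K1' Kr.
  rewrite ger0_norm; last by rewrite subr_ge0; lra.
  by lra.
have h2 : \sum_(i | S i) `|rho i - 1| <= \sum_(i | S i) `|bulk_rho i - 1| + tail_rows.
  apply: (le_trans _ (lerD (lexx _) cross_le)); rewrite -big_split/=.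
  apply: ler_sum => i _; have -> : rho i - 1 = (bulk_rho i - 1) + (rho i - bulk_rho i) by ring.
  apply: (le_trans (ler_normD _ _)); rewrite lerD2l ger0_norm// subr_ge0.
  exact: bulk_rho_le.
have cS : \sum_(i | S i) (1 : R) <= n%:R.
  apply: (@le_trans _ _ (\sum_(i < n) (1 : R))).
    by rewrite [leRHS](bigID S)/= lerDl sumr_ge0.
  by rewrite sumr_const card_ord.
have h3 : \sum_(i | S i) `|bulk_rho i - 1| <=
    (u * \sum_(i | S i) 1 + (\sum_(i | S i) (bulk_rho i - 1) ^+ 2) / u) / 2.
  rewrite mulr_sumr mulr_suml -big_split/= mulr_suml; apply: ler_sum => i _.
  rewrite -[X in X / u]real_normK ?num_real//; move: `|_| => v.
  have : 0 <= (u - v) ^+ 2 / u by rewrite divr_ge0 ?sqr_ge0// ltW.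
  have -> : (u - v) ^+ 2 / u = u - 2 * v + v ^+ 2 / u.
    by field; rewrite gt_eqF.
  lra.
have h4 : \sum_(i | S i) (bulk_rho i - 1) ^+ 2 <=
    bulk_square - 2 * \sum_i rho i + 4 * tail_rows + n%:R.
  have -> : \sum_(i | S i) (bulk_rho i - 1) ^+ 2 =
      bulk_square - 2 * \sum_(i | S i) bulk_rho i + \sum_(i | S i) 1.
    rewrite /bulk_square mulr_sumr -sumrB -big_split/=.
    by apply: eq_bigr => i _; ring.
  have : \sum_i rho i = \sum_(i | S i) rho i + tail_rows by rewrite (bigID S).
  have := cross_le; rewrite sumrB; lra.
have h5 : (\sum_(i | S i) (bulk_rho i - 1) ^+ 2) / u <=
    (bulk_square - 2 * \sum_i rho i + 4 * tail_rows + n%:R) / u.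
  by rewrite ler_pdivrMr// divfK ?gt_eqF.
have := ler_wpM2l (ltW u0) cS; lra.
Qed.

Variables (k : R) (a b v E : 'I_n -> R) (dd : 'I_n -> 'I_n -> R).
Hypothesis k0 : 0 <= k.
Hypothesis a_eq : forall i, `|a i - k ^+ 2 * \sum_j s i j * (1 - dd i j)| <= E i.
Hypothesis dd_ge : forall i j, a i + a j - (v i + v j) / 2 <= dd i j.
Hypothesis dd_ge0 : forall i j, 0 <= dd i j.
Hypothesis dd_le : forall i j, dd i j <= b i + b j.
Hypothesis v_le : forall i, v i <= k ^+ 2 * rho i * b i + E i.
Hypothesis b_le : forall i, b i <= k * (1 + rho i) / 2.
Hypothesis b_le2 : forall i, b i <= 2.
Hypothesis b_ge0 : forall i, 0 <= b i.

Definition decorrelation : R := \sum_i \sum_j s i j * dd i j.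

Let E0 i : 0 <= E i.
Proof. exact: le_trans (a_eq i). Qed.

Let bK i : S i -> b i <= k * (1 + K) / 2.
Proof.
rewrite /S => iK; apply: (le_trans (b_le i)); rewrite ler_wpM2r// ler_wpM2l//.
by rewrite lerD2l.
Qed.

Lemma decorrelation_ge0 : 0 <= decorrelation.
Proof. by apply: sumr_ge0 => i _; apply: sumr_ge0 => j _; exact: mulr_ge0. Qed.

(** The crude bound, linear in [k] with a constant depending on [K]: tail rows use [b <= 2] and bulk
    rows the bound of order [k]. *)
Lemma decorrelation_le : decorrelation <= 4 * tail_rows + n%:R * (K * (1 + K) * k).
Proof.
have h1 : decorrelation <= 2 * \sum_i rho i * b i.
  apply: (@le_trans _ _ (\sum_i \sum_j s i j * (b i + b j))).
    by apply: ler_sum => i _; apply: ler_sum => j _; rewrite ler_wpM2l.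
  under eq_bigr => i _ do (under eq_bigr => j _ do rewrite mulrDr); rewrite -[leRHS]/_.
  under eq_bigr do rewrite big_split/= -mulr_suml.
  by rewrite big_split/= sum_profile_exchange; lra.
have h2 : \sum_i rho i * b i <= 2 * tail_rows + n%:R * (K * (k * (1 + K) / 2)).
  rewrite (bigID S)/= addrC; apply: lerD.
    rewrite mulr_sumr; apply: ler_sum => i _; rewrite mulrC ler_wpM2r//.
  apply: (@le_trans _ _ (\sum_(i < n) (K * (k * (1 + K) / 2)))); last first.
    by rewrite sumr_const card_ord mulr_natl.
  rewrite [leRHS](bigID S)/=; apply: ler_wpDr.
    apply: sumr_ge0 => i _; have K0 : 0 <= K by exact: le_trans ler01 K1.
    by rewrite mulr_ge0// divr_ge0// mulr_ge0// addr_ge0.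
  by apply: ler_sum => i Si; apply: ler_pM => //; exact: bK.
lra.
Qed.

Lemma sum_a_eq : `|\sum_i a i - k ^+ 2 * (\sum_i rho i - decorrelation)| <= \sum_i E i.
Proof.
have -> : \sum_i a i - k ^+ 2 * (\sum_i rho i - decorrelation) =
    \sum_i (a i - k ^+ 2 * \sum_j s i j * (1 - dd i j)).
  rewrite sumrB -mulr_sumr /decorrelation -sumrB; congr (_ - _ * _).
  apply: eq_bigr => i _; rewrite -sumrB; apply: eq_bigr => j _.
  by rewrite mulrBr mulr1.
by apply: (le_trans (ler_norm_sum _ _ _)); apply: ler_sum.
Qed.

(** [decorrelation] is bounded below on the bulk block through [dd_ge]. There [a i] is nearly
    [k ^+ 2 * rho i], and summing it with weight [bulk_rho i] produces the square twice, once from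
    each index. The terms in [v] are of order [k ^+ 3]. *)
Lemma bulk_square_le :
  2 * k ^+ 2 * bulk_square <= decorrelation * (1 + 2 * k ^+ 2 * K) +
    3 * K * \sum_i E i + n%:R * (k ^+ 2 * K ^+ 2 * (1 + K) * k / 2).
Proof.
have K0 : 0 <= K by exact: le_trans ler01 K1.
have kk : 0 <= k ^+ 2 by exact: sqr_ge0.
have h1 : 2 * \sum_(i | S i) bulk_rho i * a i - \sum_(i | S i) bulk_rho i * v i <= decorrelation.
  apply: (@le_trans _ _ (\sum_(i | S i) \sum_(j | S j) s i j * dd i j)); last first.
    rewrite /decorrelation [leRHS](bigID S)/=; apply: ler_wpDr.
      by apply: sumr_ge0 => i _; apply: sumr_ge0 => j _; exact: mulr_ge0.
    apply: ler_sum => i _; rewrite [leRHS](bigID S)/= lerDl.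
    by apply: sumr_ge0 => j _; exact: mulr_ge0.
  have ex (y : 'I_n -> R) : \sum_(i | S i) \sum_(j | S j) s i j * y j =
      \sum_(i | S i) bulk_rho i * y i.
    rewrite exchange_big/=; apply: eq_bigr => i _; rewrite /bulk_rho mulr_suml.
    by apply: eq_bigr => j _; rewrite sC.
  apply: (@le_trans _ _ (\sum_(i | S i) \sum_(j | S j)
      s i j * (a i + a j - (v i + v j) / 2))); last first.
    by apply: ler_sum => i _; apply: ler_sum => j _; rewrite ler_wpM2l.
  have -> : \sum_(i | S i) \sum_(j | S j) s i j * (a i + a j - (v i + v j) / 2) =
      \sum_(i | S i) (bulk_rho i * a i + (\sum_(j | S j) s i j * a j) -
        (bulk_rho i * v i + \sum_(j | S j) s i j * v j) / 2).
    apply: eq_bigr => i _; rewrite /bulk_rho !mulr_suml -!big_split/= mulr_suml -sumrB.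
    by apply: eq_bigr => j _; ring.
  rewrite sumrB big_split/= -mulr_suml big_split/= !ex; lra.
(* The loop equation bounds [a i] below in terms of [rho i]; [bulk_rho i <= rho i] then gives the
   square, and [bulk_rho i <= K] controls what is subtracted. *)
have h2 : k ^+ 2 * bulk_square - k ^+ 2 * K * decorrelation - K * \sum_i E i <=
    \sum_(i | S i) bulk_rho i * a i.
  apply: (@le_trans _ _ (\sum_(i | S i) (k ^+ 2 * bulk_rho i ^+ 2 -
      k ^+ 2 * K * (\sum_j s i j * dd i j) - K * E i))).
    rewrite !sumrB -!mulr_sumr -/bulk_square -!addrA lerD2l -!opprD lerN2.
    apply: lerD; rewrite ler_wpM2l ?mulr_ge0//.
      rewrite /decorrelation [leRHS](bigID S)/= lerDl; apply: sumr_ge0 => i _.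
      by apply: sumr_ge0 => j _; exact: mulr_ge0.
    by rewrite [leRHS](bigID S)/= lerDl sumr_ge0.
  apply: ler_sum => i Si; have := a_eq i; rewrite ler_norml => /andP[ha _].
  set X := \sum_j s i j * dd i j.
  have eX : \sum_j s i j * (1 - dd i j) = rho i - X.
    by rewrite /X -sumrB; apply: eq_bigr => j _; rewrite mulrBr mulr1.
  rewrite eX in ha.
  have X0 : 0 <= X by apply: sumr_ge0 => j _; exact: mulr_ge0.
  have bK' : bulk_rho i <= K by apply: le_trans (bulk_rho_le i) Si.
  have l1 : bulk_rho i * (k ^+ 2 * (rho i - X) - E i) <= bulk_rho i * a i.
    by rewrite ler_wpM2l//; lra.
  have l2 : bulk_rho i * (k ^+ 2 * X) <= K * (k ^+ 2 * X).
    by rewrite ler_wpM2r// mulr_ge0.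
  have l3 : bulk_rho i * E i <= K * E i by rewrite ler_wpM2r.
  have l4 : k ^+ 2 * (bulk_rho i * bulk_rho i) <= k ^+ 2 * (bulk_rho i * rho i).
    by rewrite ler_wpM2l// ler_wpM2l.
  rewrite (expr2 (bulk_rho i)); move: (k ^+ 2) l1 l2 l3 l4 => c l1 l2 l3 l4; lra.
have h3 : \sum_(i | S i) bulk_rho i * v i <=
    n%:R * (k ^+ 2 * K ^+ 2 * (1 + K) * k / 2) + K * \sum_i E i.
  apply: (@le_trans _ _ (\sum_(i | S i) (k ^+ 2 * K ^+ 2 * (1 + K) * k / 2 + K * E i))).
    apply: ler_sum => i Si.
    have bK' : bulk_rho i <= K by apply: le_trans (bulk_rho_le i) Si.
    have V : v i <= k ^+ 2 * K * (k * (1 + K) / 2) + E i.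
      apply: (le_trans (v_le i)); rewrite lerD2r.
      apply: ler_pM => //; [exact: mulr_ge0|by rewrite ler_wpM2l|exact: bK].
    have V0 : 0 <= k ^+ 2 * K * (k * (1 + K) / 2) + E i.
      rewrite addr_ge0// mulr_ge0//; first exact: mulr_ge0.
      by rewrite divr_ge0// mulr_ge0// addr_ge0.
    apply: (@le_trans _ _ (K * (k ^+ 2 * K * (k * (1 + K) / 2) + E i))).
      by apply: (le_trans (ler_wpM2l (bulk_rho0 i) V)); rewrite ler_wpM2r.
    by rewrite le_eqVlt; apply/orP; left; apply/eqP; field.
  rewrite big_split/=; apply: lerD; last first.
    by rewrite -mulr_sumr ler_wpM2l// [leRHS](bigID S)/= lerDl sumr_ge0.
  apply: (@le_trans _ _ (\sum_(i < n) (k ^+ 2 * K ^+ 2 * (1 + K) * k / 2))); last first.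
    by rewrite sumr_const card_ord mulr_natl.
  rewrite [leRHS](bigID S)/= lerDl; apply: sumr_ge0 => i _.
  rewrite divr_ge0// mulr_ge0// mulr_ge0//; last by rewrite addr_ge0.
  by apply: mulr_ge0 => //; exact: sqr_ge0.
lra.
Qed.

End bulk_rows.
End variance_profile.

(** * Choice of parameters in the converse *)

Section deviation_limit.
Variable R : realType.
Variables (rbar dev : nat -> R) (tail sq : R -> nat -> R) (m D : R -> nat -> R)
  (err : R -> nat -> R) (h : R -> R).
Hypothesis tail_small : forall e, 0 < e -> exists2 K, 1 <= K &
  \forall n \near \oo, tail K n <= e.
Hypothesis err_small : forall e, 0 < e -> exists2 a, 0 < a <= 1 &
  \forall n \near \oo, err a n <= e.
Hypothesis m_cvg : forall k, 0 < k <= 1 / 2 -> m k n @[n --> \oo] --> h k.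
Hypothesis h_eq : forall k, 0 < k -> [/\ 0 <= h k, h k <= 1 & h k = 1 - k ^+ 2 * h k ^+ 2].
Hypothesis D_ge0 : forall k n, 0 < k <= 1 / 2 -> 0 <= D k n.
Hypothesis D_le : forall K k n, 1 <= K -> 0 < k <= 1 / 2 ->
  D k n <= 4 * tail K n + K * (1 + K) * k.
Hypothesis m_eq : forall k a n, 0 < k <= 1 / 2 -> 0 < a <= 1 ->
  `|1 - m k n - k ^+ 2 * (rbar n - D k n)| <= err a n.
Hypothesis sq_le : forall K k a n, 1 <= K -> 0 < k <= 1 / 2 -> 0 < a <= 1 ->
  2 * k ^+ 2 * sq K n <= D k n * (1 + 2 * k ^+ 2 * K) + 3 * K * err a n +
    k ^+ 2 * K ^+ 2 * (1 + K) * k / 2.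
Hypothesis dev_le : forall K u n, 1 <= K -> 0 < u ->
  dev n <= (u + (sq K n - 2 * rbar n + 4 * tail K n + 1) / u) / 2 + 2 * tail K n.
Hypothesis dev_ge0 : forall n, 0 <= dev n.

Let h_sqr k : 0 < k -> 1 - 2 * k ^+ 2 <= h k ^+ 2 <= 1.
Proof.
move=> k0; have [h0 h1 he] := h_eq k0.
have h2 : h k ^+ 2 <= 1 by rewrite exprn_ile1.
rewrite h2 andbT; have : k ^+ 2 * h k ^+ 2 <= k ^+ 2.
  by rewrite -[leRHS]mulr1 ler_wpM2l// sqr_ge0.
have kk : 0 <= k ^+ 2 by exact: sqr_ge0.
have : h k ^+ 2 = 1 - 2 * (k ^+ 2 * h k ^+ 2) + (k ^+ 2 * h k ^+ 2) ^+ 2.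
  by rewrite {1}he; ring.
have := sqr_ge0 (k ^+ 2 * h k ^+ 2); lra.
Qed.

(** The loop equation divided by [k ^+ 2], where [1 - h k = k ^+ 2 * h k ^+ 2]. The division is the
    reason for asking precision [k ^+ 2 * e / 2] of both inputs. *)
Let A_near k e : 0 < k <= 1 / 2 -> 0 < e ->
  \forall n \near \oo, `|rbar n - D k n - h k ^+ 2| <= e.
Proof.
move=> kk e0; have [k0 k1] := andP kk; have [_ _ he] := h_eq k0.
have kk0 : 0 < k ^+ 2 by rewrite exprn_gt0.
have e2 : 0 < k ^+ 2 * e / 2 by rewrite divr_gt0// mulr_gt0.
have [a a01 ha] := err_small e2.
have /cvgrPdist_le/(_ _ e2) hm := m_cvg kk.
near=> n.
have q1 : err a n <= k ^+ 2 * e / 2 by near: n.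
have q2 : `|h k - m k n| <= k ^+ 2 * e / 2 by near: n.
have q3 := le_trans (m_eq n kk a01) q1.
rewrite -(ler_pM2l kk0).
have <- : `|k ^+ 2 * (rbar n - D k n - h k ^+ 2)| =
    k ^+ 2 * `|rbar n - D k n - h k ^+ 2| by rewrite normrM (gtr0_norm kk0).
have -> : k ^+ 2 * (rbar n - D k n - h k ^+ 2) =
   (h k - m k n) - (1 - m k n - k ^+ 2 * (rbar n - D k n)).
  by rewrite [X in X - m k n]he; ring.
apply: (le_trans (ler_normB _ _)); lra.
Unshelve. all: by end_near. Qed.

(** [rbar] does not depend on [k], so [k] may be taken small after [K]: the crude bound makes [D]
    small, and [h k ^+ 2] is within [2 * k ^+ 2] of 1. *)
Let rbar_near e : 0 < e -> \forall n \near \oo, `|rbar n - 1| <= e.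
Proof.
move=> e0; have e16 : 0 < e / 16 by rewrite divr_gt0.
have [K K1 hK] := tail_small e16.
have K0 : 0 < K by lra.
pose C := K * (1 + K) + 2.
have C0 : 2 <= C by rewrite lerDr mulr_ge0// ?ltW//; lra.
pose k := Num.min (1 / 2) (e / (4 * C)).
have C4 : 0 < 4 * C by lra.
have k0 : 0 < k by rewrite lt_min divr_gt0//= divr_gt0.
have k1 : k <= 1 / 2 by rewrite ge_min lexx.
have kC : C * k <= e / 4.
  have : k <= e / (4 * C) by rewrite ge_min lexx orbT.
  by rewrite ler_pdivlMr//; lra.
have kk : 0 < k <= 1 / 2 by rewrite k0.
have /andP[hs1 hs2] := h_sqr k0.
have k2 : 2 * k ^+ 2 <= k by rewrite expr2; nra.
have e4 : 0 < e / 4 by rewrite divr_gt0.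
have hA := A_near kk e4.
near=> n.
have q1 : tail K n <= e / 16 by near: n.
have q2 : `|rbar n - D k n - h k ^+ 2| <= e / 4 by near: n.
have q3 := D_le n K1 kk; have q4 := D_ge0 n kk.
move: q2 kC; rewrite ler_norml /C mulrDl => /andP[q5 q6] kC.
have q7 : 0 <= K * (1 + K) * k by rewrite !mulr_ge0 ?ltW//; lra.
by rewrite ler_norml; apply/andP; split; lra.
Unshelve. all: by end_near. Qed.

(** Once [rbar] tends to 1, the loop equation returns the sharp bound on [D], since
    [h k ^+ 2 >= 1 - 2 * k ^+ 2]. Dividing [sq_le] by [2 * k ^+ 2] bounds the truncated second
    moment by nearly 1, and its excess over the squared mean vanishes. *)
Theorem deviation_cvg0 : dev n @[n --> \oo] --> (0 : R).
Proof.
apply/cvgrPdist_le => e e0.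
(* The numerator in [dev_le] will be at most [8 * dl]. With [u = e] the total is then at most
   [(e + e / 4) / 2 + e / 4], which is below [e]. *)
pose dl := Num.min (e ^+ 2 / 32) (e / 8).
have dl0 : 0 < dl by rewrite lt_min !divr_gt0// exprn_gt0.
have dl1 : dl <= e ^+ 2 / 32 by rewrite ge_min lexx.
have dl2 : dl <= e / 8 by rewrite ge_min lexx orbT.
have [K K1 hK] := tail_small dl0.
have K0 : 0 < K by lra.
(* [C * k] collects the terms of [sq_le], divided by [2 * k ^+ 2], that vanish with [k]. *)
pose C := 2 * K + K ^+ 2 * (1 + K) / 4.
have C0 : 0 < C.
  by rewrite ltr_pwDl ?mulr_gt0// divr_ge0// mulr_ge0 ?sqr_ge0//; lra.
pose k := Num.min (1 / 2) (dl / C).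
have k0 : 0 < k by rewrite lt_min divr_gt0//= divr_gt0.
have k1 : k <= 1 / 2 by rewrite ge_min lexx.
have kC : C * k <= dl.
  have : k <= dl / C by rewrite ge_min lexx orbT.
  by rewrite ler_pdivlMr// mulrC.
have kk : 0 < k <= 1 / 2 by rewrite k0.
have c0 : 0 < k ^+ 2 by rewrite exprn_gt0.
have ck : k ^+ 2 <= k by rewrite expr2; nra.
(* [B] is the total coefficient of [eta] in [sq_le]. Since these errors get divided by [2 * k ^+ 2],
   [eta] can be fixed only after [k]. *)
pose B := 2 * (1 + 2 * k ^+ 2 * K) + 3 * K.
have B0 : 0 < B by rewrite /B; have := mulr_gt0 c0 K0; lra.
pose eta := Num.min dl (2 * k ^+ 2 * dl / B).
have eta0 : 0 < eta by rewrite lt_min dl0/= divr_gt0// !mulr_gt0.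
have eta1 : eta <= dl by rewrite ge_min lexx.
have etaB : B * eta <= 2 * k ^+ 2 * dl.
  have : eta <= 2 * k ^+ 2 * dl / B by rewrite ge_min lexx orbT.
  by rewrite ler_pdivlMr// mulrC.
have /andP[hs1 hs2] := h_sqr k0.
have hA := A_near kk eta0.
have hr := rbar_near eta0.
have [a a01 ha] := err_small eta0.
near=> n.
have q1 : tail K n <= dl by near: n.
have q2 : `|rbar n - D k n - h k ^+ 2| <= eta by near: n.
have q3 : `|rbar n - 1| <= eta by near: n.
have q4 : err a n <= eta by near: n.
have q5 := sq_le n K1 kk a01.
rewrite sub0r normrN ger0_norm//; apply: (le_trans (dev_le n K1 e0)).
move: q2 q3; rewrite !ler_norml => /andP[q6 q7] /andP[q8 q9].
have D1 : D k n <= 2 * k ^+ 2 + 2 * eta by lra.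
have sq1 : sq K n <= 1 + 2 * dl.
  rewrite -(ler_pM2l (_ : 0 < 2 * k ^+ 2)) ?mulr_gt0//; apply: (le_trans q5).
  have cK : 0 <= 1 + 2 * k ^+ 2 * K by have := mulr_gt0 c0 K0; lra.
  have r1 := ler_wpM2r cK D1.
  have r2 : 3 * K * err a n <= 3 * K * eta by rewrite ler_wpM2l// mulr_ge0// ltW.
  have r3 : 2 * k ^+ 2 * (C * k) <= 2 * k ^+ 2 * dl.
    by rewrite ler_wpM2l// mulr_ge0// ltW.
  have r4 : (2 * k ^+ 2) * (2 * k ^+ 2 * K) <= (2 * k ^+ 2) * (2 * K * k).
    apply: ler_wpM2l; first by rewrite mulr_ge0// ltW.
    have -> : 2 * K * k = 2 * k * K by ring.
    by rewrite (ler_wpM2r (ltW K0))// ler_wpM2l.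
  move: r1 r2 r3 r4 etaB; rewrite /C /B.
  move: (k ^+ 2) => c r1 r2 r3 r4 etaB.
  have -> : c * K ^+ 2 * (1 + K) * k / 2 = 2 * c * (K ^+ 2 * (1 + K) / 4 * k) by field.
  have e1 : 2 * c * ((2 * K + K ^+ 2 * (1 + K) / 4) * k) =
    2 * c * (2 * K * k) + 2 * c * (K ^+ 2 * (1 + K) / 4 * k) by ring.
  rewrite e1 in r3; move: (K ^+ 2 * (1 + K) / 4 * k) r3 => Z r3; nra.
have N8 : sq K n - 2 * rbar n + 4 * tail K n + 1 <= 8 * dl by lra.
have f1 : (sq K n - 2 * rbar n + 4 * tail K n + 1) / e <= e / 4.
  rewrite ler_pdivrMr//; apply: (le_trans N8); move: dl1; rewrite expr2; lra.
lra.
Unshelve. all: by end_near. Qed.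

End deviation_limit.

(** * Uniform integrability of the row sums *)

Section uniform_integrability_of_rows.
Variable R : realType.
Variable rho : forall n : nat, 'I_n.+1 -> R.
Hypothesis rho0 : forall n i, 0 <= @rho n i.
Hypothesis small : forall J : forall n : nat, {set 'I_n.+1},
  #|J n|%:R / n.+1%:R @[n --> \oo] --> (0 : R) ->
  n.+1%:R^-1 * \sum_(i in J n) rho i @[n --> \oo] --> (0 : R).

Let heavy (e : R) (m n : nat) (J : {set 'I_n.+1}) : Prop :=
  (#|J| * m.+1 <= n.+1)%N /\ e < n.+1%:R^-1 * \sum_(i in J) rho i.

(* Otherwise heavy sets of vanishing density exist for arbitrarily large sizes;
   a strictly increasing sequence of such sizes contradicts the hypothesis. *)
Let equi_small (e : R) : 0 < e -> exists m N : nat, forall n, (N <= n)%N ->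
  forall J : {set 'I_n.+1}, (#|J| * m.+1 <= n.+1)%N ->
  n.+1%:R^-1 * \sum_(i in J) rho i <= e.
Proof.
move=> e0; apply: contrapT => noN.
have step (p : nat * nat) : exists n, (p.2 <= n)%N /\ exists J, @heavy e p.1 n J.
  apply: contrapT => h; apply: noN; exists p.1, p.2 => n pn J cJ.
  rewrite leNgt; apply/negP => eJ; apply: h; exists n; split => //.
  by exists J.
have [nu nuP] := choice step.
(* Stage [m] supplies a heavy set of density at most [1 / (m + 1)], at a size larger than all the
   previous ones. *)
pose fix N m := if m is m'.+1 then nu (m, (N m').+1) else nu (0%N, 0%N).
have Nheavy m : exists J, @heavy e m (N m) J.
  by case: m => [|m] /=; [have [_] := nuP (0%N, 0%N)|have [_] := nuP (m.+1, (N m).+1)].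
have Nlt m : (N m < N m.+1)%N by have [] := nuP (m.+1, (N m).+1).
have Nmono m m' : (m < m')%N -> (N m < N m')%N.
  elim: m' => // m' ih; rewrite ltnS leq_eqVlt => /orP[/eqP->|mm']; first exact: Nlt.
  exact: ltn_trans (ih mm') (Nlt _).
have Nge m : (m <= N m)%N.
  by elim: m => // m ih; exact: leq_ltn_trans ih (Nlt m).
have ninc m m' : (N m <= N m')%N -> (m <= m')%N.
  by move=> h; rewrite leqNgt; apply/negP => /Nmono; rewrite ltnNge h.
(* Sizes outside the sequence receive the empty set, so that the family is defined for every [n] and
   its density still tends to 0. *)
have JP n : exists J : {set 'I_n.+1},
    (forall m, N m = n -> @heavy e m n J) /\ (~ (exists m, N m = n) -> J = finset.set0).
  have [[m mn]|nex] := pselect (exists m, N m = n).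
    have [J hJ] := Nheavy m; move: J hJ; rewrite mn => J hJ; exists J; split.
      move=> m' m'n; have -> // : m' = m.
      by apply/eqP; rewrite eqn_leq; apply/andP; split; apply: ninc; rewrite mn m'n.
    by move=> h; exfalso; apply: h; exists m.
  by exists finset.set0; split => // m mn; exfalso; apply: nex; exists m.
pose J n := projT1 (cid (JP n)).
have JE n : (forall m, N m = n -> @heavy e m n (J n)) /\
    (~ (exists m, N m = n) -> J n = finset.set0) := projT2 (cid (JP n)).
have cJ : #|J n|%:R / n.+1%:R @[n --> \oo] --> (0 : R).
  apply/cvgrPdist_le => d d0; pose M := Num.truncn d^-1.
  have Md : M.+1%:R^-1 <= d by rewrite invf_ple ?posrE// ltW// truncnS_gt.
  near=> n; rewrite sub0r normrN ger0_norm ?divr_ge0//.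
  have [[m mn]|nex] := pselect (exists m, N m = n); last first.
    by have [_ ->//] := JE n; rewrite cards0 mul0r ltW.
  have [/(_ m mn)[h _] _] := JE n.
  have Mm : (M <= m)%N by apply: ninc; rewrite mn; near: n; exists (N M).
  apply: le_trans Md; rewrite ler_pdivrMr// ler_pdivlMl// -natrM ler_nat.
  by apply: leq_trans h; rewrite mulnC leq_mul2l ltnS Mm orbT.
have /cvgrPdist_lt/(_ e e0)[N0 _ hN0] := small cJ.
have := hN0 (N N0) (Nge N0) => /=.
have [/(_ N0 erefl)[_ h] _] := JE (N N0).
rewrite sub0r normrN ger0_norm; last by rewrite mulr_ge0// sumr_ge0.
by rewrite ltNge (ltW h).
Unshelve. all: by end_near. Qed.

Let subset_of_card (T : finType) (A : {set T}) (p : nat) : (p <= #|A|)%N ->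
  exists2 B : {set T}, B \subset A & #|B| = p.
Proof.
move=> pA; exists [set x in take p (enum A)]%SET.
  by apply/fintype.subsetP => x; rewrite inE => /mem_take; rewrite mem_enum.
rewrite cardsE (card_uniqP _) ?take_uniq ?enum_uniq//.
by rewrite size_take -cardE; case: ltngtP pA.
Qed.

(** If the rows above [K] were too many to be a small set, a subset of them with the largest
    admissible cardinality would be small and yet have sum greater than [e * n.+1]. *)
Lemma rows_tail_small (e : R) : 0 < e -> exists2 K, 1 <= K &
  \forall n \near \oo, n.+1%:R^-1 * \sum_(i < n.+1 | ~~ (rho i <= K)) rho i <= e.
Proof.
move=> e0; have [m [N0 hN]] := equi_small e0.
(* With [p] the quotient of [n.+1] by [m.+1], rounding loses at most half: [n.+1 <= 2 * p * m.+1].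
   So [p] rows above [2 * e * m.+1] already reach [e * n.+1]; the added 1 makes this strict and
   gives [1 <= K]. *)
pose K : R := 1 + 2 * e * m.+1%:R.
have K0 : 0 <= 2 * e * m.+1%:R by rewrite !mulr_ge0// ltW.
exists K; first by rewrite lerDl.
near=> n.
have nN : (N0 <= n)%N by near: n; exists N0.
have nm : (m <= n)%N by near: n; exists m.
pose A : {set 'I_n.+1} := [set i | ~~ (rho i <= K)]%SET.
have -> : \sum_(i < n.+1 | ~~ (rho i <= K)) rho i = \sum_(i in A) rho i.
  by apply: eq_bigl => i; rewrite inE.
apply: (hN n nN); rewrite leqNgt; apply/negP => big.
pose p := (n.+1 %/ m.+1)%N.
have p0 : (0 < p)%N by rewrite divn_gt0.
have pm : (p * m.+1 <= n.+1)%N by rewrite leq_divM.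
have pA : (p <= #|A|)%N.
  by rewrite -ltnS -(ltn_pmul2r (ltn0Sn m)) (leq_ltn_trans pm)// (ltn_trans big)// ltn_pmul2r.
have [B BA cB] := subset_of_card pA.
have := hN n nN B; rewrite cB => /(_ pm); apply/negP; rewrite -ltNge.
have h1 : p%:R * K <= \sum_(i in B) rho i.
  rewrite -cB mulr_natl -sumr_const; apply: ler_sum => i iB.
  by have := fintype.subsetP BA i iB; rewrite inE -ltNge => /ltW.
rewrite ltr_pdivlMl//; apply: lt_le_trans h1.
have h2 : n.+1%:R <= 2 * (p%:R * m.+1%:R) :> R.
  have : (n.+1 <= 2 * (p * m.+1))%N.
    have := ltn_ceil n.+1 (ltn0Sn m); rewrite -/p => h; apply: (leq_trans (ltnW h)).
    by rewrite mulnA leq_mul2r mul2n -addnn -[X in (X <= _)%N]addn1 leq_add2l p0 orbT.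
  by rewrite -(ler_nat R) !natrM.
have h3 := ler_wpM2r (ltW e0) h2.
have p0' : 0 < p%:R :> R by rewrite ltr0n.
rewrite /K; lra.
Unshelve. all: by end_near. Qed.

End uniform_integrability_of_rows.

Lemma cvgn_EFinP (R : realType) (u : nat -> R) (l : R) :
  ((u n)%:E @[n --> \oo] --> l%:E)%E <-> (u n @[n --> \oo] --> l).
Proof.
split; first by move=> /fine_cvgP[].
by move=> ul; apply: cvg_EFin => //; exact: nearW.
Qed.

(** * Weak convergence to the semicircle law from resolvent test functions *)

Section weak_convergence.
Variable R : realType.
Local Notation TR := (measurableTypeR R).
Implicit Type nu : nat -> probability TR R.

Let L1_ctsb (P : probability TR R) (f : R -> R) (M : R) : continuous f ->
  (forall x, `|f x| <= M) -> L1 P f.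
Proof. by move=> cf fM; apply: (@L1_bounded _ _ _ _ M) => //; exact: continuous_measurable_fun. Qed.

Lemma weak_cvg_Ex nu (mu : probability TR R) (f : R -> R) (M : R) :
  weak_cvg nu mu -> continuous f -> (forall x, `|f x| <= M) ->
  Ex (nu n) f @[n --> \oo] --> Ex mu f.
Proof.
move=> h cf fM; have := h f cf (ex_intro _ M fM).
have e (P : probability TR R) : (\int[P]_x (f x)%:E)%E = (Ex P f)%:E.
  by rewrite /Ex /Rintegral fineK//; apply: integrable_fin_num => //; exact: L1_ctsb fM.
by under eq_fun do rewrite e; rewrite e => /cvgn_EFinP.
Qed.

Let norm_qk (k x : R) : `|qk k x| <= 1.
Proof. by rewrite ger0_norm ?qk_ge0 ?qk_le1. Qed.

(* [1 - qk k] exceeds 1/2 outside [-1/k, 1/k]: this gives tightness. *)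
Let truncation (k x c : R) : 0 < k -> 0 <= c ->
  k^-1 < `|x| -> c <= 2 * c * (1 - qk k x).
Proof.
move=> k0 c0 kx; have h : qk k x <= 1 / 2.
  rewrite /qk mul1r lef_pV2 ?posrE ?qk_den_gt0//.
  rewrite -[2]/(1 + 1) lerD2l -exprMn -real_normK ?num_real// normrM (gtr0_norm k0).
  by rewrite exprn_ege1// -ler_pdivrMl// mulr1 ltW.
nra.
Qed.

(** The density theorem is applied to the bounded measurable functions whose integrals converge. Its
    limit step approximates on compacts only, so it needs tightness; this follows from the
    convergence for [qk k] with [k] small, and no moment of [nu n] is used. *)
Lemma semicircle_weak_cvg nu :
  (forall k, 0 < k <= 1 / 2 ->
     Ex (nu n) (qk k) @[n --> \oo] --> Ex (@semicircle R) (qk k)) ->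
  (forall k, 0 < k <= 1 / 2 -> Ex (nu n) (fun x => x * qk k x) @[n --> \oo] --> (0 : R)) ->
  weak_cvg nu (@semicircle R).
Proof.
move=> hq hx f cf [M fM]; set sc := (@semicircle R : probability TR R).
pose C (g : R -> R) := [/\ measurable_fun [set: TR] g, exists M, forall x, `|g x| <= M &
  Ex (nu n) g @[n --> \oo] --> Ex sc g].
have LC (P : probability TR R) g : C g -> L1 P g.
  by move=> [mg [K gK] _]; exact: (@L1_bounded _ _ _ _ K).
suff Cf : C f.
  have [_ _] := Cf.
  have e (P : probability TR R) : (\int[P]_x (f x)%:E)%E = (Ex P f)%:E.
    by rewrite /Ex /Rintegral fineK//; apply: integrable_fin_num => //; exact: LC.
  by move=> h; under eq_fun do rewrite e; rewrite e; apply/cvgn_EFinP.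
apply: (density_of_qk (C := C) _ _ _ _ _ cf fM).
- move=> a g1 g2 C1 C2; split.
  + have [m1 _ _] := C1; have [m2 _ _] := C2.
    by apply: measurable_funD => //; exact: measurable_funM.
  + have [_ [M1 h1] _] := C1; have [_ [M2 h2] _] := C2.
    exists (`|a| * M1 + M2) => x; apply: (le_trans (ler_normD _ _)).
    by rewrite lerD// normrM ler_wpM2l.
  + have e (P : probability TR R) :
        Ex P (fun x => a * g1 x + g2 x) = a * Ex P g1 + Ex P g2.
      rewrite ExD; [|apply: L1Z|]; try exact: LC.
      by rewrite ExZ//; exact: LC.
    under eq_fun do rewrite e; rewrite e.
    have [_ _ l1] := C1; have [_ _ l2] := C2.
    by apply: cvgD => //; apply: cvgM => //; exact: cvg_cst.
- split; [exact: measurable_cst|by exists 1 => x; rewrite normr1|].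
  by under eq_fun do rewrite Ex_cst; rewrite Ex_cst; exact: cvg_cst.
- move=> k kk; split; last exact: hq.
    by apply: continuous_measurable_fun; exact: continuous_qk.
  by exists 1.
- move=> k kk; have [k0 _] := andP kk; split.
  + by apply: continuous_measurable_fun; exact: continuous_xqk.
  + by exists (2 * k)^-1 => x; exact: xqk_le.
  + by rewrite Ex_semicircle_xqk//; exact: hx.
move=> g K gK approx.
have K0 : 0 <= K by exact: le_trans (gK 0).
have mg : measurable_fun [set: TR] g.
  have approx' (m : nat) : exists h, C h /\
      forall x, `|x| <= m%:R -> `|h x - g x| <= m.+1%:R^-1.
    have e0 : (0 : R) < m.+1%:R^-1 by rewrite invr_gt0.
    by have [h [h1 _ h3]] := approx m%:R _ e0; exists h.
  have [h hP] := choice approx'.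
  apply: (@measurable_fun_cvg _ _ _ _ h) => [m|x _]; first by have [[]] := hP m.
  apply/cvgrPdist_le => e e0; near=> m.
  have [_ hm] := hP m; rewrite distrC; apply: (le_trans (hm x _)).
    by near: m; exact: nbhs_infty_ger.
  rewrite invf_ple ?posrE//; apply: (@le_trans _ _ m%:R); last by rewrite ler_nat.
  by near: m; exact: nbhs_infty_ger.
have Lg (P : probability TR R) : L1 P g by exact: (@L1_bounded _ _ _ _ K).
split => //; first by exists K.
apply/cvgrPdist_le => e e0.
(* Bounds [|g - q|] outside the compact set, as [|g| <= K] and [|q| <= K + 1]. *)
pose c := 2 * K + 1.
have c0 : 0 < c by rewrite /c; lra.
(* For the semicircle law [1 - Ex sc (qk k)] is [k ^+ 2 * h ^+ 2], at most [k], so its mass outside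
   [[-1/k, 1/k]] contributes at most [e / 12]. *)
pose k := Num.min (1 / 2) (e / (24 * c)).
have k0 : 0 < k by rewrite lt_min divr_gt0//= divr_gt0// mulr_gt0.
have k1 : k <= 1 / 2 by rewrite ge_min lexx.
have kk : 0 < k <= 1 / 2 by rewrite k0.
have kc : 2 * c * k <= e / 12.
  have : k <= e / (24 * c) by rewrite ge_min lexx orbT.
  by rewrite ler_pdivlMr ?mulr_gt0//; lra.
have e6 : 0 < e / 6 by rewrite divr_gt0.
have [q [Cq qK qg]] := approx k^-1 (e / 6) e6.
have close (P : probability TR R) :
    `|Ex P g - Ex P q| <= e / 6 + 2 * c * (1 - Ex P (qk k)).
  have Lk : L1 P (qk k) by exact: (L1_ctsb _ (@continuous_qk R k) (norm_qk k)).
  have L1k : L1 P (fun x => 1 - qk k x) by apply: L1B => //; exact: L1_cst.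
  have <- : Ex P (fun x => e / 6 + 2 * c * (1 - qk k x)) =
      e / 6 + 2 * c * (1 - Ex P (qk k)).
    rewrite (ExD (L1_cst P _) (L1Z _ L1k)) Ex_cst (ExZ _ L1k).
    by rewrite (ExB (L1_cst P _) Lk) Ex_cst.
  have Lq := LC P q Cq; rewrite -(ExB (Lg P) Lq).
  apply: Ex_norm_le => [||x]; first exact: L1B (Lg P) Lq.
    exact: L1D (L1_cst P _) (L1Z _ L1k).
  have [xk|kx] := lerP `|x| k^-1.
    rewrite distrC; apply: (le_trans (qg x xk)); rewrite lerDl mulr_ge0//.
      by rewrite mulr_ge0// ltW.
    by rewrite subr_ge0 qk_le1.
  apply: (@le_trans _ _ c).
    apply: (le_trans (ler_normB _ _)); have := gK x; have := qK x; rewrite /c; lra.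
  by have := truncation k0 (ltW c0) kx; lra.
have [h0 h1 hE] := semicircle_fixed_point k0; rewrite -/sc in h0 h1 hE.
have hk : 1 - Ex sc (qk k) <= k.
  rewrite [X in 1 - X]hE opprB addrC subrK.
  have h2 : Ex sc (qk k) ^+ 2 <= 1 by rewrite exprn_ile1.
  have kk2 : k ^+ 2 <= k by rewrite expr2; nra.
  by rewrite -[leRHS]mulr1 ler_pM ?sqr_ge0.
have d12 : 0 < e / (24 * c) by rewrite divr_gt0// mulr_gt0.
have /cvgrPdist_le/(_ _ d12) near_q := hq k kk.
have [_ _ /cvgrPdist_le/(_ _ e6) near_g] := Cq.
near=> n.
have r1 : `|Ex sc (qk k) - Ex (nu n) (qk k)| <= e / (24 * c) by near: n.
have r2 : `|Ex sc q - Ex (nu n) q| <= e / 6 by near: n.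
have r3 := close sc; have r4 := close (nu n).
have r5 : 2 * c * (1 - Ex sc (qk k)) <= e / 12.
  by apply: le_trans kc; rewrite ler_wpM2l// mulr_ge0// ltW.
have r6 : 2 * c * (1 - Ex (nu n) (qk k)) <= e / 6.
  have -> : e / 6 = e / 12 + 2 * c * (e / (24 * c)) by field; exact: lt0r_neq0.
  apply: (@le_trans _ _ (2 * c * (1 - Ex sc (qk k)) + 2 * c * (e / (24 * c)))); last first.
    by rewrite lerD2r.
  rewrite -mulrDr ler_wpM2l//; first by rewrite mulr_ge0// ltW.
  by move: r1; rewrite ler_norml => /andP[]; lra.
have -> : Ex sc g - Ex (nu n) g =
  (Ex sc g - Ex sc q) + (Ex sc q - Ex (nu n) q) - (Ex (nu n) g - Ex (nu n) q) by ring.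
apply: (le_trans (ler_normB _ _)).
have := ler_normD (Ex sc g - Ex sc q) (Ex sc q - Ex (nu n) q); lra.
Unshelve. all: by end_near. Qed.

End weak_convergence.

(** * Averaged inequalities for one matrix *)

Section single_matrix.
Context d (T : measurableType d) (R : realType) (P : probability T R) (n : nat).
Variable W : T -> 'M[R[i]]_n.+1.
Hypothesis hW : hermitian_wigner P W.
Local Notation mvar := (mvar P W).
Local Notation mtrunc := (mtrunc P W).
Local Notation rowvar := (rowvar P W).
Local Notation H k t := (resolvent (k%:C%C *: W t)).
Local Notation N := (n.+1%:R : R).
Local Notation avg F := (N^-1 * \sum_(i < n.+1) F i).
Local Notation nu := (expected_measure P (fun t => esd (W t))).

Let N0 : 0 < N.
Proof. by rewrite ltr0n. Qed.

Let hermW t : W t \is hermsymmx.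
Proof. by case: hW. Qed.

Let cW i j : cmeasurable (fun t => W t i j).
Proof. exact: wigner_cmeasurable hW i j. Qed.

Let cH k i : cmeasurable (fun t => H k t i i).
Proof. exact: (wigner_resolvent_cmeasurable k hW). Qed.

Let H1 k t i j : nm (H k t i j) <= 1.
Proof. by apply: nm_resolvent_le1; exact: hermsymmx_scale. Qed.

Lemma L1_of_second_moment i j : (second_moment P (fun t => W t i j) < +oo)%E ->
  L1 P (fun t => nm (W t i j) ^+ 2).
Proof.
rewrite /second_moment unlock => h; apply/integrableP; split.
  by apply/measurable_EFinP; apply: measurable_funX; exact: measurable_nm.
by under eq_integral => t _ do rewrite /= ger0_norm ?sqr_ge0//.
Qed.

Lemma mvar_sym i j : mvar i j = mvar j i.
Proof.
by apply: Ex_ext => t; rewrite (hermsymmx_sym (hermW t)) nm_conj.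
Qed.

Lemma mvar_ge0 i j : 0 <= mvar i j.
Proof. exact: secm_ge0. Qed.

Lemma rowvar_ge0 i : 0 <= rowvar i.
Proof. by apply: sumr_ge0 => j _; exact: mvar_ge0. Qed.

Lemma avg_row_error e :
  avg (row_error P W e) = 500 * (e * (1 + avg rowvar) +
    (N^-1 * \sum_i \sum_j mtrunc e i j) / e).
Proof.
rewrite /row_error -mulr_sumr big_split/= -mulr_sumr big_split/= -mulr_suml.
rewrite sumr_const card_ord -[1 *+ _]/(n.+1%:R); move: (e^-1) => e'.
by field; exact: lt0r_neq0.
Qed.

Section resolvent_averages.
Variable k : R.

Let L1_Re i : L1 P (fun t => complex.Re (H k t i i)).
Proof. exact: (@L1_Re_bounded _ _ _ P 1). Qed.

Let L1_Im i : L1 P (fun t => complex.Im (H k t i i)).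
Proof.
apply: (@L1_bounded _ _ _ _ 1) => [|t]; first by case: (cH k i).
exact: le_trans (nm_Im _) (H1 k t i i).
Qed.

Lemma Ex_expected_esd_qk :
  Ex nu (qk k) = avg (fun i => Ex P (fun t => complex.Re (H k t i i))).
Proof.
have b x : `|qk k x| <= 1 by rewrite ger0_norm ?qk_ge0 ?qk_le1.
rewrite (Ex_expected_esd hW (@continuous_qk _ k) b) -Ex_sum// -ExZ; last exact: L1_sum.
by apply: Ex_ext => t; rewrite specsum_qk.
Qed.

Lemma one_sub_Ex_expected_esd_qk : 1 - Ex nu (qk k) = avg (aE P W k).
Proof.
rewrite Ex_expected_esd_qk /aE.
have e i : Ex P (fun t => complex.Re (1 - H k t i i)) =
    1 - Ex P (fun t => complex.Re (H k t i i)).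
  rewrite -[X in X - _](Ex_cst P) -ExB//; last exact: L1_cst.
  by apply: Ex_ext => t; rewrite cReB.
under [in RHS]eq_bigr do rewrite e.
rewrite sumrB sumr_const card_ord -[1 *+ _]/(n.+1%:R) mulrBr mulVf//.
Qed.

Lemma Ex_expected_esd_xqk : 0 < k -> k * Ex nu (fun x => x * qk k x) =
  - avg (fun i => Ex P (fun t => complex.Im (H k t i i))).
Proof.
move=> k0.
have kn : k != 0 by rewrite gt_eqF.
rewrite (Ex_expected_esd hW (@continuous_xqk _ k) (fun x => xqk_le x k0)).
pose S t := N^-1 * \sum_i complex.Im (H k t i i).
have LI : L1 P (fun t => \sum_i complex.Im (H k t i i)) by exact: L1_sum.
have -> : avg (fun i => Ex P (fun t => complex.Im (H k t i i))) = Ex P S.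
  by rewrite (ExZ _ LI) Ex_sum.
have -> : Ex P (fun t => specsum (fun x => x * qk k x) (W t)) =
    Ex P (fun t => - k^-1 * S t).
  apply: Ex_ext => t; rewrite mulNr -mulrN -(specsum_xqk k (hermW t)).
  by rewrite mulKf.
by rewrite (ExZ _ (L1Z _ LI)) mulNr mulrN mulVKf.
Qed.

Section deviation.
Variables (h u : R).
Hypothesis u0 : 0 < u.
Local Notation y := (devE P W k h).

Let cHh i : cmeasurable (fun t => H k t i i - h%:C%C).
Proof. by apply: cmeasurableB => //; exact: cmeasurable_cst. Qed.

Let L1y i : L1 P (fun t => nm (H k t i i - h%:C%C) ^+ 2).
Proof.
apply: (@L1_bounded _ _ _ _ ((1 + `|h|) ^+ 2)) => [|t].
  by apply: measurable_funX; exact: measurable_nm.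
rewrite ger0_norm ?sqr_ge0// ler_sqr ?nnegrE ?nm_ge0 ?addr_ge0//.
by apply: (le_trans (nmB _ _)); rewrite nmRC lerD2r.
Qed.

Let amgm (v : R) : v <= (u + v ^+ 2 / u) / 2.
Proof.
have : 0 <= (u - v) ^+ 2 / u by rewrite divr_ge0 ?sqr_ge0// ltW.
have -> : (u - v) ^+ 2 / u = u - 2 * v + v ^+ 2 / u.
  by field; rewrite gt_eqF.
lra.
Qed.

(** First moments are compared with second ones through [v <= (u + v^2 / u) / 2]. The parameter [u]
    will be the target precision, with the averaged second moment below its square. *)
Let deviation (f : 'I_n.+1 -> T -> R) (c : R) :
  (forall i, L1 P (f i)) ->
  (forall i t, `|f i t - c| <= nm (H k t i i - h%:C%C)) ->
  `|avg (fun i => Ex P (f i)) - c| <= (u + avg y / u) / 2.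
Proof.
move=> Lf fc.
have e i : `|Ex P (f i) - c| <= (u + y i / u) / 2.
  have -> : (u + y i / u) / 2 =
      Ex P (fun t => 2^-1 * (u + u^-1 * nm (H k t i i - h%:C%C) ^+ 2)).
    rewrite ExZ; last by apply: L1D; [exact: L1_cst|exact: L1Z].
    rewrite (ExD (L1_cst P u) (L1Z _ (L1y i))) Ex_cst ExZ// mulrC.
    by rewrite [u^-1 * _]mulrC.
  rewrite -[X in _ - X](Ex_cst P) -ExB//; last exact: L1_cst.
  apply: Ex_norm_le => [||t]; first by apply: L1B => //; exact: L1_cst.
    by apply: L1Z; apply: L1D; [exact: L1_cst|exact: L1Z].
  apply: (le_trans (fc i t)); apply: (le_trans (amgm _)).
  by rewrite mulrC [_ / u]mulrC.
have -> : avg (fun i => Ex P (f i)) - c = avg (fun i => Ex P (f i) - c).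
  rewrite sumrB sumr_const card_ord -[c *+ _]mulr_natl.
  by field; exact: lt0r_neq0.
have -> : (u + avg y / u) / 2 = avg (fun i => (u + y i / u) / 2).
  rewrite -mulr_suml big_split/= -mulr_suml sumr_const card_ord -[u *+ _]mulr_natl.
  by field; rewrite !lt0r_neq0.
rewrite normrM gtr0_norm ?invr_gt0// ler_pM2l ?invr_gt0//.
by apply: (le_trans (ler_norm_sum _ _ _)); apply: ler_sum.
Qed.

Lemma Ex_expected_esd_qk_deviation : `|Ex nu (qk k) - h| <= (u + avg y / u) / 2.
Proof.
rewrite Ex_expected_esd_qk; apply: deviation => // i t.
by apply: le_trans (nm_Re _); rewrite cReB.
Qed.

Lemma Ex_expected_esd_xqk_deviation : 0 < k ->
  `|k * Ex nu (fun x => x * qk k x)| <= (u + avg y / u) / 2.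
Proof.
move=> k0; rewrite Ex_expected_esd_xqk// normrN -[X in `|X|]subr0.
apply: deviation => // i t.
have e (z : R[i]) : complex.Im (z - h%:C%C) = complex.Im z by case: z => x z /=; rewrite subr0.
by apply: le_trans (nm_Im _); rewrite subr0 e.
Qed.

End deviation.
End resolvent_averages.

Section averaged_inequalities.
Hypothesis W0 : forall i j, ccentered P (fun t => W t i j).
Hypothesis W2 : forall i j, L1 P (fun t => nm (W t i j) ^+ 2).
Variables (k a K : R).
Hypothesis k01 : 0 <= k <= 1.
Hypothesis a01 : 0 < a <= 1.
Hypothesis K1 : 1 <= K.
Local Notation aD := (N^-1 * decorrelation mvar (dE P W k)).
Local Notation aerr := (avg (row_error P W a)).
Local Notation atail := (N^-1 * tail_rows mvar K).
Local Notation asq := (N^-1 * bulk_square mvar K).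

Let k0 : 0 <= k.
Proof. by case/andP: k01. Qed.

Let hb i : bE P W k i <= k * (1 + \sum_j mvar i j) / 2.
Proof. exact: (bE_le hW W2 k01). Qed.

Let hd i j : dE P W k i j <= bE P W k i + bE P W k j.
Proof. exact: (dE_le k hW). Qed.

Let ha i : `|aE P W k i - k ^+ 2 * \sum_j mvar i j * (1 - dE P W k i j)| <= row_error P W a i.
Proof. exact: (aE_eq hW W0 W2 k01). Qed.

Let inv_le (X Y y : R) : X <= Y -> Y = N * y -> N^-1 * X <= y.
Proof. by move=> XY e; rewrite ler_pdivrMl// -e. Qed.

Lemma avg_decorrelation_ge0 : 0 <= aD.
Proof.
rewrite mulr_ge0 ?invr_ge0 ?(ltW N0)//.
by apply: decorrelation_ge0 => i j; [exact: mvar_ge0|exact: (dE_ge0 k hW)].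
Qed.

Lemma avg_decorrelation_le : aD <= 4 * atail + K * (1 + K) * k.
Proof.
apply: (inv_le (decorrelation_le mvar_ge0 mvar_sym K1 k0 hd hb _ _)).
- by move=> i; exact: (bE_le2 k hW).
- by move=> i; exact: bE_ge0.
- by field; exact: lt0r_neq0.
Qed.

Lemma avg_loop_equation :
  `|1 - Ex nu (qk k) - k ^+ 2 * (avg rowvar - aD)| <= aerr.
Proof.
rewrite one_sub_Ex_expected_esd_qk; have := sum_a_eq ha.
rewrite -(ler_pM2l (_ : 0 < N^-1)) ?invr_gt0//; apply: le_trans.
rewrite -[X in X * `|_|]gtr0_norm ?invr_gt0// -normrM le_eqVlt.
by apply/orP; left; apply/eqP; congr `|_|; rewrite /rowvar; ring.
Qed.

Lemma avg_bulk_square_le : 2 * k ^+ 2 * asq <= aD * (1 + 2 * k ^+ 2 * K) +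
  3 * K * aerr + k ^+ 2 * K ^+ 2 * (1 + K) * k / 2.
Proof.
rewrite mulrCA; apply: (inv_le (bulk_square_le mvar_ge0 mvar_sym K1 k0 ha _ _ _ hb _)).
- by move=> i j; exact: (dE_ge k hW).
- by move=> i j; exact: (dE_ge0 k hW).
- by move=> i; exact: (vE_le hW W0 W2 k01).
- by move=> i; exact: bE_ge0.
- by field; exact: lt0r_neq0.
Qed.

Lemma avg_rho_deviation_le (u : R) : 0 < u -> avg (fun i => `|rowvar i - 1|) <=
  (u + (asq - 2 * avg rowvar + 4 * atail + 1) / u) / 2 + 2 * atail.
Proof.
move=> u0; apply: (inv_le (rho_deviation_le mvar_ge0 mvar_sym K1 u0)).
by rewrite /rowvar; field; rewrite !lt0r_neq0.
Qed.

Lemma avg_contraction (h : R) : 0 <= h <= 1 -> h = 1 - k ^+ 2 * h ^+ 2 ->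
  (1 - k ^+ 2) * avg (devE P W k h) <= aerr + 6 * k ^+ 2 * avg (fun i => `|rowvar i - 1|).
Proof.
move=> h01 hE; have c0 : 0 <= k ^+ 2 by exact: sqr_ge0.
rewrite mulrCA; apply: (inv_le (profile_contraction mvar_sym c0 _ _)).
- move=> i; rewrite Ex_ge0/=; last by move=> t; exact: sqr_ge0.
  rewrite -[leRHS](Ex_cst P); apply: Ex_le => [||t]; last 1 first.
  + have -> : (4 : R) = 2 ^+ 2 by ring.
    rewrite ler_sqr ?nnegrE ?nm_ge0//; apply: (le_trans (nmB _ _)); rewrite nmRC.
    have [h0 h1] := andP h01; rewrite ger0_norm//.
    by have := H1 k t i i; lra.
  + apply: (@L1_bounded _ _ _ _ (2 ^+ 2)) => [|t].
      apply: measurable_funX; apply: measurable_nm.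
      by apply: cmeasurableB => //; exact: cmeasurable_cst.
    rewrite ger0_norm ?sqr_ge0// ler_sqr ?nnegrE ?nm_ge0//.
    apply: (le_trans (nmB _ _)); rewrite nmRC.
    have [h0 h1] := andP h01; rewrite ger0_norm//.
    by have := H1 k t i i; lra.
  + exact: L1_cst.
- by move=> i; exact: (contraction_row hW W0 W2 k01 i h01 hE a01).
- by rewrite /rowvar; field; exact: lt0r_neq0.
Qed.

End averaged_inequalities.
End single_matrix.

(** * The two implications along the sequence *)

Section wigner_sequence.
Context (R : realType) (d : nat -> measure_display)
  (T : forall n : nat, measurableType (d n)) (P : forall n : nat, probability (T n) R).
Variable W : forall n : nat, T n -> 'M[R[i]]_n.+1.
Hypothesis hW : forall n : nat, hermitian_wigner (P n) (@W n).
Hypothesis W0 : forall n (i j : 'I_n.+1), ccentered (P n) (fun t => W t i j).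
Hypothesis W2 : forall n (i j : 'I_n.+1), L1 (P n) (fun t => nm (W t i j) ^+ 2).
Local Notation s n := (mvar (P n) (@W n)).
Local Notation rho n := (rowvar (P n) (@W n)).
Local Notation avg n F := (n.+1%:R^-1 * \sum_(i < n.+1) F i).
Local Notation nu n := (expected_measure (P n) (fun t => esd (@W n t))).
Local Notation sc := (@semicircle R).
Hypothesis tail_small : forall e, 0 < e -> exists2 K, 1 <= K &
  \forall n \near \oo, n.+1%:R^-1 * tail_rows (s n) K <= e.
Hypothesis trunc_small : forall a, 0 < a ->
  n.+1%:R^-1 * \sum_i \sum_j mtrunc (P n) (@W n) a i j @[n --> \oo] --> (0 : R).

(** Rows below [K] contribute at most [K] to the average, and the others at most 1 for large [n]. *)
Let rho_bounded : exists2 B, 0 <= B & \forall n \near \oo, avg n (rho n) <= B.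
Proof.
have [K K1 hK] := tail_small ltr01.
exists (K + 1); first by rewrite addr_ge0// (le_trans ler01).
near=> n; have h : n.+1%:R^-1 * tail_rows (s n) K <= 1 by near: n.
have N0 : (0 : R) < n.+1%:R by rewrite ltr0n.
apply: le_trans (_ : _ <= K + n.+1%:R^-1 * tail_rows (s n) K) _; last by rewrite lerD2l.
rewrite ler_pdivrMl// mulrDr mulVKf ?lt0r_neq0//.
rewrite (bigID (fun i => rho n i <= K))/=; apply: lerD; last exact: lexx.
apply: (@le_trans _ _ (\sum_(i < n.+1) K)); last by rewrite sumr_const card_ord mulr_natl.
rewrite [leRHS](bigID (fun i => rho n i <= K))/=; apply: ler_wpDr.
  by apply: sumr_ge0 => i _; exact: le_trans ler01 K1.
exact: ler_sum.
Unshelve. all: by end_near. Qed.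

Let err_small e : 0 < e -> exists2 a, 0 < a <= 1 &
  \forall n \near \oo, avg n (row_error (P n) (@W n) a) <= e.
Proof.
move=> e0; have [B B0 hB] := rho_bounded.
have C0 : 0 < 1000 * (1 + B) by lra.
pose a := Num.min 1 (e / (1000 * (1 + B))).
have a0 : 0 < a by rewrite lt_min ltr01; exact: divr_gt0 e0 C0.
have a1 : a <= 1 by rewrite ge_min lexx.
have aB : a * (1000 * (1 + B)) <= e by rewrite -(ler_pdivlMr _ _ C0) ge_min lexx orbT.
exists a; first by rewrite a0.
have e1 : 0 < e / 1000 by lra.
(* The truncated moments are divided by [a] in the error, so the Lindeberg hypothesis, applied at
   the fixed level [a], is used with precision [a * (e / 1000)]. *)
have d0 := mulr_gt0 a0 e1.
have /cvgrPdist_le/(_ _ d0) ht := trunc_small a0.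
near=> n; rewrite avg_row_error.
have h1 : avg n (rho n) <= B by near: n.
have h2 : n.+1%:R^-1 * \sum_i \sum_j mtrunc (P n) (@W n) a i j <= a * (e / 1000).
  apply: (le_trans (ler_norm _)); rewrite -normrN -[X in `|X|]add0r.
  by near: n.
have h3 : a * (1 + avg n (rho n)) <= a * (1 + B) by rewrite ler_wpM2l ?(ltW a0)// lerD2l.
have h4 : (n.+1%:R^-1 * \sum_i \sum_j mtrunc (P n) (@W n) a i j) / a <= e / 1000.
  by rewrite (ler_pdivrMr _ _ a0) [X in _ <= X]mulrC.
apply: (@le_trans _ _ (500 * (a * (1 + B) + e / 1000))); last by lra.
apply: ler_wpM2l; [lra|exact: lerD h3 h4].
Unshelve. all: by end_near. Qed.

Let k01 (k : R) : 0 < k <= 1 / 2 -> 0 <= k <= 1.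
Proof. by case/andP => k0 k1; apply/andP; split; lra. Qed.

(** For [k <= 1 / 2] the factor [1 - k ^+ 2] is at least [3 / 4], so the contraction forces the
    averaged square deviation of [H_ii] from [h] to 0. This gives both families of test integrals,
    the imaginary parts because [h] is real. *)
Theorem weak_cvg_of_rho_deviation :
  avg n (fun i => `|rho n i - 1|) @[n --> \oo] --> (0 : R) -> weak_cvg (fun n => nu n) sc.
Proof.
move=> dev0.
have small_dev (k e : R) : 0 < k <= 1 / 2 -> 0 < e -> \forall n \near \oo,
    avg n (devE (P n) (@W n) k (Ex sc (qk k))) <= e.
  move=> kk e0; have [k0 k1] := andP kk.
  have [h0 h1 hE] := semicircle_fixed_point k0.
  have e4 : 0 < e / 4 by rewrite divr_gt0.
  have e8 : 0 < e / 8 by rewrite divr_gt0.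
  have [a a01 ha] := err_small e4.
  have /cvgrPdist_le/(_ _ e8) hd := dev0.
  near=> n.
  have r1 : avg n (row_error (P n) (@W n) a) <= e / 4 by near: n.
  have r2 : avg n (fun i => `|rho n i - 1|) <= e / 8.
    apply: (le_trans (ler_norm _)); rewrite -normrN -[X in `|X|]add0r.
    by near: n.
  have h01 : 0 <= Ex sc (qk k) <= 1 by rewrite h0.
  have := avg_contraction (hW n) (@W0 n) (@W2 n) (k01 kk) a01 h01 hE.
  have c1 : k ^+ 2 <= 1 / 4 by rewrite expr2; nra.
  have c0 : 0 <= k ^+ 2 by exact: sqr_ge0.
  have D0 : 0 <= avg n (fun i => `|rho n i - 1|).
    by rewrite mulr_ge0 ?invr_ge0// sumr_ge0.
  move: c0 c1 r1 r2 D0.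
  move: (avg n (devE _ _ _ _)) (avg n (row_error _ _ _)) (avg n (fun i => `|rho n i - 1|)).
  by move: (k ^+ 2) => c y E D; nra.
apply: semicircle_weak_cvg => k kk; have [k0 k1] := andP kk; apply/cvgrPdist_le => e e0.
  have e2 : 0 < e ^+ 2 by rewrite exprn_gt0.
  have sd := small_dev k _ kk e2.
  near=> n; rewrite distrC.
  apply: (le_trans (Ex_expected_esd_qk_deviation (hW n) k _ e0)).
  have h : avg n (devE (P n) (@W n) k (Ex sc (qk k))) <= e ^+ 2 by near: n.
  have r : avg n (devE (P n) (@W n) k (Ex sc (qk k))) / e <= e by rewrite ler_pdivrMr// -expr2.
  apply: (@le_trans _ _ ((e + e) / 2)); last by lra.
  by apply: ler_wpM2r; [lra|exact: lerD (lexx e) r].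
(* Imaginary parts yield [k] times the integral, hence the precision [k * e]. *)
have ke : 0 < k * e by rewrite mulr_gt0.
have e2 : 0 < (k * e) ^+ 2 by rewrite exprn_gt0.
have sd := small_dev k _ kk e2.
near=> n; rewrite sub0r normrN -(ler_pM2l k0) -[X in X * `|_|](gtr0_norm k0) -normrM.
apply: (le_trans (Ex_expected_esd_xqk_deviation (hW n) (Ex sc (qk k)) ke k0)).
have h : avg n (devE (P n) (@W n) k (Ex sc (qk k))) <= (k * e) ^+ 2 by near: n.
have r : avg n (devE (P n) (@W n) k (Ex sc (qk k))) / (k * e) <= k * e.
  by rewrite ler_pdivrMr// -expr2.
apply: (@le_trans _ _ ((k * e + k * e) / 2)); last by lra.
by apply: ler_wpM2r; [lra|exact: lerD (lexx (k * e)) r].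
Unshelve. all: by end_near. Qed.

Theorem rho_deviation_of_weak_cvg : weak_cvg (fun n => nu n) sc ->
  avg n (fun i => `|rho n i - 1|) @[n --> \oo] --> (0 : R).
Proof.
move=> wc.
apply: (@deviation_cvg0 R (fun n => avg n (rho n)) _
  (fun K n => n.+1%:R^-1 * tail_rows (s n) K)
  (fun K n => n.+1%:R^-1 * bulk_square (s n) K)
  (fun k n => Ex (nu n) (qk k))
  (fun k n => n.+1%:R^-1 * decorrelation (s n) (dE (P n) (@W n) k))
  (fun a n => avg n (row_error (P n) (@W n) a))
  (fun k => Ex sc (qk k))) => //.
- move=> k kk; apply: (weak_cvg_Ex (M := 1) wc); first exact: continuous_qk.
  by move=> x; rewrite ger0_norm ?qk_ge0 ?qk_le1.
- exact: semicircle_fixed_point.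
- by move=> k n kk; exact: (avg_decorrelation_ge0 (hW n)).
- by move=> K k n K1 /k01 kk; exact: (avg_decorrelation_le (hW n) (@W2 n) kk K1).
- by move=> k a n /k01 kk a01; exact: (avg_loop_equation (hW n) (@W0 n) (@W2 n) kk a01).
- move=> K k a n K1 /k01 kk a01.
  exact: (avg_bulk_square_le (hW n) (@W0 n) (@W2 n) kk a01 K1).
- by move=> K u n K1 u0; exact: (avg_rho_deviation_le (hW n) K1 u0).
- by move=> n; rewrite mulr_ge0 ?invr_ge0// sumr_ge0.
Qed.

End wigner_sequence.

(* The index [n] stands for the matrix size [n.+1]. *)
Theorem theorem1p6 (R : realType) (d : nat -> measure_display)
    (T : forall n : nat, measurableType (d n))
    (P : forall n : nat, probability (T n) R)
    (W : forall n : nat, T n -> 'M[R[i]]_n.+1)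
    (wignerW : forall n : nat, hermitian_wigner (P n) (W n))
    (W_centered : forall (n : nat) (i j : 'I_n.+1),
      ccentered (P n) (fun t => W n t i j))
    (W_L2 : forall (n : nat) (i j : 'I_n.+1),
      (second_moment (P n) (fun t => W n t i j) < +oo)%E)
    (small_rows : forall J : forall n : nat, {set 'I_n.+1},
      #|J n|%:R / n.+1%:R @[n --> \oo] --> (0 : R) ->
      ((n.+1%:R^-1)%:E * \sum_(i in J n) \sum_(j < n.+1)
         second_moment (P n) (fun t => W n t i j) @[n --> \oo] --> 0)%E)
    (lindeberg : forall eps : R, 0 < eps ->
      ((n.+1%:R^-1)%:E * \sum_(i < n.+1) \sum_(j < n.+1)
         truncated_second_moment (P n) eps (fun t => W n t i j)
         @[n --> \oo] --> 0)%E) :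
  weak_cvg (fun n => expected_measure (P n) (fun t => esd (W n t)))
    (@semicircle R) <->
  ((n.+1%:R^-1)%:E * \sum_(i < n.+1)
     `| \sum_(j < n.+1) second_moment (P n) (fun t => W n t i j) - 1 |
     @[n --> \oo] --> 0)%E.
Proof.
(* Finite second moments make every expectation in the statement a real number, so the extended-real
   hypotheses and the criterion pass to real sequences. *)
have W2 n i j := L1_of_second_moment (wignerW n) (W_L2 n i j).
have sE n i j : second_moment (P n) (fun t => W n t i j) = (mvar (P n) (W n) i j)%:E.
  exact: expectationE (W2 n i j).
have tE n e i j : truncated_second_moment (P n) e (fun t => W n t i j) =
    (mtrunc (P n) (W n) e i j)%:E.
  exact/expectationE/L1_truncm/W2/(wigner_cmeasurable (wignerW n)).
have devE : (fun n => (n.+1%:R^-1)%:E * \sum_(i < n.+1)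
      `| \sum_(j < n.+1) second_moment (P n) (fun t => W n t i j) - 1 |)%E =
    (fun n => (n.+1%:R^-1 * \sum_i `|rowvar (P n) (W n) i - 1|)%:E).
  apply/funext => n; rewrite EFinM -sumEFin; congr (_ * _)%E; apply: eq_bigr => i _.
  by under eq_bigr do rewrite sE; rewrite sumEFin.
have small (J : forall n : nat, {set 'I_n.+1}) :
    #|J n|%:R / n.+1%:R @[n --> \oo] --> (0 : R) ->
    n.+1%:R^-1 * \sum_(i in J n) rowvar (P n) (W n) i @[n --> \oo] --> (0 : R).
  move=> /small_rows h; apply/cvgn_EFinP; apply: cvg_trans h.
  apply: near_eq_cvg; apply: nearW => n; rewrite EFinM -sumEFin; congr (_ * _)%E; apply: eq_bigr => i _.
  by under eq_bigr do rewrite sE; rewrite sumEFin.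
have trunc_small a : 0 < a ->
    n.+1%:R^-1 * \sum_i \sum_j mtrunc (P n) (W n) a i j @[n --> \oo] --> (0 : R).
  move=> /lindeberg h; apply/cvgn_EFinP; apply: cvg_trans h.
  apply: near_eq_cvg; apply: nearW => n; rewrite EFinM -sumEFin; congr (_ * _)%E; apply: eq_bigr => i _.
  by under eq_bigr do rewrite tE; rewrite sumEFin.
have tail_small := rows_tail_small (fun n i => rowvar_ge0 (P n) (W n) i) small.
rewrite devE; split => h.
  by apply/cvgn_EFinP; exact: rho_deviation_of_weak_cvg.
by apply: weak_cvg_of_rho_deviation => //; apply/cvgn_EFinP.
Qed.
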